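(* Let $s\in(0,1)$, let $n\ge1$ be an integer with $n>2s$, and let $1<p<\frac{n+2s}{n-2s}$. Then there exists a constant $C$, depending only on $n$, $s$ and $p$, such that for every weak solution $u\in H^s_{\mathbb{R}^n_+}\cap L^\infty(\mathbb{R}^n_+)$ of $$\begin{cases}(-\Delta)^s u=u^p & \text{in }\mathbb{R}^n_+,\\ u\ge0 & \text{in }\mathbb{R}^n_+,\\ \mathcal N_su=0 & \text{in }\mathbb{R}^n_-,\end{cases}$$ one has $$u(x)+|\nabla u(x)|^{\frac{2s}{2s+p-1}}\le C\,x_n^{-\frac{2s}{p-1}}\qquad\text{for all }x\in\mathbb{R}^n_+ .$$
   Context: Notation: $\mathbb{R}^n_+=\{x\in\mathbb{R}^n: x_n>0\}$, $\mathbb{R}^n_-=\{x\in\mathbb{R}^n: x_n<0\}$, $T(\mathbb{R}^n_+)=\mathbb{R}^{2n}\setminus(\mathbb{R}^n_-)^2$, $2^*_s=\frac{2n}{n-2s}$. $c_{n,s}>0$ is the normalization constant of the fractional Laplacian $(-\Delta)^su(x)=c_{n,s}\,\mathrm{PV}\int_{\mathbb{R}^n}\frac{u(x)-u(y)}{|x-y|^{n+2s}}dy$, and $\mathcal N_su(x)=c_{n,s}\int_{\mathbb{R}^n_+}\frac{u(x)-u(y)}{|x-y|^{n+2s}}dy$ for $x\in\mathbb{R}^n_-$. $H^s_{\mathbb{R}^n_+}$ is the space of measurable $u:\mathbb{R}^n\to\mathbb{R}$ with $u\in L^{2^*_s}(\mathbb{R}^n_+)$ and $\iint_{T(\mathbb{R}^n_+)}\frac{(u(x)-u(y))^2}{|x-y|^{n+2s}}dxdy<\infty$.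 Weak solution: $u\in H^s_{\mathbb{R}^n_+}$ with $u\ge0$ a.e. in $\mathbb{R}^n_+$ such that for every $v\in H^s_{\mathbb{R}^n_+}$ (the integral on the right being required to converge) $$\frac{c_{n,s}}{2}\iint_{T(\mathbb{R}^n_+)}\frac{(u(x)-u(y))(v(x)-v(y))}{|x-y|^{n+2s}}\,dx\,dy=\int_{\mathbb{R}^n_+}u^pv\,dx .$$ Such a weak solution is identified with its representative that is continuously differentiable in $\mathbb{R}^n_+$. *)

(* Defs.v *)
From HB Require Import structures.
From mathcomp Require Import all_boot all_order all_algebra.
From mathcomp Require Import all_classical all_reals all_analysis.
Set Implicit Arguments.
Unset Strict Implicit.
Unset Printing Implicit Defensive.
Import Order.TTheory GRing.Theory Num.Theory.
Import numFieldNormedType.Exports.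
Local Open Scope classical_set_scope.
Local Open Scope ring_scope.

(* The sigma-algebra on row vectors generated by the coordinates, as the one
   the library puts on [n.-tuple T].  Over a [realType] it is the Borel
   sigma-algebra of R^n. *)
Definition measure_rV_display : measure_display -> measure_display.
Proof. exact. Qed.

Section measurable_rV.
Context {d} {T : sigmaRingType d}.
Variable n : nat.

Let coors : 'I_n -> 'rV[T]_n -> T := fun i x => x ord0 i.

Let rV_set0 : g_sigma_preimage coors set0.
Proof. exact: sigma_algebra0. Qed.

Let rV_setC A : g_sigma_preimage coors A -> g_sigma_preimage coors (~` A).
Proof. exact: sigma_algebraC. Qed.

Let rV_bigcup (F : (set 'rV[T]_n)^nat) : (forall i, g_sigma_preimage coors (F i)) ->
  g_sigma_preimage coors (\bigcup_i (F i)).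
Proof. exact: sigma_algebra_bigcup. Qed.

HB.instance Definition _ := @isMeasurable.Build (measure_rV_display d)
  'rV[T]_n (g_sigma_preimage coors) rV_set0 rV_setC rV_bigcup.

End measurable_rV.

Lemma measurable_coord d (T : sigmaRingType d) n (i : 'I_n) :
  measurable_fun [set: 'rV[T]_n] (fun x : 'rV[T]_n => x ord0 i).
Proof.
move=> _ Y mY; rewrite setTI; apply: sub_sigma_algebra => /=.
rewrite -bigcup_seq/=; exists i => /=; first by rewrite mem_index_enum.
by exists Y => //; rewrite setTI.
Qed.

Lemma measurable_fun_coordP d1 d2 (T1 : measurableType d1)
    (T2 : measurableType d2) n (f : T1 -> 'rV[T2]_n) :
  (forall i, measurable_fun [set: T1] (fun x => f x ord0 i)) ->
  measurable_fun [set: T1] f.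
Proof.
move=> mf _ A mA; rewrite setTI.
suff : (g_sigma_preimage (fun (i : 'I_n) (x : 'rV[T2]_n) => x ord0 i))
    `<=` [set B | measurable (f @^-1` B)] by apply.
apply: smallest_sub.
  split => /=.
  - by rewrite preimage_set0.
  - by move=> B mB; rewrite setTD -preimage_setC; exact: measurableC.
  - by move=> F mF; rewrite preimage_bigcup; exact: bigcup_measurable.
rewrite -bigcup_seq/=; apply: bigcup_sub => i _ B /= [C mC <-].
by rewrite setTI -[X in measurable X]setTI; exact: mf.
Qed.

Section lebesgue_rV.
Variable R : realType.

Let cons_rV n (z : R * 'rV[R]_n) : 'rV[R]_n.+1 := row_mx z.1%:M z.2.
Let uncons_rV n (x : 'rV[R]_n.+1) : R * 'rV[R]_n :=
  (x ord0 ord0, \row_i x ord0 (lift ord0 i)).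

Let cons_rV0 n (z : R * 'rV[R]_n) : cons_rV z ord0 ord0 = z.1.
Proof.
rewrite /cons_rV mxE; case: splitP => [j _|j]; last by case: n z j.
by rewrite (ord1 j) mxE eqxx mulr1n.
Qed.

Let cons_rVS n (z : R * 'rV[R]_n) i : cons_rV z ord0 (lift ord0 i) = z.2 ord0 i.
Proof.
rewrite /cons_rV mxE; case: splitP => [j|j /= ij].
  by rewrite (ord1 j).
by congr (_ _ _); apply/val_inj; case: ij.
Qed.

Let uncons_rVK n : cancel (@cons_rV n) (@uncons_rV n).
Proof.
move=> [a v]; rewrite /uncons_rV cons_rV0; congr pair.
by apply/rowP => i; rewrite mxE cons_rVS.
Qed.

Let measurable_cons_rV n : measurable_fun [set: measurableTypeR R * 'rV[R]_n] (@cons_rV n).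
Proof.
apply: measurable_fun_coordP => i; case: (unliftP ord0 i) => [j|] ->.
  under eq_fun do rewrite cons_rVS.
  by apply: (measurableT_comp (measurable_coord j)).
by under eq_fun do rewrite cons_rV0; exact: measurable_fst.
Qed.

Let measurable_uncons_rV n : measurable_fun [set: 'rV[R]_n.+1]
  (@uncons_rV n : _ -> measurableTypeR R * 'rV[R]_n).
Proof.
apply: measurable_fun_pair; first exact: measurable_coord.
apply: measurable_fun_coordP => i; under eq_fun do rewrite mxE.
exact: measurable_coord.
Qed.

Section step.
Variables (n : nat) (mu : {sigma_finite_measure set 'rV[R]_n -> \bar R}).

Definition lebesgue_rV_step : set 'rV[R]_n.+1 -> \bar R :=
  pushforward (@lebesgue_measure R \x mu)%E (@cons_rV n).

HB.instance Definition _ := Measure.copy lebesgue_rV_step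
  (measure_function_pushforward__canonical__measure_function_Measure
     (@lebesgue_measure R \x mu)%E (@measurable_cons_rV n)).

Let sigma_finite_step : sigma_finite setT lebesgue_rV_step.
Proof.
have /sigma_finiteP[F [TF ndF Foo]] := sigma_finiteT (@lebesgue_measure R).
have /sigma_finiteP[G [TG ndG Goo]] := sigma_finiteT mu.
exists (fun k => @uncons_rV n @^-1` (F k `*` G k)).
  rewrite -preimage_bigcup -(@preimage_setT _ _ (@uncons_rV n)).
  congr (_ @^-1` _); apply/esym; rewrite -subTset => -[x y] _.
  have : (\bigcup_k F k) x by rewrite -TF.
  have : (\bigcup_k G k) y by rewrite -TG.
  move=> [j _ Gy] [i _ Fx]; exists (maxn i j) => //; split.
  - by move: x Fx; exact/subsetPset/ndF/leq_maxl.
  - by move: y Gy; exact/subsetPset/ndG/leq_maxr.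
move=> k; have [mFk Fk] := Foo k; have [mGk Gk] := Goo k; split.
  rewrite -[X in measurable X]setTI; apply: measurable_uncons_rV => //.
  exact: measurableX.
rewrite /lebesgue_rV_step /pushforward -comp_preimage.
rewrite (_ : _ \o _ = id) ?preimage_id.
  by rewrite product_measure1E// lte_mul_pinfty// ge0_fin_numE.
by apply/funext => z /=; rewrite uncons_rVK.
Qed.

HB.instance Definition _ :=
  Measure_isSigmaFinite.Build _ _ _ lebesgue_rV_step sigma_finite_step.

End step.

Fixpoint lebesgue_rV n : {sigma_finite_measure set 'rV[R]_n -> \bar R} :=
  match n with
  | 0 => dirac (0 : 'rV[R]_0)
  | k.+1 => lebesgue_rV_step (lebesgue_rV k)
  end.

Lemma lebesgue_rV_box n (A : 'I_n -> set R) : (forall i, measurable (A i)) ->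
  lebesgue_rV n [set x : 'rV[R]_n | forall i, A i (x ord0 i)] =
  (\prod_(i < n) lebesgue_measure (A i))%E.
Proof.
elim: n A => [|n IHn] A mA /=.
  by rewrite big_ord0 diracE mem_set// => -[].
rewrite big_ord_recl -(IHn (fun i => A (lift ord0 i)))//.
have mB : measurable [set x : 'rV[R]_n | forall i, A (lift ord0 i) (x ord0 i)].
  rewrite [X in measurable X](_ : _ = \bigcap_(i in [set: 'I_n])
      ((fun x : 'rV[R]_n => x ord0 i) @^-1` A (lift ord0 i))); last first.
    by apply/seteqP; split=> x /= Ax i => [_|]; exact: Ax.
  apply: fin_bigcap_measurable => // i _.
  by rewrite -[X in measurable X]setTI; exact: measurable_coord.
rewrite /lebesgue_rV_step /pushforward -product_measure1E//; last exact: mA.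
congr (_ _); apply/seteqP; split=> z /=.
  move=> Az; split=> [|i]; first by have := Az ord0; rewrite cons_rV0.
  by have := Az (lift ord0 i); rewrite cons_rVS.
move=> [Az1 Az2] i; case: (unliftP ord0 i) => [j|] ->.
  by rewrite cons_rVS; exact: Az2.
by rewrite cons_rV0.
Qed.

End lebesgue_rV.

Definition enorm (R : realType) n (x : 'rV[R]_n) : R :=
  Num.sqrt (\sum_i x ord0 i ^+ 2).

Definition grad (R : realType) n (u : 'rV[R]_n -> R) (x : 'rV[R]_n) : 'rV[R]_n :=
  \row_i 'D_(delta_mx ord0 i) u x.

(* [A] is meant to be open. *)
Definition continuously_differentiable_on (R : realType) n (A : set 'rV[R]_n)
    (u : 'rV[R]_n -> R) : Prop :=
  forall x, A x -> forall i,
    derivable u x (delta_mx ord0 i) /\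
    {for x, continuous (fun y => grad u y ord0 i)}.

(* The dimension is [m.+1], so that the last coordinate is [ord_max]. *)
Definition upper_half (R : realType) m : set 'rV[R]_m.+1 :=
  [set x | 0 < x ord0 ord_max].

Definition lower_half (R : realType) m : set 'rV[R]_m.+1 :=
  [set x | x ord0 ord_max < 0].

Definition T_upper (R : realType) m : set ('rV[R]_m.+1 * 'rV[R]_m.+1) :=
  ~` (@lower_half R m `*` @lower_half R m).

Definition critical_exponent (R : realType) (n : nat) (s : R) : R :=
  2 * n%:R / (n%:R - 2 * s).

(* The factor [c_{n,s}] for which [(-Delta)^s] has Fourier symbol
   [|xi|^(2s)]. *)
Definition frac_laplacian_const (R : realType) m (s : R) : R :=
  (fine (\int[lebesgue_rV R m.+1]_z
     ((1 - cos (z ord0 ord0)) / enorm z `^ (m.+1%:R + 2 * s))%:E))^-1.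

(* The integrands below are [0] on the diagonal, since [0^-1 = 0]. *)
Definition gagliardo_integrand (R : realType) m (s : R) (u v : 'rV[R]_m.+1 -> R)
    (z : 'rV[R]_m.+1 * 'rV[R]_m.+1) : R :=
  (u z.1 - u z.2) * (v z.1 - v z.2) / enorm (z.1 - z.2) `^ (m.+1%:R + 2 * s).

Definition gagliardo_form (R : realType) m (s : R) (u v : 'rV[R]_m.+1 -> R)
    : \bar R :=
  (\int[lebesgue_rV R m.+1 \x lebesgue_rV R m.+1]_(z in @T_upper R m)
     (gagliardo_integrand s u v z)%:E)%E.

Definition Hs_upper (R : realType) m (s : R) (u : 'rV[R]_m.+1 -> R) : Prop :=
  [/\ measurable_fun setT u,
      (\int[lebesgue_rV R m.+1]_(x in @upper_half R m)
         (`|u x| `^ critical_exponent m.+1 s)%:E < +oo)%E &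
      (gagliardo_form s u u < +oo)%E].

Definition bounded_ae_upper (R : realType) m (u : 'rV[R]_m.+1 -> R) : Prop :=
  exists M : R,
    {ae lebesgue_rV R m.+1, forall x, upper_half x -> `|u x| <= M}.

Definition weak_solution (R : realType) m (s p : R) (u : 'rV[R]_m.+1 -> R)
    : Prop :=
  [/\ Hs_upper s u,
      {ae lebesgue_rV R m.+1, forall x, upper_half x -> 0 <= u x} &
      forall v, Hs_upper s v ->
        (lebesgue_rV R m.+1).-integrable (@upper_half R m)
          (fun x => (u x `^ p * v x)%:E) /\
        ((frac_laplacian_const m s / 2)%:E * gagliardo_form s u v =
         \int[lebesgue_rV R m.+1]_(x in @upper_half R m)
           (u x `^ p * v x)%:E)%E].

(* Main.v *)
Require Import Defs.
From HB Require Import structures.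
From mathcomp Require Import all_boot all_order all_algebra.
From mathcomp Require Import ring lra.
From mathcomp Require Import all_classical all_reals all_analysis.
From mathcomp Require Import measurable_realfun.
Set Implicit Arguments.
Unset Strict Implicit.
Unset Printing Implicit Defensive.
Import Order.TTheory GRing.Theory Num.Theory.
Import numFieldNormedType.Exports.
Local Open Scope classical_set_scope.
Local Open Scope ring_scope.

(* The equation has no nonzero solution of finite energy, so u vanishes on the
   upper half-space and the bound holds with C = 0.

   This is the Pohozaev argument for the dilations x |-> x + t x, which preserve both
   half-spaces.  Let E be the Gagliardo energy of u over T(R^n_+), Q the integral
   of u^(p+1), and c = c_{n,s} / 2.  Testing with u gives c E = Q.  Write a field as
   phi(x) e_i and let Psi be the inverse of x |-> x + t phi(x) e_i.  Convexity of the
   energy and a Taylor bound on u^(p+1) give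
     0 <= c (E(u o Psi) - E(u)) - 2/(p+1) (Q(u o Psi) - Q(u)) + C |u o Psi - u|_2^2,
   and if the last term is o(t) then, dividing by t,
     2/(p+1) Q'(phi) <= c E'(phi)
   for the first variations Q', E'.  Each coordinate field x_i e_i is treated
   separately, after truncation, and the truncation is removed by dominated
   convergence.  Summing over i gives 2n/(p+1) Q <= (n - 2s) c E = (n - 2s) Q, and
   subcriticality of p forces Q = 0.

   Why |u o Psi - u|_2^2 = o(t): for the normal coordinate the truncated field is
   supported, within the upper half-space, in a compact set on which u is C^1.  For
   a tangential coordinate, finite energy gives |u(. + t e_i) - u|_2^2 = O(t^(2s))
   only; but translations preserve E and Q, so the comparison above bounds the
   energy of u(. + t e_i) - u by its L^2 norm, and this improves the decay to
   t^(log 3 / log 2). *)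

(** * Changes of variables on row vectors *)

(** Working one coordinate at a time keeps the geometry elementary: x |-> x + t phi(x) e_i preserves
    every line parallel to e_i, so its change of variables reduces by Fubini to the line, and its
    Jacobian 1 + t d_i phi is affine in t. One-sided estimates are enough. Only t > 0 and an upper
    bound for E(u o Psi) enter, and the inequality obtained for each i already has the sign that
    excludes Q > 0 after summation. For the field x_i e_i the logarithmic derivative of the
    transported kernel is 2 - (n + 2s) z_i^2 / |z|^2 with z = x - y; summed over i this is 2n - (n +
    2s) = n - 2s. The obstacle is the L^2 remainder: u is not known to have a derivative in L^2 or
    bounds on its gradient near the boundary, and a tangential field does act near the boundary. The
    exponent log 3 / log 2 matters only because it exceeds 1; second differences would allow any
    factor below 4 in place of 3, and any factor above 2 is sufficient. *)

Section density.
Context d (T : measurableType d) (R : realType).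
Variables (mu : {measure set T -> \bar R}) (j : T -> R).
Hypotheses (mj : measurable_fun setT j) (j0 : forall x, 0 <= j x).

(** The two hypotheses are arguments so that a term [density_measure mj j0] determines them and can
    carry a canonical measure structure. *)
Definition density_measure (_ : measurable_fun setT j) (_ : forall x, 0 <= j x)
  (A : set T) : \bar R := (\int[mu]_(x in A) (j x)%:E)%E.

Local Notation nu := (density_measure mj j0).

Let nu0 : nu set0 = 0%E. Proof. exact: integral_set0. Qed.

Let nu_ge0 A : (0 <= nu A)%E.
Proof. by apply: integral_ge0 => x _; rewrite lee_fin. Qed.

Let nu_sigma_additive : semi_sigma_additive nu.
Proof.
apply: semi_sigma_additive_nng_induced; last by move=> x; rewrite lee_fin.
exact/measurable_EFinP.
Qed.

HB.instance Definition _ := isMeasure.Build _ _ _ nu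
  nu0 nu_ge0 nu_sigma_additive.

Import HBNNSimple.

(** Monotone convergence along simple approximations of [f], applied to both sides, reduces the
    identity to indicators of level sets, where it is the definition of the measure. *)
Lemma ge0_integral_density (f : T -> \bar R) :
  measurable_fun setT f -> (forall x, 0 <= f x)%E ->
  (\int[nu]_x f x = \int[mu]_x (f x * (j x)%:E))%E.
Proof.
move=> mf f0.
pose g := nnsfun_approx measurableT mf.
have cvgg x : (EFin \o g^~ x) @ \oo --> f x.
  by apply: cvg_nnsfun_approx.
have -> : (\int[nu]_x f x = limn (fun n => \int[nu]_x (g n x)%:E))%E.
  rewrite -monotone_convergence//.
  - apply: eq_integral => x _; apply/esym/cvg_lim => //; exact: cvgg.
  - by move=> n; exact/measurable_EFinP.
  - by move=> n x _; rewrite lee_fin.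
  - by move=> x _ a b ab; rewrite lee_fin; exact/lefP/nd_nnsfun_approx.
have -> : (\int[mu]_x (f x * (j x)%:E) =
    limn (fun n => \int[mu]_x ((g n x)%:E * (j x)%:E)))%E.
  rewrite -monotone_convergence//.
  - apply: eq_integral => x _; apply/esym/cvg_lim => //.
    by apply: cvgeZr => //; exact: cvgg.
  - move=> n; apply: emeasurable_funM; exact/measurable_EFinP.
  - by move=> n x _; rewrite mule_ge0// lee_fin.
  - move=> x _ a b ab; rewrite lee_wpmul2r// ?lee_fin//.
    exact/lefP/nd_nnsfun_approx.
congr (limn _); apply/funext => n.
rewrite integralT_nnsfun sintegralE.
under [RHS]eq_integral => x _.
  rewrite fimfunE -fsumEFin// ge0_mule_fsuml; last first.
    by move=> i; rewrite EFinM nnfun_muleindic_ge0.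
  over.
rewrite ge0_integral_fsum//; last 2 first.
  - move=> r; apply: emeasurable_funM; last exact/measurable_EFinP.
    by apply/measurable_EFinP/measurable_funM => //; exact: measurable_indic.
  - by move=> r x _; rewrite mule_ge0 ?EFinM ?nnfun_muleindic_ge0 ?lee_fin.
apply: eq_fsbigr => r _.
have [r0|r0] := leP 0 r; last first.
  rewrite preimage_nnfun0// measure0 mule0.
  by rewrite integral0_eq// => x _; rewrite indic0 mulr0 mul0e.
under [RHS]eq_integral do rewrite EFinM -muleA.
rewrite ge0_integralZl//; last 2 first.
- apply: emeasurable_funM; exact/measurable_EFinP.
- by move=> x _; rewrite mule_ge0// lee_fin.
congr (_ * _)%E.
rewrite -[LHS]/(\int[mu]_(x in g n @^-1` [set r]) (j x)%:E)%E integral_mkcond.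
apply: eq_integral => x _; rewrite /patch indicE.
by case: ifPn => xA; rewrite ?mul1e ?mul0e.
Qed.

End density.

Section substitution.
Variable R : realType.
Local Notation mu := (@lebesgue_measure R).

(** Pushed forward by [psi], the measure with density [j] agrees with Lebesgue measure on half-open
    intervals, hence everywhere. The Jacobian is prescribed by its integrals over intervals and not
    as a derivative, because the profiles used later have kinks. *)
Lemma ge0_integral_substitution (psi psi' j : R -> R) :
  cancel psi psi' -> cancel psi' psi -> {homo psi : a b / a <= b} ->
  measurable_fun setT j -> (forall x, 0 <= j x) ->
  (forall a b, a <= b -> (\int[mu]_(x in `]a, b]) (j x)%:E = (psi b - psi a)%:E)%E) ->
  forall f : R -> \bar R, measurable_fun setT f -> (forall x, 0 <= f x)%E ->
  (\int[mu]_x (f (psi x) * (j x)%:E) = \int[mu]_x f x)%E.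
Proof.
move=> psiK psi'K psi_le mj j0 psiE f mf f0.
have mpsi : measurable_fun setT (psi : measurableTypeR R -> measurableTypeR R).
  by apply: nondecreasing_measurable => //.
rewrite -(@ge0_integral_density _ _ _ mu j mj j0 (f \o psi)); last 2 first.
- exact: measurableT_comp.
- by move=> x /=.
have := @ge0_integral_pushforward _ _ _ _ _ _ mpsi (density_measure mu mj j0)
  setT f measurableT mf (fun x _ => f0 x).
rewrite preimage_setT => <-; apply/esym; apply: eq_measure_integral => A mA _.
apply: (lebesgue_measure_unique (mu := pushforward _ _)) => // _ [[a b] _ <-] /=.
rewrite /pushforward.
have psi_lt x y : (psi x < psi y) = (x < y).
  apply/idP/idP => [|xy]; first by apply: contraTT; rewrite -!leNgt => /psi_le.
  by rewrite lt_neqAle psi_le ?ltW// andbT (can_eq psiK) lt_eqF.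
have pl x y : (psi x <= y) = (x <= psi' y).
  by rewrite -{1}(psi'K y) leNgt psi_lt -leNgt.
have lp x y : (y < psi x) = (psi' y < x) by rewrite -{1}(psi'K y) psi_lt.
have -> : psi @^-1` `]a, b]%classic = `]psi' a, psi' b]%classic.
  by apply/seteqP; split => x /=; rewrite !in_itv/= pl lp.
rewrite lebesgue_measure_itv/= lte_fin /density_measure.
case: ltP => [ab|ba].
  by rewrite psiE ?psi'K// -[_ <= _]negbK -ltNge -psi_lt !psi'K -leNgt ltW.
rewrite set_itv_ge ?integral_set0//.
by rewrite bnd_simp -leNgt leNgt -psi_lt !psi'K -leNgt.
Qed.

End substitution.

Section slicing.
Variable R : realType.
Local Notation mu := (@lebesgue_measure R).

Definition ins n (i : 'I_n.+1) (z : R * 'rV[R]_n) : 'rV[R]_n.+1 :=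
  \row_k (if unlift i k is Some j then z.2 ord0 j else z.1).

Lemma ins_same n (i : 'I_n.+1) z : ins i z ord0 i = z.1.
Proof. by rewrite mxE unlift_none. Qed.

Lemma ins_lift n (i : 'I_n.+1) z j : ins i z ord0 (lift i j) = z.2 ord0 j.
Proof. by rewrite mxE liftK. Qed.

Lemma measurable_ins n (i : 'I_n.+1) :
  measurable_fun [set: measurableTypeR R * 'rV[R]_n] (ins i).
Proof.
apply: measurable_fun_coordP => k; case: (unliftP i k) => [j|] ->.
  under eq_fun do rewrite ins_lift.
  by apply: (measurableT_comp (measurable_coord j)).
by under eq_fun do rewrite ins_same; exact: measurable_fst.
Qed.

Definition rV_box n (A : 'I_n -> set R) : set 'rV[R]_n :=
  [set x | forall i, A i (x ord0 i)].

Definition rV_ball n (k : nat) : set 'rV[R]_n := rV_box (fun=> `]- k%:R, k%:R[%classic).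

Definition rV_boxes n : set (set 'rV[R]_n) :=
  [set B | exists2 A, (forall i, measurable (A i)) & B = rV_box A].

Lemma measurable_rV_box n (A : 'I_n -> set R) :
  (forall i, measurable (A i)) -> measurable (rV_box A).
Proof.
move=> mA; rewrite [X in measurable X](_ : _ = \bigcap_(i in [set: 'I_n])
    ((fun x : 'rV[R]_n => x ord0 i) @^-1` A i)); last first.
  by apply/seteqP; split=> x /= Ax i => [_|]; exact: Ax.
apply: fin_bigcap_measurable => // i _.
by rewrite -[X in measurable X]setTI; exact: measurable_coord.
Qed.

Lemma measurable_rV_boxesE n :
  @measurable _ 'rV[R]_n = <<s @rV_boxes n >>.
Proof.
apply/seteqP; split; last first.
  apply: smallest_sub; first exact: sigma_algebra_measurable.
  by move=> _ [A mA ->]; exact: measurable_rV_box.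
apply: smallest_sub; first exact: smallest_sigma_algebra.
rewrite -bigcup_seq/=; apply: bigcup_sub => i _ B /= [C mC <-].
apply: sub_sigma_algebra; exists (fun k => if k == i then C else setT).
  by move=> k; case: ifP.
apply/seteqP; split => x /=; rewrite /rV_box /=.
  by move=> [_ Cx] k; case: eqP => // ->.
by move=> /(_ i); rewrite eqxx.
Qed.

(** Boxes form a pi-system that generates the sigma-algebra, and the cubes [rV_ball] exhaust the
    space. *)
Lemma measure_rV_unique n (m1 m2 : {measure set 'rV[R]_n -> \bar R}) :
  (forall A : 'I_n -> set R, (forall i, measurable (A i)) ->
     m1 (rV_box A) = m2 (rV_box A)) ->
  (forall k : nat, m1 (@rV_ball n k) < +oo)%E ->
  forall A, measurable A -> m1 A = m2 A.
Proof.
move=> m12 fin A mA.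
apply: (measure_unique (@rV_boxes n) (@rV_ball n))
  => //.
- exact: measurable_rV_boxesE.
- move=> _ _ [B mB ->] [C mC ->]; exists (fun i => B i `&` C i).
    by move=> i; exact: measurableI.
  by apply/seteqP; split => x /= => [[Bx Cx] i|BCx]; [split|split => i; have [] := BCx i].
- by move=> i; exists (fun=> `]- i%:R, i%:R[%classic) => // k; exact: measurable_itv.
- rewrite -subTset => x _.
  exists (Num.truncn (\sum_i `|x ord0 i|)).+1 => // i /=.
  rewrite in_itv/= -ltr_norml; apply: le_lt_trans (truncnS_gt _).
  by rewrite (bigD1 i)//= lerDl sumr_ge0.
- by move=> _ [B mB ->]; exact: m12.
Qed.

Definition slice_measure n (i : 'I_n.+1) : {measure set 'rV[R]_n.+1 -> \bar R} :=
  Measure.clone _ _ _ (pushforward (mu \x lebesgue_rV R n)%E (ins i))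
  (measure_function_pushforward__canonical__measure_function_Measure
     (mu \x lebesgue_rV R n)%E (measurable_ins i)).

(** [lebesgue_rV] is built by splitting off coordinate 0. Comparison on boxes shows that any
    coordinate may be split off instead, which gives Fubini along the lines parallel to e_i. *)
Lemma lebesgue_rV_slice n (i : 'I_n.+1) A : measurable A ->
  lebesgue_rV R n.+1 A = (mu \x lebesgue_rV R n)%E (ins i @^-1` A).
Proof.
move=> mA.
rewrite -[RHS]/(slice_measure i A); apply: measure_rV_unique => //.
  move=> B mB; transitivity (\prod_k mu (B k))%E; first exact: lebesgue_rV_box.
  rewrite (bigD1_ord i)//=.
  have /= <- := lebesgue_rV_box (fun j => mB (lift i j)).
  rewrite /slice_measure /= /pushforward -product_measure1E; last 2 first.
  - exact: mB.
  - exact: (measurable_rV_box (A := fun j => B (lift i j))).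
  congr (_ _); apply/seteqP; split => z /=.
    move=> [Bz1 Bz2] k; case: (unliftP i k) => [j|] ->.
      by rewrite ins_lift; exact: Bz2.
    by rewrite ins_same.
  move=> Bz; split; first by have := Bz i; rewrite ins_same.
  by move=> j; have := Bz (lift i j); rewrite ins_lift.
move=> k; rewrite [X in (X < _)%E](_ : _ = \prod_(i < n.+1) mu `](- k%:R)%R, k%:R[)%E.
  2: by apply: lebesgue_rV_box => ?; exact: measurable_itv.
rewrite lebesgue_measure_itv/=; case: ifP => _.
  by rewrite -EFinD prodEFin ltry.
by rewrite (prodEFin _ _ (fun=> 0)) ltry.
Qed.

Lemma ge0_integral_slice n (i : 'I_n.+1) (f : 'rV[R]_n.+1 -> \bar R) :
  measurable_fun setT f -> (forall x, 0 <= f x)%E ->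
  (\int[lebesgue_rV R n.+1]_x f x =
   \int[lebesgue_rV R n]_v \int[mu]_a f (ins i (a, v)))%E.
Proof.
move=> mf f0.
have mfi : measurable_fun [set: measurableTypeR R * 'rV[R]_n] (f \o ins i).
  exact: (measurableT_comp mf (measurable_ins i)).
transitivity (\int[(mu \x lebesgue_rV R n)%E]_z (f \o ins i) z)%E; last first.
  rewrite (fubini_tonelli1 (m1 := mu) (m2 := lebesgue_rV R n) (f \o ins i))//.
  rewrite /fubini_F.
  refine (@fubini_tonelli _ _ _ _ _ mu (lebesgue_rV R n) (f \o ins i) mfi _).
  by move=> z /=; exact: f0.
  by move=> z /=; exact: f0.
have h : (\int[slice_measure i]_x f x =
    \int[(mu \x lebesgue_rV R n)%E]_z (f \o ins i) z)%E.
  by rewrite (ge0_integral_pushforward (measurable_ins i)) ?preimage_setT.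
rewrite -h; apply: eq_measure_integral => A mA _.
exact: (lebesgue_rV_slice i mA).
Qed.

End slicing.

Section shear.
Variable R : realType.
Local Notation mu := (@lebesgue_measure R).

Lemma bilipschitz_inverse (psi : R -> R) :
  (forall a b, a <= b -> (b - a) / 2 <= psi b - psi a <= 2 * (b - a)) ->
  exists2 psi', cancel psi psi' & cancel psi' psi.
Proof.
move=> psiB.
have psi_cont : continuous psi.
  move=> x; apply/cvgrPdist_le => e e0; exists (e / 2); first by rewrite /= divr_gt0.
  move=> y /= /ltW.
  have [xy|/ltW yx] := leP x y; rewrite distrC => hxy.
    have /andP[h1 h2] := psiB _ _ xy.
    rewrite distrC ger0_norm; last by lra.
    by move: hxy; rewrite ger0_norm; lra.
  have /andP[h1 h2] := psiB _ _ yx.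
  rewrite ger0_norm; last by lra.
  by move: hxy; rewrite distrC ger0_norm; lra.
have psi_surj y : exists x, psi x == y.
  (* The slope of [psi] is at least 1/2, so from 0 to d and from -d to 0 it rises by at least d/2,
     which is the distance from [psi 0] to y. *)
  pose d := 2 * `|y - psi 0|.
  have d0 : 0 <= d by rewrite mulr_ge0.
  have dN : - d <= d by lra.
  have /andP[h1 _] := psiB 0 d d0.
  have /andP[h2 _] : (0 - - d) / 2 <= psi 0 - psi (- d) <= 2 * (0 - - d).
    by apply: psiB; lra.
  have hy : `|y - psi 0| = d / 2 by rewrite /d; lra.
  have [c _ <-] : exists2 c, c \in `[- d, d] & psi c = y.
    apply: IVT => //; first exact: continuous_subspaceT.
    have := ler_norm (y - psi 0); have := ler_norm (- (y - psi 0)).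
    rewrite normrN hy => h3 h4; rewrite ge_min le_max.
    by apply/andP; split; apply/orP; [left|right]; lra.
  by exists c.
pose psi' y := sval (cid (psi_surj y)).
have psi'K : cancel psi' psi by move=> y; rewrite /psi'; case: cid => x /= /eqP.
have psi_inj : injective psi.
  move=> a b ab; have [h|/ltW h] := leP a b; have /andP[h1 _] := psiB _ _ h;
    by move: h1; rewrite ab subrr => h1; lra.
exists psi' => // x; apply: psi_inj; exact: psi'K.
Qed.

Definition upd n (i : 'I_n) (x : 'rV[R]_n) (a : R) : 'rV[R]_n :=
  \row_k (if k == i then a else x ord0 k).

Lemma upd_same n (i : 'I_n) x a : upd i x a ord0 i = a.
Proof. by rewrite mxE eqxx. Qed.

Lemma upd_neq n (i k : 'I_n) x a : k != i -> upd i x a ord0 k = x ord0 k.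
Proof. by rewrite mxE => /negPf ->. Qed.

Lemma updK n (i : 'I_n) x a b : upd i (upd i x a) b = upd i x b.
Proof. by apply/rowP => k; rewrite !mxE; case: eqP. Qed.

Lemma upd_id n (i : 'I_n) x : upd i x (x ord0 i) = x.
Proof. by apply/rowP => k; rewrite !mxE; case: eqP => // ->. Qed.

Lemma ins_upd n (i : 'I_n.+1) a b v : ins i (b, v) = upd i (ins i (a, v)) b.
Proof.
apply/rowP => k; case: (unliftP i k) => [j|] ->.
  by rewrite upd_neq ?ins_lift// eq_sym neq_lift.
by rewrite upd_same ins_same.
Qed.

Lemma measurable_upd d (T : measurableType d) n (i : 'I_n) (f : T -> 'rV[R]_n)
    (g : T -> R) :
  measurable_fun setT f -> measurable_fun setT g ->
  measurable_fun setT (fun x => upd i (f x) (g x)).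
Proof.
move=> mf mg; apply: measurable_fun_coordP => k.
under eq_fun do rewrite mxE.
case: eqP => // _; exact: measurableT_comp (measurable_coord k) mf.
Qed.

Variables (n : nat) (i : 'I_n.+1) (h j : 'rV[R]_n.+1 -> R).

Definition shear (x : 'rV[R]_n.+1) := upd i x (x ord0 i + h x).

Hypotheses (mh : measurable_fun setT h) (mj : measurable_fun setT j).
Hypothesis j_bounds : forall x, 2^-1 <= j x <= 2.
Hypothesis hj : forall x a b, a <= b ->
  (\int[mu]_(t in `]a, b]) (j (upd i x t))%:E =
   (b + h (upd i x b) - (a + h (upd i x a)))%:E)%E.

Let line x a := a + h (upd i x a).

Let mupd x : measurable_fun [set: R] (upd i x).
Proof. by apply: measurable_upd => //; exact: measurable_cst. Qed.

Let mjl x : measurable_fun [set: R] (fun t => j (upd i x t)).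
Proof. exact: measurableT_comp mj (mupd x). Qed.

Let line_bounds x a b : a <= b ->
  (b - a) / 2 <= line x b - line x a <= 2 * (b - a).
Proof.
move=> ab; rewrite -!lee_fin /line -hj//.
have lab : mu `]a, b]%classic = (b - a)%:E.
  rewrite lebesgue_measure_itv/= lte_fin; case: ltgtP ab => // -> _.
  by rewrite subrr.
have c0 c : (\int[mu]_(t in `]a, b]) (cst c%:E) t = (c * (b - a))%:E)%E.
  by rewrite integral_cst//= lab.
apply/andP; split.
  rewrite mulrC -c0; apply: ge0_le_integral => //.
  - by move=> t _; rewrite lee_fin invr_ge0.
  - by apply/measurable_EFinP; apply: measurable_funS (mjl x).
  - by move=> t _; rewrite lee_fin; have /andP[] := j_bounds (upd i x t).
rewrite -c0; apply: ge0_le_integral => //.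
- by move=> t _; rewrite lee_fin; have /andP[] := j_bounds (upd i x t); lra.
- by apply/measurable_EFinP; apply: measurable_funS (mjl x).
- by move=> t _; rewrite lee_fin; have /andP[] := j_bounds (upd i x t).
Qed.

Lemma measurable_shear : measurable_fun setT shear.
Proof.
apply: measurable_upd; first exact: measurable_id.
by apply: measurable_funD => //; exact: measurable_coord.
Qed.

(** A shear maps each line parallel to e_i to itself, acting there as [line x]. The bounds on [j]
    make this map bilipschitz, hence invertible, and Fubini along these lines reduces the integral
    formula to [ge0_integral_substitution]. *)
Lemma shear_change_of_variables :
  exists shear' : 'rV[R]_n.+1 -> 'rV[R]_n.+1,
  [/\ cancel shear shear', cancel shear' shear, measurable_fun setT shear' &
   forall f : 'rV[R]_n.+1 -> \bar R, measurable_fun setT f ->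
     (forall x, 0 <= f x)%E ->
     (\int[lebesgue_rV R n.+1]_x (f (shear x) * (j x)%:E) =
      \int[lebesgue_rV R n.+1]_x f x)%E].
Proof.
pose inv x := sval (cid2 (bilipschitz_inverse (line_bounds x))).
have lineK x : cancel (line x) (inv x) by rewrite /inv; case: cid2.
have invK x : cancel (inv x) (line x) by rewrite /inv; case: cid2.
have line_upd x a : line (upd i x a) =1 line x.
  by move=> b; rewrite /line updK.
have inv_upd x a : inv (upd i x a) =1 inv x.
  by move=> b; rewrite -[in RHS](invK (upd i x a) b) line_upd lineK.
have line_le x : {homo line x : a b / a <= b}.
  by move=> a b ab; have /andP[] := line_bounds x ab; lra.
have shearE x : shear x = upd i x (line x (x ord0 i)).
  by rewrite /shear /line upd_id.
exists (fun x => upd i x (inv x (x ord0 i))); split.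
- by move=> x; rewrite shearE updK upd_same inv_upd lineK upd_id.
- by move=> x; rewrite shearE updK upd_same line_upd invK upd_id.
- apply: measurable_upd; first exact: measurable_id.
  apply: (measurability (@RGenCInfty.G R)) => [|_ [_] [a -> <-]].
    exact: RGenCInfty.measurableE.
  (* Monotonicity describes the superlevel sets of the inverse through the direct map [line], whose
     measurability is known. *)
  rewrite setTI (_ : _ @^-1` _ = [set x | line x a <= x ord0 i]); last first.
    apply/seteqP; split => x /=; rewrite in_itv/= andbT => ax.
      by rewrite -(invK x (x ord0 i)) line_le.
    rewrite leNgt; apply/negP => xa.
    have /andP[h1 _] := line_bounds x (ltW xa).
    by move: h1; rewrite invK; lra.
  rewrite -[X in measurable X]setTI; apply: measurable_fun_le => //.
    apply: measurable_funD; first exact: measurable_cst.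
    apply: measurableT_comp mh _; apply: measurable_upd; first exact: measurable_id.
    exact: measurable_cst.
  exact: measurable_coord.
move=> f mf f0.
have j0 x : 0 <= j x by have /andP[] := j_bounds x; lra.
rewrite (ge0_integral_slice i); last 2 first.
- apply: emeasurable_funM; last exact/measurable_EFinP.
  exact: measurableT_comp mf measurable_shear.
- by move=> x; rewrite mule_ge0// lee_fin.
rewrite (ge0_integral_slice i)//; apply: eq_integral => v _.
pose x := ins i (0, v).
under eq_integral do rewrite (ins_upd i 0) -/x shearE upd_same updK line_upd.
under [RHS]eq_integral do rewrite (ins_upd i 0) -/x.
apply: (@ge0_integral_substitution R (line x) (inv x) (fun a => j (upd i x a))
  (lineK x) (invK x) (@line_le x) (mjl x) (fun a => j0 _) _ (f \o upd i x)).
- by move=> a b ab; exact: hj.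
- exact: measurableT_comp mf (mupd x).
- by move=> a /=.
Qed.

End shear.

Arguments lebesgue_rV : simpl never.
Opaque lebesgue_rV.

(** * Real inequalities *)

Section real_inequalities.
Variable R : realType.
Implicit Types a b x y q p t : R.

(** This is Young's inequality for the product of y and x^(q-1), with exponents q and q/(q-1),
    multiplied by q. *)
Lemma powR_convex q x y : 1 < q -> 0 <= x -> 0 <= y ->
  x `^ q - y `^ q <= q * x `^ (q - 1) * (x - y).
Proof.
move=> q1 x0 y0.
have q0 : 0 < q by lra.
have q10 : 0 < q - 1 by lra.
have r0 : 0 < q / (q - 1) by rewrite divr_gt0.
have h := conjugate_powR (p := q) (q := q / (q - 1)) y0 (powR_ge0 x (q - 1)) q0 r0.
have {h} : y * x `^ (q - 1) <= y `^ q / q + x `^ q / (q / (q - 1)).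
  rewrite [in X in _ <= _ + X / _](_ : x `^ q = (x `^ (q - 1)) `^ (q / (q - 1))).
    by apply: h; field; lra.
  by rewrite -powRrM; congr (_ `^ _); field; lra.
have -> : x `^ q = x `^ (q - 1) * x.
  rewrite -{3}(powRr1 x0) -powRD; first by congr (_ `^ _); ring.
  by apply/implyP; rewrite subrK => /eqP; lra.
move: (x `^ (q - 1)) (y `^ q) => X Y h.
have : q * (y * X) <= q * (Y / q + X * x / (q / (q - 1))) by rewrite ler_pM2l.
have -> : q * (Y / q + X * x / (q / (q - 1))) = Y + (q - 1) * (X * x).
  by field; lra.
by lra.
Qed.

(** The tangent inequality at b leaves (b^p - a^p)(b - a). A second use of convexity, now for the
    exponent p > 1, makes this quadratic. *)
Lemma powR_taylor p M a b : 1 < p -> 0 <= a <= M -> 0 <= b <= M ->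
  (b `^ (p + 1) - a `^ (p + 1)) / (p + 1) - a `^ p * (b - a) <=
  p * M `^ (p - 1) * (b - a) ^+ 2.
Proof.
move=> p1 /andP[a0 aM] /andP[b0 bM].
have p0 : 0 < p + 1 by lra.
have h1 : (b `^ (p + 1) - a `^ (p + 1)) / (p + 1) <= b `^ p * (b - a).
  rewrite ler_pdivrMr//; have := @powR_convex (p + 1) b a.
  by rewrite addrK => /(_ _ b0 a0) h; apply: le_trans (h _) _; lra.
have mono x : 0 <= x <= M -> x `^ (p - 1) <= M `^ (p - 1).
  by move=> /andP[x0 xM]; rewrite ge0_ler_powR// ?nnegrE; lra.
have h2 x y : 0 <= y <= x -> x <= M ->
    (x `^ p - y `^ p) * (x - y) <= p * M `^ (p - 1) * (x - y) ^+ 2.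
  move=> /andP[y0 yx] xM; rewrite expr2 mulrA ler_wpM2r//; first lra.
  apply: le_trans (powR_convex p1 _ _) _ => //; first lra.
  rewrite ler_wpM2r//; first lra.
  by rewrite ler_wpM2l//; [lra|apply: mono; lra].
have h3 : (b `^ p - a `^ p) * (b - a) <= p * M `^ (p - 1) * (b - a) ^+ 2.
  have [ab|/ltW ba] := leP a b; first by apply: h2; lra.
  by have := h2 a b; rewrite b0 ba => /(_ isT aM); lra.
by lra.
Qed.

(** From exp(-x) >= 1 - x one gets exp x <= 1/(1 - x), and (1 + x + 2x^2)(1 - x) - 1 = x^2 (1 - 2x)
    is nonnegative. *)
Lemma expR_le_quadratic x : x <= 2^-1 -> expR x <= 1 + x + 2 * x ^+ 2.
Proof.
move=> x2; rewrite -[x in expR x]opprK expRN.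
have h := expR_ge1Dx (- x).
have h0 : 0 < 1 - x by lra.
apply: (@le_trans _ _ (1 - x)^-1); first by rewrite lef_pV2// posrE; lra.
rewrite -[_^-1]mul1r ler_pdivrMr//.
have : 0 <= x ^+ 2 * (1 - 2 * x) by rewrite mulr_ge0 ?sqr_ge0//; lra.
by move=> h1; lra.
Qed.

(** Write the power as exp(-r ln(1 + x)) and use -ln(1 + x) <= -x + 2x^2. The exponent is then at
    most some w with w^2 <= 4 r^2 x^2, and [expR_le_quadratic] turns 2 w^2 into the term 8 r^2
    x^2. *)
Lemma powRN_1D_le r x : 0 <= r -> `|x| <= 2^-1 -> 2 * r * `|x| <= 2^-1 ->
  (1 + x) `^ (- r) <= 1 - r * x + (2 * r + 8 * r ^+ 2) * x ^+ 2.
Proof.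
move=> r0 x2 rx.
have /andP[x2a x2b] : - 2^-1 <= x <= 2^-1 by rewrite -ler_norml.
have x1 : 0 < 1 + x by lra.
have hln : - ln (1 + x) <= - x + 2 * x ^+ 2.
  rewrite -lnV ?posrE//.
  have -> : (1 + x)^-1 = 1 + - (x / (1 + x)) by field; lra.
  have hx : - (x / (1 + x)) = - x + x ^+ 2 / (1 + x) by field; lra.
  apply: le_trans (le_ln1Dx _) _.
    by rewrite ltrNr opprK ltr_pdivrMr//; lra.
  rewrite hx lerD2l ler_pdivrMr//.
  have : 0 <= x ^+ 2 * (1 + 2 * x) by rewrite mulr_ge0 ?sqr_ge0//; lra.
  by move=> h; lra.
set w := - (r * x) + 2 * r * x ^+ 2.
have hw : - r * ln (1 + x) <= w.
  have : r * (- ln (1 + x)) <= r * (- x + 2 * x ^+ 2) by rewrite ler_wpM2l.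
  by rewrite /w; lra.
have xx : x ^+ 2 <= `|x| / 2 by rewrite -[x ^+ 2]real_normK ?num_real// expr2 ler_wpM2l.
have rxx : r * x ^+ 2 <= r * (`|x| / 2) by rewrite ler_wpM2l.
have wle : `|w| <= 2 * (r * `|x|).
  apply: le_trans (ler_normD _ _) _; rewrite normrN normrM (ger0_norm r0).
  have : 0 <= 2 * r * x ^+ 2 by rewrite mulr_ge0 ?sqr_ge0 ?mulr_ge0.
  by move=> /ger0_norm ->; lra.
have w2 : w <= 2^-1 by have := ler_norm w; lra.
have ww : w ^+ 2 <= 4 * r ^+ 2 * x ^+ 2.
  rewrite -[w ^+ 2]ger0_norm ?sqr_ge0// normrX.
  have : `|w| ^+ 2 <= (2 * (r * `|x|)) ^+ 2.
    by rewrite ler_sqr ?nnegrE ?mulr_ge0.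
  rewrite (_ : (2 * (r * `|x|)) ^+ 2 = 4 * r ^+ 2 * x ^+ 2).
    by rewrite real_normK ?num_real.
  by rewrite -[x ^+ 2]real_normK ?num_real//; ring.
rewrite /powR gt_eqF//; apply: le_trans (_ : expR w <= _); first by rewrite ler_expR.
by apply: le_trans (expR_le_quadratic w2) _; rewrite /w in ww *; lra.
Qed.

(** Here d is a squared distance |x - y|^2, e and f are the increments of x_i and of the field, j
    and k the derivatives of the field at both points, and r = (n + 2s)/2. The left side is the
    transported kernel times its Jacobians; the point is a second-order error C t^2 with C uniform
    in the two points. *)
Lemma kernel_ratio (r L : R) : 0 <= r -> 0 <= L ->
  exists2 C : R, 0 <= C & forall t d e f j k : R,
  0 < t -> t * C <= 1 -> 0 < d -> e ^+ 2 <= d -> f ^+ 2 <= L ^+ 2 * d ->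
  `|j| <= L -> `|k| <= L ->
  [/\ 0 <= 1 + t * j, 0 <= 1 + t * k &
  (d + 2 * t * (e * f) + t ^+ 2 * f ^+ 2) `^ (- r) * ((1 + t * j) * (1 + t * k)) <=
  (1 + t * (j + k - 2 * r * (e * f / d)) + C * t ^+ 2) * d `^ (- r)].
Proof.
move=> r0 L0.
(* The squared distance changes by a factor 1 + z with |z| <= t B. [C0] then bounds the quadratic
   term of [powRN_1D_le] divided by t^2, and [D] the second-order part of the full product. *)
pose B := 2 * L + L ^+ 2.
pose C0 := (2 * r + 8 * r ^+ 2) * B ^+ 2.
pose D := L ^+ 2 + 4 * r * L ^+ 2 + C0 + 2 * L * C0 + 2 * r * L ^+ 3 + L ^+ 2 * C0.
have B0 : 0 <= B by rewrite addr_ge0 ?mulr_ge0 ?sqr_ge0.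
have C00 : 0 <= C0 by rewrite mulr_ge0 ?sqr_ge0// addr_ge0 ?mulr_ge0 ?sqr_ge0.
have D0 : 0 <= D.
  have l2 : 0 <= L ^+ 2 by rewrite sqr_ge0.
  have l3 : 0 <= r * L ^+ 3 by rewrite mulr_ge0// exprn_ge0.
  have l4 : 0 <= r * L ^+ 2 by rewrite mulr_ge0.
  have l5 : 0 <= L * C0 by rewrite mulr_ge0.
  have l6 : 0 <= L ^+ 2 * C0 by rewrite mulr_ge0.
  by rewrite /D; lra.
have rB0 : 0 <= r * B by rewrite mulr_ge0.
(* With t C <= 1 the first summands give t <= 1, t L <= 1, |z| <= 1/2 and 2 r |z| <= 1/2, as
   [powRN_1D_le] requires. *)
exists (1 + L + 2 * B + 4 * (r * B) + D); first by lra.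
move=> t d e f j k t0 tC d0 ed fd jL kL.
have tL0 : 0 <= t * L by rewrite mulr_ge0// ltW.
have tB0 : 0 <= t * B by rewrite mulr_ge0// ltW.
have trB0 : 0 <= t * (r * B) by rewrite mulr_ge0// ltW.
have tD0 : 0 <= t * D by rewrite mulr_ge0// ltW.
have t1 : t <= 1 by lra.
have tL1 : t * L <= 1 by lra.
have bnd x : `|x| <= L -> `|t * x| <= t * L.
  by move=> h; rewrite normrM (gtr0_norm t0) ler_wpM2l// ltW.
have j0 : 0 <= 1 + t * j by have := bnd _ jL; rewrite ler_norml; lra.
have k0 : 0 <= 1 + t * k by have := bnd _ kL; rewrite ler_norml; lra.
split => //.
pose g := e * f / d; pose h := f ^+ 2 / d.
have gL : `|g| <= L.
  have : g ^+ 2 <= L ^+ 2.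
    rewrite /g expr_div_n exprMn ler_pdivrMr ?exprn_gt0//.
    have : e ^+ 2 * f ^+ 2 <= d * (L ^+ 2 * d).
      by apply: ler_pM => //; exact: sqr_ge0.
    by rewrite [d ^+ 2]expr2; lra.
  by rewrite -[g ^+ 2]real_normK ?num_real// ler_sqr ?nnegrE.
have h0 : 0 <= h by apply: divr_ge0; [exact: sqr_ge0|exact: ltW].
have th0 : 0 <= t ^+ 2 * h by apply: mulr_ge0 => //; exact: sqr_ge0.
have hL : h <= L ^+ 2 by rewrite ler_pdivrMr.
have tt1 : t ^+ 2 <= t by rewrite expr2 ler_piMl// ltW.
pose z := 2 * t * g + t ^+ 2 * h.
have -> : d + 2 * t * (e * f) + t ^+ 2 * f ^+ 2 = d * (1 + z).
  by rewrite /z /g /h; field; lra.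
have zB : `|z| <= t * B.
  apply: le_trans (ler_normD _ _) _.
  rewrite -mulrA normrM (ger0_norm (_ : 0 <= 2))//.
  rewrite [`|t ^+ 2 * h|]ger0_norm//.
  have h1 := bnd _ gL.
  have : t ^+ 2 * h <= t * L ^+ 2 by apply: ler_pM => //; exact: sqr_ge0.
  by rewrite /B; lra.
have zr : 2 * r * `|z| <= 2^-1.
  have : r * `|z| <= r * (t * B) by rewrite ler_wpM2l.
  by lra.
have hz := @powRN_1D_le r z r0 _ zr.
have z1 : 0 <= 1 + z by move: (ler_norm (- z)); rewrite normrN; lra.
rewrite powRM ?(ltW d0)// mulrC mulrCA [leRHS]mulrC ler_wpM2l ?powR_ge0//.
have hz2 : (1 + z) `^ (- r) <= 1 - 2 * r * t * g + C0 * t ^+ 2.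
  apply: le_trans (hz _) _; first lra.
  have zz : z ^+ 2 <= t ^+ 2 * B ^+ 2.
    rewrite -[z ^+ 2]real_normK ?num_real// -exprMn ler_sqr ?nnegrE//.
  have : (2 * r + 8 * r ^+ 2) * z ^+ 2 <= (2 * r + 8 * r ^+ 2) * (t ^+ 2 * B ^+ 2).
    by rewrite ler_wpM2l// addr_ge0 ?mulr_ge0 ?sqr_ge0.
  have : 0 <= r * (t ^+ 2 * h) by rewrite mulr_ge0.
  by rewrite /C0 /z; lra.
have jk0 : 0 <= (1 + t * j) * (1 + t * k) by rewrite mulr_ge0.
apply: le_trans (_ : (1 + t * j) * (1 + t * k) * (1 - 2 * r * t * g + C0 * t ^+ 2) <= _).
  by rewrite ler_wpM2l.
(* The product is (1 + t S + t^2 P)(1 + t Q + C0 t^2); [D] bounds all that follows 1 + t (S + Q),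
   divided by t^2. *)
pose S := j + k; pose P := j * k; pose Q := - (2 * r * g).
have SL : `|S| <= 2 * L by apply: le_trans (ler_normD _ _) _; lra.
have PL : `|P| <= L ^+ 2 by rewrite normrM expr2 ler_pM.
have QL : `|Q| <= 2 * r * L.
  by rewrite normrN normrM ger0_norm ?mulr_ge0// ler_wpM2l ?mulr_ge0.
have mulb x y a b : `|x| <= a -> `|y| <= b -> x * y <= a * b.
  by move=> xa yb; apply: le_trans (ler_norm _) _; rewrite normrM ler_pM.
have e1 := mulb _ _ _ _ SL QL.
have C0n : `|C0| <= C0 by rewrite ger0_norm.
have e2 := mulb _ _ _ _ SL C0n.
have e3 := mulb _ _ _ _ PL QL.
have e4 := mulb _ _ _ _ PL C0n.
have e5 := le_trans (ler_norm P) PL.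
have tn0 : 0 <= t by lra.
have q1 : t * (S * C0) <= 2 * L * C0.
  apply: le_trans (_ : t * (2 * L * C0) <= _); first by rewrite ler_wpM2l.
  by rewrite ler_piMl//; apply: mulr_ge0 => //; lra.
have q2 : t * (P * Q) <= 2 * r * L ^+ 3.
  apply: le_trans (_ : t * (L ^+ 2 * (2 * r * L)) <= _); first by rewrite ler_wpM2l.
  rewrite (_ : L ^+ 2 * (2 * r * L) = 2 * r * L ^+ 3); last by ring.
  by rewrite ler_piMl// !mulr_ge0// exprn_ge0.
have q3 : t ^+ 2 * (P * C0) <= L ^+ 2 * C0.
  apply: le_trans (_ : t ^+ 2 * (L ^+ 2 * C0) <= _).
    by rewrite ler_wpM2l ?sqr_ge0.
  have l6 : 0 <= L ^+ 2 * C0 by apply: mulr_ge0 => //; exact: sqr_ge0.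
  by rewrite ler_piMl//; lra.
have q4 : P + S * Q + C0 + t * (S * C0) + t * (P * Q) + t ^+ 2 * (P * C0) <= D.
  by rewrite /D; lra.
have : t ^+ 2 * (P + S * Q + C0 + t * (S * C0) + t * (P * Q) + t ^+ 2 * (P * C0))
    <= t ^+ 2 * D by rewrite ler_wpM2l ?sqr_ge0.
have : 0 <= t ^+ 2 * (1 + L + 2 * B + 4 * (r * B)).
  by rewrite mulr_ge0 ?sqr_ge0//; lra.
rewrite -/g /Q /S /P; lra.
Qed.

End real_inequalities.


Lemma measurable_erestrict d (T : measurableType d) (R : realType) (D : set T)
    (f : T -> \bar R) : measurable D -> measurable_fun setT f ->
  measurable_fun setT (f \_ D).
Proof.
move=> mD mf.
rewrite (_ : f \_ D = fun x => (f x * (\1_D x)%:E)%E); last first.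
  by apply/funext => x; rewrite patchE indicE; case: ifP; rewrite ?mule1 ?mule0.
by apply: emeasurable_funM => //; exact/measurable_EFinP/measurable_indic.
Qed.

(** * The Gagliardo energy *)

Section gagliardo.
Variables (R : realType) (m : nat).
Local Notation L := (lebesgue_rV R m.+1).
Local Notation rV := 'rV[R]_m.+1.
Local Notation L2 := (L \x L)%E.
Local Notation upper := (@upper_half R m).
Local Notation TT := (@T_upper R m).

Definition sqn (x : rV) : R := \sum_i x ord0 i ^+ 2.

Lemma sqn_ge0 x : 0 <= sqn x.
Proof. by apply: sumr_ge0 => i _; rewrite sqr_ge0. Qed.

Lemma sqr_coord_le_sqn (x : rV) i : x ord0 i ^+ 2 <= sqn x.
Proof.
by rewrite /sqn (bigD1 i)//= lerDl; apply: sumr_ge0 => j _; rewrite sqr_ge0.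
Qed.

Lemma sqn_gt0 x : x != 0 -> 0 < sqn x.
Proof.
move=> x0; rewrite lt_neqAle sqn_ge0 andbT eq_sym; apply: contra x0 => /eqP h.
apply/eqP/rowP => i; rewrite mxE; apply/eqP.
by rewrite -sqrf_eq0 eq_le sqr_ge0 andbT -h sqr_coord_le_sqn.
Qed.

(** The kernel |x|^-(n+2s), expressed through the squared norm because the latter changes by a
    quadratic polynomial in t under the deformations below. For s > 0 its value at 0 is 0, as in
    [gagliardo_integrand]. *)
Definition riesz_kernel (s : R) (x : rV) : R := sqn x `^ (- ((m.+1%:R + 2 * s) / 2)).

Lemma riesz_kernel_ge0 s x : 0 <= riesz_kernel s x. Proof. exact: powR_ge0. Qed.

Lemma gagliardo_integrandE s (u v : rV -> R) z :
  gagliardo_integrand s u v z =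
  (u z.1 - u z.2) * (v z.1 - v z.2) * riesz_kernel s (z.1 - z.2).
Proof.
rewrite /gagliardo_integrand /enorm /riesz_kernel powRN; congr (_ / _).
by rewrite -powR12_sqrt ?sqn_ge0// -powRrM; congr (_ `^ _); ring.
Qed.

Lemma measurable_sqn : measurable_fun setT sqn.
Proof.
apply: measurable_sum => i; apply: measurable_funX; exact: measurable_coord.
Qed.

Lemma measurable_riesz_kernel s : measurable_fun setT (riesz_kernel s).
Proof. exact: measurableT_comp (measurable_powR _) measurable_sqn. Qed.

Lemma measurable_rV_sub d (T : measurableType d) (f g : T -> rV) :
  measurable_fun setT f -> measurable_fun setT g ->
  measurable_fun setT (fun x => f x - g x).
Proof.
move=> mf mg; apply: measurable_fun_coordP => i.
under eq_fun do rewrite !mxE.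
by apply: measurable_funB; exact: measurableT_comp (measurable_coord i) _.
Qed.

Lemma measurable_riesz_kernel_sub s :
  measurable_fun [set: rV * rV] (fun z => riesz_kernel s (z.1 - z.2)).
Proof.
apply: measurableT_comp (measurable_riesz_kernel s) _; apply: measurable_rV_sub.
  exact: measurable_fst.
exact: measurable_snd.
Qed.

Lemma measurable_comp1 (f : rV -> R) : measurable_fun setT f ->
  measurable_fun [set: rV * rV] (fun z => f z.1).
Proof. by move=> mf; apply: measurableT_comp mf _; exact: measurable_fst. Qed.

Lemma measurable_comp2 (f : rV -> R) : measurable_fun setT f ->
  measurable_fun [set: rV * rV] (fun z => f z.2).
Proof. by move=> mf; apply: measurableT_comp mf _; exact: measurable_snd. Qed.

Lemma measurable_gagliardo s (u v : rV -> R) :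
  measurable_fun setT u -> measurable_fun setT v ->
  measurable_fun setT (gagliardo_integrand s u v).
Proof.
move=> mu mv; rewrite (funext (gagliardo_integrandE s u v)).
apply: measurable_funM; last exact: measurable_riesz_kernel_sub.
by apply: measurable_funM; apply: measurable_funB;
  (exact: measurable_comp1 || exact: measurable_comp2).
Qed.

Lemma measurable_upper : measurable upper.
Proof.
rewrite (_ : upper = (fun x : rV => x ord0 ord_max) @^-1` `]0, +oo[%classic).
  by rewrite -[X in measurable X]setTI; exact: measurable_coord.
by apply/seteqP; split => x /=; rewrite in_itv/= andbT.
Qed.

Lemma measurable_lower : measurable (@lower_half R m).
Proof.
rewrite (_ : @lower_half R m = (fun x : rV => x ord0 ord_max) @^-1` `]-oo, 0[%classic).
  by rewrite -[X in measurable X]setTI; exact: measurable_coord.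
by apply/seteqP; split => x /=; rewrite in_itv/=.
Qed.

Lemma measurable_T_upper : measurable TT.
Proof. by apply: measurableC; apply: measurableX; exact: measurable_lower. Qed.

Hint Resolve measurable_upper measurable_T_upper : core.

Lemma gagliardo_sqr_ge0 s (u : rV -> R) z : 0 <= gagliardo_integrand s u u z.
Proof.
by rewrite gagliardo_integrandE -expr2 mulr_ge0 ?sqr_ge0 ?riesz_kernel_ge0.
Qed.

Lemma gagliardo_form_ge0 s (u : rV -> R) : (0 <= gagliardo_form s u u)%E.
Proof. by apply: integral_ge0 => z _; rewrite lee_fin gagliardo_sqr_ge0. Qed.

Lemma integrable_gagliardo_sqr s (u : rV -> R) : Hs_upper s u ->
  L2.-integrable TT (EFin \o gagliardo_integrand s u u).
Proof.
move=> [mu _ fu]; apply/integrableP; split.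
  by apply/measurable_EFinP/measurable_funTS; exact: measurable_gagliardo.
under eq_integral do rewrite /= ger0_norm ?gagliardo_sqr_ge0//.
exact: fu.
Qed.

Lemma integrable_gagliardo s (u v : rV -> R) : Hs_upper s u -> Hs_upper s v ->
  L2.-integrable TT (EFin \o gagliardo_integrand s u v).
Proof.
move=> hu hv; have [mu _ _] := hu; have [mv _ _] := hv.
have := integrableD measurable_T_upper
  (integrable_gagliardo_sqr hu) (integrable_gagliardo_sqr hv).
apply: le_integrable => //.
  by apply/measurable_EFinP/measurable_funTS; exact: measurable_gagliardo.
move=> z _; rewrite /= lee_fin [leRHS]ger0_norm; last first.
  by rewrite addr_ge0 ?gagliardo_sqr_ge0.
rewrite !gagliardo_integrandE normrM (ger0_norm (riesz_kernel_ge0 _ _)) -mulrDl.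
rewrite ler_wpM2r ?riesz_kernel_ge0// normrM -!expr2.
move: (u z.1 - u z.2) (v z.1 - v z.2) => a b.
rewrite -[a ^+ 2]real_normK ?num_real// -[b ^+ 2]real_normK ?num_real//.
have := sqr_ge0 (`|a| - `|b|); have := sqr_ge0 (`|a| + `|b|); lra.
Qed.

Definition energy s (u v : rV -> R) : R := fine (gagliardo_form s u v).

Lemma gagliardo_formE s (u v : rV -> R) : Hs_upper s u -> Hs_upper s v ->
  gagliardo_form s u v = (energy s u v)%:E.
Proof.
move=> hu hv; rewrite fineK//; apply: integrable_fin_num => //.
exact: integrable_gagliardo.
Qed.

Lemma energy_ge0 s (u : rV -> R) : 0 <= energy s u u.
Proof. by rewrite fine_ge0// gagliardo_form_ge0. Qed.

Lemma energyB s (u v : rV -> R) : Hs_upper s u -> Hs_upper s v ->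
  energy s (fun x => v x - u x) (fun x => v x - u x) =
  energy s v v + energy s u u - 2 * energy s u v.
Proof.
move=> hu hv.
have iu := integrable_gagliardo hu hu.
have iv := integrable_gagliardo hv hv.
have iuv := integrable_gagliardo hu hv.
transitivity (\int[L2]_(z in TT) (gagliardo_integrand s v v z +
    gagliardo_integrand s u u z - 2 * gagliardo_integrand s u v z)).
  by apply: eq_Rintegral => z _; rewrite !gagliardo_integrandE; ring.
have i1 := integrableD measurable_T_upper iv iu.
have i2 := integrableZl measurable_T_upper 2 iuv.
rewrite (RintegralB measurable_T_upper i1 i2).
by rewrite (RintegralD measurable_T_upper iv iu) (RintegralZl _ measurable_T_upper iuv).
Qed.

Lemma Hs_upperB s (u v : rV -> R) : 2 * s < m.+1%:R ->
  Hs_upper s u -> Hs_upper s v -> Hs_upper s (fun x => v x - u x).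
Proof.
move=> sm hu hv; have [mu qu fu] := hu; have [mv qv fv] := hv.
have q0 : 0 <= critical_exponent m.+1 s.
  by rewrite /critical_exponent divr_ge0// ?mulr_ge0//; lra.
set q := critical_exponent m.+1 s in qu qv q0 *.
have mpow (w : rV -> R) : measurable_fun setT w ->
    measurable_fun upper (fun x => (`|w x| `^ q)%:E).
  move=> mw; apply/measurable_EFinP/measurable_funTS.
  apply: measurableT_comp (measurable_powR _) _.
  exact: measurableT_comp (@normr_measurable _ _) mw.
have mvu : measurable_fun setT (fun x => v x - u x) by exact: measurable_funB.
split; first exact: mvu.
  apply: (@le_lt_trans _ _ (\int[L]_(x in upper)
    ((2 `^ q)%:E * ((`|u x| `^ q)%:E + (`|v x| `^ q)%:E)))%E).
    apply: ge0_le_integral => //.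
    - exact: mpow.
    - by apply: emeasurable_funM => //; apply: emeasurable_funD; exact: mpow.
    move=> x _; rewrite -EFinD -EFinM lee_fin mulrDr -!powRM//.
    wlog uv : u v {hu hv mu qu fu mv qv fv mvu} / `|u x| <= `|v x|.
      move=> h; have [uv|/ltW vu] := leP `|u x| `|v x|; first exact: h.
      by rewrite distrC [leRHS]addrC; exact: h.
    apply: (@le_trans _ _ ((2 * `|v x|) `^ q)); last by rewrite lerDr powR_ge0.
    apply: (ge0_ler_powR q0); rewrite ?nnegrE ?mulr_ge0//.
    by apply: le_trans (ler_normB _ _) _; lra.
  rewrite ge0_integralZl//; last 2 first.
  - by apply: emeasurable_funD; exact: mpow.
  - by move=> x _; rewrite adde_ge0// lee_fin powR_ge0.
  rewrite ge0_integralD//; [|exact: mpow..].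
  by apply: lte_mul_pinfty; rewrite ?lee_fin ?powR_ge0//; exact: lte_add_pinfty.
have /integrableP[_] := integrableZl measurable_T_upper 2
  (integrableD measurable_T_upper (integrable_gagliardo_sqr hu)
    (integrable_gagliardo_sqr hv)).
apply: le_lt_trans; apply: ge0_le_integral => //.
- by move=> z _; rewrite lee_fin gagliardo_sqr_ge0.
- by apply/measurable_EFinP/measurable_funTS; exact: measurable_gagliardo.
- apply: measurableT_comp => //; apply: emeasurable_funM => //.
  by apply: emeasurable_funD; apply/measurable_EFinP/measurable_funTS;
    exact: measurable_gagliardo.
move=> z _; rewrite /= lee_fin; apply: le_trans (ler_norm _).
rewrite !gagliardo_integrandE -mulrDl mulrA ler_wpM2r ?riesz_kernel_ge0//.
have := sqr_ge0 ((u z.1 - u z.2) + (v z.1 - v z.2)); lra.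
Qed.

End gagliardo.

Lemma ge0_integral_prod_rV (R : realType) (m : nat)
    (f : 'rV[R]_m.+1 * 'rV[R]_m.+1 -> \bar R) :
  measurable_fun setT f -> (forall z, 0 <= f z)%E ->
  (\int[(lebesgue_rV R m.+1 \x lebesgue_rV R m.+1)%E]_z f z =
   \int[lebesgue_rV R m.+1]_x \int[lebesgue_rV R m.+1]_y f (x, y))%E.
Proof.
by move=> mf f0;
  exact: (fubini_tonelli1 (m1 := lebesgue_rV R m.+1) (m2 := lebesgue_rV R m.+1)).
Qed.

Lemma measurable_fun_integral_rV (R : realType) (m : nat)
    (f : 'rV[R]_m.+1 * 'rV[R]_m.+1 -> \bar R) :
  measurable_fun setT f -> (forall z, 0 <= f z)%E ->
  measurable_fun setT (fun x => \int[lebesgue_rV R m.+1]_y f (x, y))%E.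
Proof.
move=> mf f0.
rewrite -[X in measurable_fun _ X]/(fubini_F (lebesgue_rV R m.+1) f).
have := @measurable_fun_fubini_tonelli_F _ _ _ _ R (lebesgue_rV R m.+1) f mf f0.
exact.
Qed.

(** * Bijections that preserve the two half-spaces *)

Section diffeo.
Variables (R : realType) (m : nat).
Local Notation L := (lebesgue_rV R m.+1).
Local Notation rV := 'rV[R]_m.+1.
Local Notation L2 := (L \x L)%E.
Local Notation upper := (@upper_half R m).
Local Notation TT := (@T_upper R m).

(** Smoothness is replaced by its consequence, the change of variables for nonnegative functions
    with a density between 1/2 and 2. Invariance of the lower half-space makes T(R^n_+)
    invariant. *)
Record half_space_diffeo (Phi Psi : rV -> rV) (j : rV -> R) : Prop :=
  HalfSpaceDiffeo {
  diffeo_measurable : measurable_fun setT Phi;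
  diffeo_inv_measurable : measurable_fun setT Psi;
  diffeoK : cancel Phi Psi;
  diffeo_invK : cancel Psi Phi;
  diffeo_upper : forall x, upper (Phi x) <-> upper x;
  diffeo_lower : forall x, lower_half (Phi x) <-> lower_half x;
  diffeo_jac_measurable : measurable_fun setT j;
  diffeo_jac_bounds : forall x, 2^-1 <= j x <= 2;
  diffeo_integral : forall f : rV -> \bar R, measurable_fun setT f ->
    (forall x, 0 <= f x)%E ->
    (\int[L]_x (f (Phi x) * (j x)%:E) = \int[L]_x f x)%E }.

Variables (Phi Psi : rV -> rV) (j : rV -> R).
Hypothesis D : half_space_diffeo Phi Psi j.

Lemma diffeo_jac_ge0 x : 0 <= j x.
Proof. by have /andP[h _] := diffeo_jac_bounds D x; lra. Qed.

Lemma diffeo_T_upper z : TT (Phi z.1, Phi z.2) <-> TT z.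
Proof.
rewrite /T_upper /setC /setX /=.
by split => h [h1 h2]; apply: h; split; apply/(diffeo_lower D).
Qed.

Lemma diffeo_integral_upper (f : rV -> \bar R) : measurable_fun setT f ->
  (forall x, upper x -> 0 <= f x)%E ->
  (\int[L]_(x in upper) f (Psi x) = \int[L]_(x in upper) (f x * (j x)%:E))%E.
Proof.
move=> mf f0.
rewrite integral_mkcond -(diffeo_integral D); last 2 first.
- apply: measurable_erestrict; first exact: measurable_upper.
  apply: measurableT_comp mf _.
  exact: diffeo_inv_measurable D.
- move=> x; rewrite patchE; case: ifPn => //; rewrite inE => xu.
  by apply: f0; apply/(diffeo_upper D); rewrite (diffeo_invK D).
rewrite [RHS]integral_mkcond; apply: eq_integral => x _.
rewrite !patchE /=; have [xu|xu] := pselect (upper x).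
  by rewrite !mem_set//= ?(diffeoK D)//; exact/(diffeo_upper D).
by rewrite !memNset//= ?mul0e//; apply: contra_not xu => /(diffeo_upper D).
Qed.

Lemma diffeo_integral2 (f : rV * rV -> \bar R) : measurable_fun setT f ->
  (forall z, 0 <= f z)%E ->
  (\int[L2]_z (f (Phi z.1, Phi z.2) * (j z.1 * j z.2)%:E) = \int[L2]_z f z)%E.
Proof.
move=> mf f0.
have mPhi := diffeo_measurable D; have mj := diffeo_jac_measurable D.
have mjE : measurable_fun setT (EFin \o j) by exact/measurable_EFinP.
have j0E x : (0 <= (j x)%:E)%E by rewrite lee_fin diffeo_jac_ge0.
have mPP : measurable_fun [set: rV * rV] (fun z => (Phi z.1, Phi z.2)).
  apply: measurable_fun_pair.
    by apply: measurableT_comp mPhi _; exact: measurable_fst.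
  by apply: measurableT_comp mPhi _; exact: measurable_snd.
rewrite ge0_integral_prod_rV; last 2 first.
- apply: emeasurable_funM; first exact: measurableT_comp mf mPP.
  apply/measurable_EFinP; apply: measurable_funM.
    exact: measurable_comp1.
  exact: measurable_comp2.
- by move=> z; rewrite mule_ge0// EFinM mule_ge0.
rewrite [RHS](ge0_integral_prod_rV mf f0) -[RHS](diffeo_integral D); last 2 first.
- exact: (measurable_fun_integral_rV mf f0).
- by move=> x; apply: integral_ge0.
apply: eq_integral => x _; rewrite /=.
rewrite -(diffeo_integral D (f := fun y => f (Phi x, y))); last 2 first.
- exact: measurableT_comp mf (measurable_pair1 _).
- by [].
rewrite -ge0_integralZr//; last 2 first.
- apply: emeasurable_funM => //.
  apply: measurableT_comp mf _; apply: measurable_fun_pair => //.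
- by move=> y _; rewrite mule_ge0.
by apply: eq_integral => y _; rewrite EFinM muleAC muleA.
Qed.

(** The deformation is moved from [u], known only through its energy, onto the explicit kernel and
    the Jacobians. *)
Lemma diffeo_gagliardo s (u : rV -> R) : measurable_fun setT u ->
  (gagliardo_form s (u \o Psi) (u \o Psi) =
  \int[L2]_(z in TT) ((u z.1 - u z.2) ^+ 2 *
    (riesz_kernel s (Phi z.1 - Phi z.2) * (j z.1 * j z.2)))%:E)%E.
Proof.
move=> mu; rewrite /gagliardo_form integral_mkcond -diffeo_integral2; last 2 first.
- apply: measurable_erestrict; first exact: measurable_T_upper.
  apply/measurable_EFinP; apply: measurable_gagliardo;
    exact: measurableT_comp mu (diffeo_inv_measurable D).
- by move=> z; rewrite patchE; case: ifP => // _; rewrite lee_fin gagliardo_sqr_ge0.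
rewrite [RHS]integral_mkcond; apply: eq_integral => z _.
rewrite !patchE /=; have [zT|zT] := pselect (TT z).
  rewrite !mem_set//=; last exact/diffeo_T_upper.
  by rewrite gagliardo_integrandE /= !(diffeoK D) -EFinM -expr2 mulrA.
by rewrite !memNset//= ?mul0e//; apply: contra_not zT => /diffeo_T_upper.
Qed.

Lemma diffeo_Hs_upper s (u : rV -> R) (K : R) : 2 * s < m.+1%:R -> 0 <= K ->
  (forall x y, x != y -> riesz_kernel s (Phi x - Phi y) <= K * riesz_kernel s (x - y)) ->
  Hs_upper s u -> Hs_upper s (u \o Psi).
Proof.
move=> sm K0 hK hu; have [mu qu fu] := hu.
have mPsi := diffeo_inv_measurable D.
have mj := diffeo_jac_measurable D.
split; first exact: measurableT_comp mu mPsi.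
  have mpow : measurable_fun setT (fun x => (`|u x| `^ critical_exponent m.+1 s)%:E).
    apply/measurable_EFinP; apply: measurableT_comp (measurable_powR _) _.
    exact: measurableT_comp (@normr_measurable _ _) mu.
  rewrite (diffeo_integral_upper (f := fun x => (`|u x| `^ _)%:E) mpow); last first.
    by move=> x _; rewrite lee_fin powR_ge0.
  apply: (@le_lt_trans _ _ (\int[L]_(x in upper)
      ((`|u x| `^ critical_exponent m.+1 s)%:E * 2%:E))%E).
    apply: ge0_le_integral; first exact: measurable_upper.
    - by move=> x _; rewrite mule_ge0// lee_fin ?powR_ge0 ?diffeo_jac_ge0.
    - apply: measurable_funTS; apply: emeasurable_funM => //; exact/measurable_EFinP.
    - by apply: measurable_funTS; apply: emeasurable_funM.
    move=> x _; rewrite lee_wpmul2l ?lee_fin ?powR_ge0//.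
    by have /andP[] := diffeo_jac_bounds D x.
  rewrite ge0_integralZr//; last 2 first.
  - exact: measurable_upper.
  - exact: measurable_funTS.
  by rewrite muleC; apply: lte_mul_pinfty.
rewrite diffeo_gagliardo//.
(* In 4 K the kernel accounts for K and each of the two Jacobians for a factor 2. *)
apply: (@le_lt_trans _ _ (\int[L2]_(z in TT)
    ((gagliardo_integrand s u u z)%:E * (4 * K)%:E))%E).
  apply: ge0_le_integral; first exact: measurable_T_upper.
  - move=> z _; rewrite lee_fin mulr_ge0 ?sqr_ge0// mulr_ge0 ?riesz_kernel_ge0//.
    by rewrite mulr_ge0// diffeo_jac_ge0.
  - apply/measurable_EFinP; apply: measurable_funTS; apply: measurable_funM.
      apply: measurable_funX; apply: measurable_funB.
        exact: measurable_comp1.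
      exact: measurable_comp2.
    apply: measurable_funM.
      apply: measurableT_comp (measurable_riesz_kernel _) _; apply: measurable_rV_sub.
        by apply: measurableT_comp (diffeo_measurable D) _; exact: measurable_fst.
      by apply: measurableT_comp (diffeo_measurable D) _; exact: measurable_snd.
    by apply: measurable_funM; [exact: measurable_comp1|exact: measurable_comp2].
  - apply: measurable_funTS; apply: emeasurable_funM => //.
    by apply/measurable_EFinP; exact: measurable_gagliardo.
  move=> z _; rewrite -EFinM lee_fin gagliardo_integrandE -expr2 -[leRHS]mulrA.
  have [->|z12] := eqVneq z.1 z.2; first by rewrite subrr expr0n !mul0r.
  rewrite ler_wpM2l ?sqr_ge0//.
  have /andP[a1 a2] := diffeo_jac_bounds D z.1.
  have /andP[b1 b2] := diffeo_jac_bounds D z.2.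
  apply: (@le_trans _ _ (K * riesz_kernel s (z.1 - z.2) * (2 * 2))); last lra.
  by rewrite ler_pM ?riesz_kernel_ge0 ?mulr_ge0 ?diffeo_jac_ge0 ?hK// ler_pM ?diffeo_jac_ge0.
rewrite ge0_integralZr//; last 4 first.
- exact: measurable_T_upper.
- by apply/measurable_EFinP/measurable_funTS; exact: measurable_gagliardo.
- by move=> z _; rewrite lee_fin gagliardo_sqr_ge0.
- by rewrite lee_fin mulr_ge0.
by rewrite muleC; apply: lte_mul_pinfty; rewrite ?lee_fin ?mulr_ge0.
Qed.

End diffeo.

(** * Translation increments *)

Section shift.
Variables (R : realType) (m : nat).
Local Notation L := (lebesgue_rV R m.+1).
Local Notation mu := (@lebesgue_measure R).
Local Notation rV := 'rV[R]_m.+1.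
Local Notation L2 := (L \x L)%E.
Local Notation upper := (@upper_half R m).
Local Notation TT := (@T_upper R m).
Implicit Types (i : 'I_m.+1) (t : R) (x : rV) (w : rV -> R).

Definition shift i t x : rV := upd i x (x ord0 i + t).

Lemma shiftD i t t' x : shift i t (shift i t' x) = shift i (t' + t) x.
Proof. by rewrite /shift updK upd_same addrA. Qed.

Lemma shift0 i x : shift i 0 x = x.
Proof. by rewrite /shift addr0 upd_id. Qed.

Lemma shiftK i t : cancel (shift i t) (shift i (- t)).
Proof. by move=> x; rewrite shiftD subrr shift0. Qed.

Lemma shiftB i t x y : shift i t x - shift i t y = x - y.
Proof.
by apply/rowP => k; rewrite !mxE; case: eqP => // ->; rewrite opprD addrACA subrr addr0.
Qed.

Lemma shift_max i t x : i != ord_max -> shift i t x ord0 ord_max = x ord0 ord_max.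
Proof. by move=> im; rewrite /shift upd_neq// eq_sym. Qed.

Lemma shift_upper i t x : i != ord_max -> upper (shift i t x) <-> upper x.
Proof. by move=> im; rewrite /upper_half/= shift_max. Qed.

Lemma measurable_shift i t : measurable_fun setT (shift i t).
Proof. exact: (@measurable_shear R m i (cst t) (measurable_cst t)). Qed.

Lemma shift_diffeo i t : i != ord_max ->
  half_space_diffeo (shift i t) (shift i (- t)) (cst 1).
Proof.
move=> im.
have [|||x a b ab|S' [SK S'K mS' hS]] :=
  @shear_change_of_variables R m i (cst t) (cst 1).
- exact: measurable_cst.
- exact: measurable_cst.
- by move=> x; apply/andP; split; rewrite /cst; lra.
- have lab : mu `]a, b]%classic = (b - a)%:E.
    rewrite lebesgue_measure_itv/= lte_fin; case: ltgtP ab => // -> _.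
    by rewrite subrr.
  by rewrite /= integral_cst//= lab mul1e; congr EFin; ring.
have S'E : S' = shift i (- t).
  by apply/funext => x; rewrite -[in RHS](S'K x) -[shear _ _ _]/(shift i t _) shiftK.
rewrite -S'E; split => //.
- exact: measurable_shift.
- by move=> x; exact: shift_upper.
- by move=> x; rewrite /lower_half/= shift_max.
- by move=> x; apply/andP; split; rewrite /cst; lra.
Qed.

Lemma diffeo_shift_gagliardo s i t w : i != ord_max -> measurable_fun setT w ->
  gagliardo_form s (w \o shift i t) (w \o shift i t) = gagliardo_form s w w.
Proof.
move=> im mw; have := diffeo_gagliardo (shift_diffeo (- t) im) s mw.
rewrite opprK => ->; apply: eq_integral => z _.
by rewrite shiftB gagliardo_integrandE -expr2 /= !mulr1.
Qed.

Lemma Hs_upper_shift s i t w : i != ord_max -> 2 * s < m.+1%:R ->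
  Hs_upper s w -> Hs_upper s (w \o shift i t).
Proof.
move=> im sm; rewrite -[t]opprK.
apply: (diffeo_Hs_upper (shift_diffeo (- t) im) (K := 1)) => // x y _.
by rewrite shiftB mul1r.
Qed.

Lemma ge0_integral_upper_shift i t (f : rV -> \bar R) : i != ord_max ->
  measurable_fun setT f -> (forall x, upper x -> 0 <= f x)%E ->
  (\int[L]_(x in upper) f (shift i t x) = \int[L]_(x in upper) f x)%E.
Proof.
move=> im mf f0; rewrite -[t]opprK.
rewrite (diffeo_integral_upper (shift_diffeo (- t) im))//.
by apply: eq_integral => x _; rewrite /= mule1.
Qed.

Definition shift_diff i t w x : R := w (shift i t x) - w x.

Lemma measurable_shift_diff i t w : measurable_fun setT w ->
  measurable_fun setT (shift_diff i t w).
Proof.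
move=> mw; apply: measurable_funB => //.
exact: measurableT_comp mw (measurable_shift i t).
Qed.

Definition shift_norm2 i t w : \bar R :=
  (\int[L]_(x in upper) (shift_diff i t w x ^+ 2)%:E)%E.

Lemma shift_norm2_ge0 i t w : (0 <= shift_norm2 i t w)%E.
Proof. by apply: integral_ge0 => x _; rewrite lee_fin sqr_ge0. Qed.

(** The second point y ranges over the cube of side t with lowest corner x. It is within
    sup-distance t of both x and x + t e_i, and it stays in the upper half-space, so both pairs lie
    in T(R^n_+). *)
Let cube t : set (rV * rV) :=
  [set z : rV * rV | upper z.1 /\ forall k, 0 <= z.2 ord0 k - z.1 ord0 k <= t].

Let measurable_cube t : measurable (cube t).
Proof.
rewrite (_ : cube t = (fst @^-1` upper) `&` \bigcap_(k in [set: 'I_m.+1])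
   ((fun z : rV * rV => z.2 ord0 k - z.1 ord0 k) @^-1` `[0, t]%classic)).
  apply: measurableI.
    rewrite -[X in measurable X]setTI; apply: measurable_fst => //.
    exact: measurable_upper.
  apply: fin_bigcap_measurable => // k _.
  rewrite -[X in measurable X]setTI.
  apply: (measurable_funB (f := fun z : rV * rV => z.2 ord0 k)
      (g := fun z : rV * rV => z.1 ord0 k)) => //.
    exact: (measurable_comp2 (measurable_coord k)).
  exact: (measurable_comp1 (measurable_coord k)).
apply/seteqP; split => z /= [h1 h2]; split => // k.
  by move=> _; rewrite /= in_itv/= h2.
by have := h2 k Logic.I; rewrite /= in_itv.
Qed.

Let cube_volume t x : 0 < t ->
  L [set y : rV | forall k, 0 <= y ord0 k - x ord0 k <= t] = (t ^+ m.+1)%:E.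
Proof.
move=> t0.
rewrite (_ : [set y : rV | _] = rV_box (fun k => `[x ord0 k, x ord0 k + t]%classic)).
  transitivity (\prod_(k < m.+1) mu `[x ord0 k, (x ord0 k + t)%R])%E.
    by apply: lebesgue_rV_box => k; exact: measurable_itv.
  transitivity (\prod_(k < m.+1) t%:E)%E.
    apply: eq_bigr => k _; rewrite lebesgue_measure_itv/= lte_fin ltrDl t0.
    by rewrite -EFinB addrAC subrr add0r.
  by rewrite prodEFin big_const_ord iter_mulr_1.
by apply/seteqP; split => y /= h k; have := h k; rewrite /= in_itv/=; lra.
Qed.

(** Such an x has |x|^2 <= n t^2, which bounds the kernel from below. *)
Lemma sqr_le_kernel s t (d : R) x : 0 < s -> 0 < t -> (forall k, `|x ord0 k| <= t) -> x != 0 ->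
  d ^+ 2 <= m.+1%:R `^ ((m.+1%:R + 2 * s) / 2) * t `^ (m.+1%:R + 2 * s) *
    (d ^+ 2 * riesz_kernel s x).
Proof.
move=> s0 t0 xt x0.
set r := (m.+1%:R + 2 * s) / 2.
have r0 : 0 <= r by rewrite divr_ge0// addr_ge0 ?mulr_ge0// ltW.
have -> : t `^ (m.+1%:R + 2 * s) = (t ^+ 2) `^ r.
  by rewrite -powR_mulrn ?(ltW t0)// -powRrM /r; congr (_ `^ _); field.
rewrite -powRM ?sqr_ge0//.
have sq0 := sqn_gt0 x0.
have sqle : sqn x <= m.+1%:R * t ^+ 2.
  rewrite /sqn -[X in X%:R * _]card_ord -sum1_card natr_sum mulr_suml.
  apply: ler_sum => k _; rewrite mul1r -[_ ^+ 2]real_normK ?num_real//.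
  by rewrite ler_sqr ?nnegrE// ltW.
have : sqn x `^ r <= (m.+1%:R * t ^+ 2) `^ r.
  by rewrite ge0_ler_powR// nnegrE ?sqn_ge0// mulr_ge0 ?sqr_ge0.
move=> h; rewrite mulrCA ler_peMr ?sqr_ge0// /riesz_kernel powRN ler_pdivlMr ?powR_gt0//.
by rewrite mul1r.
Qed.

Lemma gagliardo_extension s w : measurable_fun setT w ->
  exists F : rV * rV -> \bar R, [/\ measurable_fun setT F,
    forall z, (0 <= F z)%E,
    forall z, TT z -> F z = (gagliardo_integrand s w w z)%:E &
    (\int[L2]_z F z = gagliardo_form s w w)%E].
Proof.
move=> mw; exists ((EFin \o gagliardo_integrand s w w) \_ TT); split.
- apply: measurable_erestrict; first exact: measurable_T_upper.
  by apply/measurable_EFinP; exact: measurable_gagliardo.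
- by move=> z; rewrite patchE; case: ifP => // _; rewrite lee_fin gagliardo_sqr_ge0.
- by move=> z zT; rewrite patchE mem_set.
- by rewrite /gagliardo_form [RHS]integral_mkcond.
Qed.

Lemma ge0_integral_prod_shift i t (F : rV * rV -> \bar R) : i != ord_max ->
  measurable_fun setT F -> (forall z, 0 <= F z)%E ->
  (\int[L2]_z F (shift i t z.1, z.2) = \int[L2]_z F z)%E.
Proof.
move=> im mF F0.
have mFS : measurable_fun [set: rV * rV] (fun z => F (shift i t z.1, z.2)).
  apply: measurableT_comp mF _; apply: measurable_fun_pair.
    by apply: measurableT_comp (measurable_shift i t) _; exact: measurable_fst.
  exact: measurable_snd.
rewrite (ge0_integral_prod_rV mFS (fun z => F0 _)) (ge0_integral_prod_rV mF F0).
rewrite -[RHS](diffeo_integral (shift_diffeo t im)); last 2 first.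
- exact: (measurable_fun_integral_rV mF F0).
- by move=> x; apply: integral_ge0.
by apply: eq_integral => x _; rewrite mule1.
Qed.

Lemma ge0_integral_cube t (g : rV -> R) : 0 < t -> measurable_fun setT g ->
  (forall x, 0 <= g x) ->
  exists H : rV * rV -> \bar R, [/\ measurable_fun setT H,
    forall z, (0 <= H z)%E,
    forall z, cube t z -> H z = (g z.1)%:E,
    forall z, ~ cube t z -> H z = 0%E &
    (\int[L2]_z H z = (t ^+ m.+1)%:E * \int[L]_(x in upper) (g x)%:E)%E].
Proof.
move=> t0 mg g0; exists ((fun z => (g z.1)%:E) \_ (cube t)).
set H := (X in measurable_fun _ X).
have H0 z : (0 <= H z)%E.
  by rewrite /H patchE; case: ifP => // _; rewrite lee_fin.
have mH : measurable_fun setT H.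
  apply: measurable_erestrict; first exact: measurable_cube.
  by apply/measurable_EFinP; exact: measurable_comp1.
split => //; [by move=> z zc; rewrite /H patchE mem_set|
  by move=> z zc; rewrite /H patchE memNset|].
rewrite (ge0_integral_prod_rV mH H0).
rewrite [in RHS]integral_mkcond -ge0_integralZl//; last 3 first.
- apply: measurable_erestrict; first exact: measurable_upper.
  exact/measurable_EFinP.
- by move=> x _; rewrite patchE; case: ifP => // _; rewrite lee_fin.
- by rewrite lee_fin exprn_ge0// ltW.
apply: eq_integral => x _; rewrite patchE.
case: ifPn => xu; last first.
  rewrite mule0 integral0_eq// => y _; rewrite /H patchE memNset//= => -[xu' _].
  by move: xu; rewrite mem_set.
rewrite -(cube_volume x t0) muleC.
have mcx : measurable [set y : rV | forall k, 0 <= y ord0 k - x ord0 k <= t].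
  have := measurable_xsection x (measurable_cube t).
  rewrite (_ : xsection _ _ = [set y : rV | forall k, 0 <= y ord0 k - x ord0 k <= t])//.
  apply/seteqP; split => y; rewrite /xsection/= inE /cube/=.
    by case.
  by move=> h; split => //; move: xu; rewrite inE.
rewrite -[in RHS](integral_cst L mcx) [RHS]integral_mkcond.
apply: eq_integral => y _; rewrite /H !patchE.
have [yc|yc] := pselect (forall k, 0 <= y ord0 k - x ord0 k <= t).
  by rewrite !mem_set//=; split => //; move: xu; rewrite inE.
by rewrite !memNset//= => -[].
Qed.

(** Compare w(x + t e_i) and w(x) through w(y), with y averaged over the cube of volume t^n at x.
    The kernel is at least a constant times t^-(n+2s) there, so dividing by the volume leaves
    t^(2s). The factor 4 is 2 from squaring a sum, times two copies of the energy. *)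
Lemma shift_norm2_le s i t w : i != ord_max -> 0 < s -> 0 < t ->
  measurable_fun setT w ->
  (shift_norm2 i t w <= (4 * m.+1%:R `^ ((m.+1%:R + 2 * s) / 2) * t `^ (2 * s))%:E *
     gagliardo_form s w w)%E.
Proof.
move=> im s0 t0 mw.
set a := m.+1%:R `^ _.
pose K := a * t `^ (m.+1%:R + 2 * s).
have K0 : 0 <= K by rewrite mulr_ge0 ?powR_ge0.
have [F [mF F0 FE intF]] := gagliardo_extension s mw.
have mFS : measurable_fun [set: rV * rV] (fun z => F (shift i t z.1, z.2)).
  apply: measurableT_comp mF _; apply: measurable_fun_pair.
    by apply: measurableT_comp (measurable_shift i t) _; exact: measurable_fst.
  exact: measurable_snd.
have intFS := ge0_integral_prod_shift t im mF F0.
rewrite intF in intFS.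
have FS0 z : (0 <= F (shift i t z.1, z.2))%E by [].
pose g x := shift_diff i t w x ^+ 2.
have mg : measurable_fun setT g.
  by apply: measurable_funX; exact: measurable_shift_diff.
have [H [mH H0 HE HE0 intH]] := ge0_integral_cube t0 mg (fun x => sqr_ge0 _).
rewrite -/(shift_norm2 i t w) in intH.
have HF z : (H z <= (2 * K)%:E * (F (shift i t z.1, z.2) + F z))%E.
  have [zc|zc] := pselect (cube t z); last first.
    by rewrite HE0// mule_ge0 ?adde_ge0// lee_fin mulr_ge0.
  rewrite HE//; have [zu zt] := zc.
  have z2u : upper z.2.
    by have /andP[h _] := zt ord_max; move: zu; rewrite /upper_half/=; lra.
  have Tz : TT z by move=> [h _]; move: h zu; rewrite /lower_half/upper_half/=; lra.
  have Tz' : TT (shift i t z.1, z.2).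
    by move=> [_ h]; move: h z2u; rewrite /lower_half/upper_half/=; lra.
  rewrite !FE// -EFinD -EFinM lee_fin !gagliardo_integrandE/=.
  rewrite -!expr2 /g /shift_diff.
  have e1 : (w (shift i t z.1) - w z.2) ^+ 2 <=
      K * ((w (shift i t z.1) - w z.2) ^+ 2 * riesz_kernel s (shift i t z.1 - z.2)).
    have [->|zz] := eqVneq (shift i t z.1) z.2; first by rewrite subrr expr0n !mul0r mulr0.
    apply: sqr_le_kernel => //; last by rewrite subr_eq0.
    move=> k; have /andP[h1 h2] := zt k; rewrite !mxE ler_norml.
    by case: eqP => [->|_]; [have /andP[h3 h4] := zt i|]; lra.
  have e2 : (w z.1 - w z.2) ^+ 2 <= K * ((w z.1 - w z.2) ^+ 2 * riesz_kernel s (z.1 - z.2)).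
    have [->|zz] := eqVneq z.1 z.2; first by rewrite subrr expr0n !mul0r mulr0.
    apply: sqr_le_kernel => //; last by rewrite subr_eq0.
    by move=> k; have /andP[h1 h2] := zt k; rewrite !mxE ler_norml; lra.
  have := sqr_ge0 ((w (shift i t z.1) - w z.2) + (w z.1 - w z.2)).
  by lra.
have : ((t ^+ m.+1)%:E * shift_norm2 i t w <= (4 * K)%:E * gagliardo_form s w w)%E.
  rewrite -intH.
  apply: (@le_trans _ _ (\int[L2]_z ((2 * K)%:E * (F (shift i t z.1, z.2) + F z)))%E).
    apply: ge0_le_integral => //.
    by apply: emeasurable_funM => //; exact: emeasurable_funD.
  rewrite ge0_integralZl//; last 3 first.
  - exact: emeasurable_funD.
  - by move=> z _; rewrite adde_ge0.
  - by rewrite lee_fin mulr_ge0.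
  rewrite ge0_integralD// intFS intF.
  rewrite [(4 * K)%:E](_ : _ = (2 * K)%:E * (1%:E + 1%:E))%E.
    by rewrite -muleA ge0_muleDl// mul1e.
  by rewrite -EFinD -EFinM; congr EFin; ring.
have -> : (4 * K)%:E = ((t ^+ m.+1)%:E * (4 * a * t `^ (2 * s))%:E)%E.
  rewrite -EFinM /K powRD; last first.
    by apply/implyP => /eqP; have := ler0n R m.+1; lra.
  by rewrite powR_mulrn ?ltW//; congr EFin; ring.
by rewrite -muleA lee_pmul2l// lte_fin exprn_gt0.
Qed.

End shift.

(** * Comparison of energies and decay of tangential increments *)

Section weak_solution_theory.
Variables (R : realType) (m : nat) (s p M : R) (u : 'rV[R]_m.+1 -> R).
Local Notation L := (lebesgue_rV R m.+1).
Local Notation rV := 'rV[R]_m.+1.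
Local Notation upper := (@upper_half R m).

Hypotheses (s_gt0 : 0 < s) (n_gt2s : 2 * s < m.+1%:R) (p_gt1 : 1 < p).
Hypothesis weak_u : weak_solution s p u.
Hypothesis u_bounds : forall x, upper x -> 0 <= u x <= M.

Local Notation c := (frac_laplacian_const m s / 2).

Definition potential (v : rV -> R) : R := \int[L]_(x in upper) (v x `^ (p + 1)).

(** Only c >= 0 is derived: the constant is the inverse of a [fine] integral, hence 0 should that
    integral be infinite. The case c = 0 is dealt with in [potential_eq0]. *)
Lemma frac_laplacian_const_ge0 : 0 <= c.
Proof.
rewrite divr_ge0// invr_ge0 fine_ge0//; apply: integral_ge0 => z _.
by rewrite lee_fin divr_ge0 ?powR_ge0// subr_ge0 cos_le1.
Qed.

Lemma powR_mulS x : 0 <= x -> x `^ p * x = x `^ (p + 1).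
Proof.
move=> x0; rewrite powRD; last by apply/implyP => /eqP; have := p_gt1; lra.
by rewrite powRr1.
Qed.

Let hu : Hs_upper s u. Proof. by have [] := weak_u. Qed.

Lemma weak_solution_eq v : Hs_upper s v ->
  L.-integrable upper (fun x => (u x `^ p * v x)%:E) /\
  c * energy s u v = \int[L]_(x in upper) (u x `^ p * v x).
Proof.
move=> hv; have [_ _ /(_ v hv) [iuv uv]] := weak_u; split => //.
by rewrite /Rintegral -uv gagliardo_formE.
Qed.

Lemma integrable_potential : L.-integrable upper (fun x => (u x `^ (p + 1))%:E).
Proof.
have [iu _] := weak_solution_eq hu; apply: eq_integrable iu.
  exact: measurable_upper.
by move=> x /[!inE] /u_bounds/andP[u0 _]; rewrite powR_mulS.
Qed.

Lemma energy_potential : c * energy s u u = potential u.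
Proof.
have [_ ->] := weak_solution_eq hu.
by apply: eq_Rintegral => x /[!inE] /u_bounds/andP[u0 _]; rewrite powR_mulS.
Qed.

(* The first-order part of the potential is removed by testing the equation
   against v; what is left of its Taylor expansion is quadratic. *)
Lemma energy_comparison v N : Hs_upper s v ->
  (forall x, upper x -> 0 <= v x <= M) ->
  L.-integrable upper (fun x => (v x `^ (p + 1))%:E) ->
  (\int[L]_(x in upper) ((v x - u x) ^+ 2)%:E <= N%:E)%E ->
  c * energy s (fun x => v x - u x) (fun x => v x - u x) <=
  c * (energy s v v - energy s u u) -
  2 / (p + 1) * (potential v - potential u) + 2 * (p * M `^ (p - 1)) * N.
Proof.
move=> hv v_bounds iv hN.
have mup := @measurable_upper R m.
rewrite (energyB hu hv).
have [iuv uvE] := weak_solution_eq hv.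
have iu := integrable_potential.
have [mu _ _] := hu; have [mv _ _] := hv.
have mvu : measurable_fun setT (fun x => (v x - u x) ^+ 2).
  by apply: measurable_funX; exact: measurable_funB.
have ivu : L.-integrable upper (EFin \o (fun x => (v x - u x) ^+ 2)).
  apply/integrableP; split; first exact/measurable_EFinP/measurable_funTS.
  under eq_integral do rewrite /= ger0_norm ?sqr_ge0//.
  by apply: le_lt_trans hN _; rewrite ltry.
pose C := p * M `^ (p - 1).
have C0 : 0 <= C by rewrite mulr_ge0 ?powR_ge0//; have := p_gt1; lra.
have i1 := integrableB mup iv iu.
have i2 := integrableZl mup (p + 1)^-1 i1.
have i3 := integrableZl mup C ivu.
have pt x : upper x ->
    u x `^ (p + 1) + (p + 1)^-1 * (v x `^ (p + 1) - u x `^ (p + 1)) <=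
    u x `^ p * v x + C * (v x - u x) ^+ 2.
  move=> xu; have ux := u_bounds xu; have vx := v_bounds x xu.
  have := powR_taylor p_gt1 ux vx; rewrite -/C.
  have /andP[u0 _] := ux; rewrite -(powR_mulS u0).
  by rewrite mulrC; lra.
have := le_Rintegral mup (integrableD mup iu i2) (integrableD mup iuv i3) pt.
rewrite (RintegralD mup iu i2) (RintegralZl (p + 1)^-1 mup i1) (RintegralB mup iv iu).
rewrite (RintegralD mup iuv i3) (RintegralZl C mup ivu).
have ep := energy_potential.
rewrite -/(potential v) -/(potential u) -uvE.
have : C * \int[L]_(x in upper) ((v x - u x) ^+ 2) <= C * N.
  rewrite ler_wpM2l// -lee_fin fineK//; exact: integrable_fin_num ivu.
rewrite -[p * M `^ (p - 1)]/C.
move: (energy s u u) (energy s v v) (energy s u v) ep => Eu Ev Euv ep.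
move: (potential u) (potential v) ep => Pu Pv ep.
by move=> h1 h2; lra.
Qed.

Let Cs := 4 * m.+1%:R `^ ((m.+1%:R + 2 * s) / 2).

Let Cs_ge0 : 0 <= Cs.
Proof. by rewrite mulr_ge0 ?powR_ge0. Qed.

Section tangential.
Variable i : 'I_m.+1.
Hypothesis i_tangential : i != ord_max.

Lemma shift_norm2_fin t : 0 < t -> shift_norm2 i t u \is a fin_num.
Proof.
move=> t0; rewrite ge0_fin_numE ?shift_norm2_ge0//.
have [mu _ fu] := hu.
apply: le_lt_trans (shift_norm2_le i_tangential s_gt0 t0 mu) _.
apply: lte_mul_pinfty => //; rewrite lee_fin mulr_ge0 ?powR_ge0//.
Qed.

Let a t := fine (shift_norm2 i t u).

Let aE t : 0 < t -> shift_norm2 i t u = (a t)%:E.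
Proof. by move=> t0; rewrite fineK// shift_norm2_fin. Qed.

Let a_ge0 t : 0 <= a t.
Proof. by rewrite fine_ge0// shift_norm2_ge0. Qed.

Lemma energy_shift_diff t : 0 < t ->
  c * energy s (shift_diff i t u) (shift_diff i t u) <= 2 * (p * M `^ (p - 1)) * a t.
Proof.
move=> t0; have [mu _ _] := hu.
have hv := Hs_upper_shift t i_tangential n_gt2s hu.
have mpow : measurable_fun setT (fun x => (u x `^ (p + 1))%:E).
  by apply/measurable_EFinP; exact: measurableT_comp (measurable_powR _) mu.
have pot : (\int[L]_(x in upper) (u (shift i t x) `^ (p + 1))%:E =
    \int[L]_(x in upper) (u x `^ (p + 1))%:E)%E.
  apply: (ge0_integral_upper_shift t i_tangential mpow).
  by move=> x _; rewrite lee_fin powR_ge0.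
have := @energy_comparison (u \o shift i t) (a t) hv.
rewrite /energy (diffeo_shift_gagliardo _ _ i_tangential mu) subrr mulr0.
rewrite /potential /Rintegral pot subrr mulr0 subrr add0r; apply.
- by move=> x xu; apply: u_bounds; exact/shift_upper.
- have [_ fu] := integrableP _ _ _ integrable_potential.
  apply/integrableP; split.
    apply: measurable_funTS; apply: measurableT_comp mpow _.
    exact: measurable_shift.
  move: fu; under eq_integral do rewrite /= ger0_norm ?powR_ge0//.
  by under [X in _ -> (X < _)%E]eq_integral do rewrite /= ger0_norm ?powR_ge0//;
    rewrite pot.
- by rewrite -aE.
Qed.

(* By [energy_shift_diff] the increment w of u satisfies a fractional Poincare
   bound |w(. + t e_i) - w|_2^2 = O(t^(2s)) a(t), where w(. + t e_i) - w is the
   second difference of u; so a(2t) is nearly 4 a(t). *)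
Lemma shift_norm2_halving : 0 < c ->
  exists2 t0, 0 < t0 & forall t, 0 < t <= t0 -> a t <= a (2 * t) / 3.
Proof.
move=> c0.
pose B := 2 * (p * M `^ (p - 1)) / c.
have B0 : 0 <= B by rewrite divr_ge0 ?(ltW c0)// !mulr_ge0 ?powR_ge0//; have := p_gt1; lra.
have CB0 : 0 < 14 * Cs * B + 1 by have := mulr_ge0 Cs_ge0 B0; lra.
(* For t below this threshold, 2 Cs t^(2s) B a(t) is at most a(t) / 7. *)
exists ((14 * Cs * B + 1)^-1 `^ (2 * s)^-1).
  by rewrite powR_gt0// invr_gt0.
move=> t /andP[t0 tt].
have ts : t `^ (2 * s) * (14 * Cs * B + 1) <= 1.
  have s2 : 0 < 2 * s by have := s_gt0; lra.
  rewrite -ler_pdivlMr// mul1r.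
  have := @ge0_ler_powR _ (2 * s) (ltW s2) t _ _ _ tt.
  rewrite -powRrM mulVf ?gt_eqF// powRr1 ?invr_ge0 ?(ltW CB0)//.
  by apply; rewrite nnegrE ?powR_ge0// ltW.
have [mu _ fu] := hu.
pose w := shift_diff i t u.
have mw : measurable_fun setT w by exact: measurable_shift_diff.
have hw : Hs_upper s w.
  exact: Hs_upperB n_gt2s hu (Hs_upper_shift t i_tangential n_gt2s hu).
have Ew : energy s w w <= B * a t.
  have := energy_shift_diff t0; rewrite -/w /B => h.
  by rewrite mulrAC ler_pdivlMr// mulrC.
have hww : (shift_norm2 i t w <= (Cs * t `^ (2 * s) * (B * a t))%:E)%E.
  apply: le_trans (shift_norm2_le i_tangential s_gt0 t0 mw) _.
  rewrite gagliardo_formE// -EFinM lee_fin ler_wpM2l// mulr_ge0 ?powR_ge0//.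
have mup := @measurable_upper R m.
have t20 : 0 < 2 * t by lra.
(* Let D1, D2 be the increments of u with steps t and 2t, so that w has increment D2 - 2 D1. Any
   weight above 1/4 could stand before D2^2; with 2/7 the difference of the two sides is (4 D2 - 7
   D1)^2 / 7. Absorbing a(t) / 7 then gives (6/7) a(t) <= (2/7) a(2t), whence the factor 3. *)
have : (shift_norm2 i t u <= (2 / 7)%:E * shift_norm2 i (2 * t) u +
    2%:E * shift_norm2 i t w)%E.
  rewrite /shift_norm2.
  have mE k v : measurable_fun setT v ->
      measurable_fun upper (fun x => (shift_diff i k v x ^+ 2)%:E).
    move=> mv; apply/measurable_EFinP/measurable_funTS/measurable_funX.
    exact: measurable_shift_diff.
  rewrite -ge0_integralZl//; [|exact: mE|by move=> x _; rewrite lee_fin sqr_ge0].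
  rewrite -ge0_integralZl//; [|exact: mE|by move=> x _; rewrite lee_fin sqr_ge0].
  rewrite -ge0_integralD//; last 4 first.
  - by move=> x _; rewrite -EFinM lee_fin mulr_ge0 ?sqr_ge0.
  - by apply: emeasurable_funM => //; exact: mE.
  - by move=> x _; rewrite -EFinM lee_fin mulr_ge0 ?sqr_ge0.
  - by apply: emeasurable_funM => //; exact: mE.
  apply: ge0_le_integral => //.
  - by move=> x _; rewrite lee_fin sqr_ge0.
  - exact: mE.
  - apply: emeasurable_funD; apply: emeasurable_funM => //; exact: mE.
  move=> x _; rewrite -!EFinM -EFinD lee_fin.
  have -> : shift_diff i t w x =
      shift_diff i (2 * t) u x - 2 * shift_diff i t u x.
    by rewrite /w /shift_diff shiftD (_ : t + t = 2 * t); ring.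
  have := sqr_ge0 (4 * shift_diff i (2 * t) u x - 7 * shift_diff i t u x); lra.
rewrite (aE t0) (aE t20) => h.
have : ((a t)%:E <= (2 / 7 * a (2 * t) + 2 * (Cs * t `^ (2 * s) * (B * a t)))%:E)%E.
  apply: le_trans h _; rewrite [in leRHS]EFinD !EFinM leeD2l//.
  by rewrite -!EFinM EFinM lee_pmul2l// ?lte_fin.
rewrite lee_fin => h1.
have : t `^ (2 * s) * (14 * Cs * B) * a t <= 1 * a t.
  by rewrite ler_wpM2r//; have := powR_ge0 t (2 * s); lra.
by move=> h2; lra.
Qed.

(** Iterated halving, started from the O(t^(2s)) bound of [shift_norm2_le] at scale [t0]. *)
Lemma shift_norm2_decay : 0 < c ->
  exists A t0, [/\ 0 <= A, 0 < t0 & forall k t, 0 < t <= t0 / 2 ^+ k ->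
    (shift_norm2 i t u <= (A / 3 ^+ k)%:E)%E].
Proof.
move=> /shift_norm2_halving[t0 t00 ht].
have [mu _ fu] := hu.
pose A := Cs * t0 `^ (2 * s) * energy s u u.
have A0 : 0 <= A by rewrite !mulr_ge0 ?powR_ge0 ?energy_ge0.
exists A, t0; split => //; elim => [|k ih] t /andP[t_gt0 tk].
  rewrite expr0 divr1; apply: le_trans (shift_norm2_le i_tangential s_gt0 t_gt0 mu) _.
  rewrite gagliardo_formE// -EFinM lee_fin ler_wpM2r ?energy_ge0// ler_wpM2l//.
  rewrite ge0_ler_powR ?nnegrE ?(ltW t_gt0) ?(ltW t00)//; first by have := s_gt0; lra.
  by move: tk; rewrite expr0 divr1.
have k2 : 0 < 2 ^+ k :> R by rewrite exprn_gt0.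
have tk2 : 2 * t <= t0 / 2 ^+ k.
  by move: tk; rewrite exprS ler_pdivlMr ?mulr_gt0// ler_pdivlMr//; lra.
have tt0 : t <= t0.
  have : t0 / 2 ^+ k <= t0.
    by rewrite ler_pdivrMr// ler_peMr ?(ltW t00)// exprn_ege1// ler1n.
  lra.
have := ih (2 * t); rewrite tk2 mulr_gt0// => /(_ isT).
rewrite !aE ?mulr_gt0// !lee_fin => h.
have := ht t; rewrite t_gt0 tt0 => /(_ isT) h1; apply: le_trans h1 _.
by rewrite exprS invfM mulrA [A / 3]mulrC -mulrA [leRHS]mulrC ler_wpM2r.
Qed.

End tangential.

End weak_solution_theory.

Lemma integrable_mul_bounded d (T : measurableType d) (R : realType)
    (mu : {measure set T -> \bar R}) (D : set T) (f g : T -> R) (B : R) :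
  measurable D -> mu.-integrable D (EFin \o f) -> measurable_fun D g ->
  (forall x, D x -> `|g x| <= B) ->
  mu.-integrable D (EFin \o (fun x => f x * g x)).
Proof.
move=> mD fi mg gB.
have mf : measurable_fun D f by apply/measurable_EFinP; exact: measurable_int fi.
have := integrableZl mD B fi; apply: le_integrable => //.
  by apply/measurable_EFinP; exact: measurable_funM.
move=> x Dx; rewrite /= lee_fin !normrM mulrC ler_wpM2r//.
by apply: le_trans (gB _ Dx) _; exact: ler_norm.
Qed.

Lemma kernel_bound_of_ratio (R : realType) (k k' j1 j2 b B : R) :
  0 <= k -> 0 <= k' -> 2^-1 <= j1 -> 2^-1 <= j2 ->
  k * (j1 * j2) <= b * k' -> b <= B -> k <= 4 * B * k'.
Proof.
move=> k0 k'0 h1 h2 h bB.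
have jj : 2^-1 * 2^-1 <= j1 * j2 by apply: ler_pM.
have e1 : k * (2^-1 * 2^-1) <= k * (j1 * j2) by rewrite ler_wpM2l.
have e2 : b * k' <= B * k' by rewrite ler_wpM2r.
by lra.
Qed.

Lemma density_factor_bound (R : realType) (t C b B : R) : 0 < t -> t <= 1 ->
  0 <= C -> t * C <= 1 -> `|b| <= B -> 1 + t * b + C * t ^+ 2 <= 2 + B.
Proof.
move=> t0 t1 C0 tC bB.
have h1 : t * b <= B.
  apply: le_trans (ler_norm _) _; rewrite normrM gtr0_norm//.
  by apply: le_trans bB; rewrite ler_piMl.
have h2 : C * t ^+ 2 <= 1.
  rewrite expr2 mulrA [C * t]mulrC; apply: le_trans tC.
  by rewrite ler_piMr// mulr_ge0// ltW.
by lra.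
Qed.

(** * First variation along a vector field *)

Section field.
Variables (R : realType) (m : nat) (i : 'I_m.+1).
Variables (phi J : 'rV[R]_m.+1 -> R) (K : R).
Local Notation L := (lebesgue_rV R m.+1).
Local Notation mu := (@lebesgue_measure R).
Local Notation rV := 'rV[R]_m.+1.
Local Notation L2 := (L \x L)%E.
Local Notation upper := (@upper_half R m).
Local Notation TT := (@T_upper R m).

(** Not the solution of a differential equation but a single Euler step x + t phi(x) e_i, so that it
    is a shear and its Jacobian is affine in t. *)
Definition flow t : rV -> rV := shear i (fun x => t * phi x).

(** [J] stands for the derivative of [phi] along e_i, known through its integrals over segments so
    that piecewise linear fields qualify. The Lipschitz bound in all directions controls the change
    of the kernel. *)
Record admissible_field : Prop := AdmissibleField {
  field_bound_ge0 : 0 <= K;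
  field_measurable : measurable_fun setT phi;
  field_deriv_measurable : measurable_fun setT J;
  field_deriv_bound : forall x, `|J x| <= K;
  field_lipschitz : forall x y, (phi x - phi y) ^+ 2 <= K ^+ 2 * sqn (x - y);
  field_primitive : forall x a b, a <= b ->
    (\int[mu]_(t in `]a, b]) (J (upd i x t))%:E =
     (phi (upd i x b) - phi (upd i x a))%:E)%E;
  flow_upper : forall t x, 0 < t -> upper (flow t x) <-> upper x;
  flow_lower : forall t x, 0 < t -> lower_half (flow t x) <-> lower_half x }.

Hypothesis F : admissible_field.

Lemma flow_diffeo t : 0 < t -> t * (2 * K) <= 1 ->
  exists Psi, half_space_diffeo (flow t) Psi (fun x => 1 + t * J x).
Proof.
move=> t0 tK.
have mphi := field_measurable F; have mJ := field_deriv_measurable F.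
have mh : measurable_fun setT (fun x => t * phi x).
  by apply: measurable_funM => //; exact: measurable_cst.
have mj : measurable_fun setT (fun x => 1 + t * J x).
  apply: measurable_funD; first exact: measurable_cst.
  by apply: measurable_funM => //; exact: measurable_cst.
have jb x : 2^-1 <= 1 + t * J x <= 2.
  have : `|t * J x| <= t * K.
    by rewrite normrM gtr0_norm// ler_wpM2l ?(ltW t0)// (field_deriv_bound F).
  by rewrite ler_norml => /andP[h1 h2]; apply/andP; split; lra.
have [|Psi [PK KP mPsi cov]] := shear_change_of_variables (i := i) mh mj jb.
  move=> x a b ab.
  have mI : measurable (`]a, b]%classic : set (measurableTypeR R)) by exact: measurable_itv.
  have lab : mu `]a, b]%classic = (b - a)%:E.
    rewrite lebesgue_measure_itv/= lte_fin; case: ltgtP ab => // -> _.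
    by rewrite subrr.
  have mJl : measurable_fun `]a, b]%classic (fun r => J (upd i x r)).
    apply: measurable_funTS; apply: measurableT_comp mJ _.
    by apply: measurable_upd => //; exact: measurable_cst.
  have i1 : mu.-integrable `]a, b] (EFin \o cst (1 : R)).
    apply/integrableP; split; first exact/measurable_EFinP/measurable_cst.
    rewrite (eq_integral (cst 1%:E)); last by move=> r _; rewrite /= normr1.
    by rewrite integral_cst//= lab mul1e ltry.
  have iJ : mu.-integrable `]a, b] (EFin \o (fun r => J (upd i x r))).
    have := @integrable_mul_bounded _ _ _ mu _ (cst 1) _ K mI i1 mJl
      (fun r _ => field_deriv_bound F _).
    by apply: eq_integrable => // r _; rewrite /= mul1r.
  have itJ := integrableZl mI t iJ.
  have h := integralD mI i1 itJ.
  rewrite (integralZl mI iJ) in h.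
  apply: (etrans h).
  have -> : (\int[mu]_(r in `]a, b]) (EFin \o (fun r => J (upd i x r))) r =
      (phi (upd i x b) - phi (upd i x a))%:E)%E by exact: field_primitive.
  have -> : (\int[mu]_(r in `]a, b]) (EFin \o cst (1%R : R)) r = (b - a)%:E)%E.
    by rewrite -lab -[RHS]mul1e -(integral_cst _ mI).
  by rewrite -!EFinM -EFinD; congr EFin; ring.
exists Psi; split => //.
- exact: measurable_shear.
- by move=> x; exact: flow_upper.
- by move=> x; exact: flow_lower.
Qed.

Lemma sqn_flow t x y : sqn (flow t x - flow t y) =
  sqn (x - y) + 2 * t * ((x ord0 i - y ord0 i) * (phi x - phi y)) +
  t ^+ 2 * (phi x - phi y) ^+ 2.
Proof.
rewrite /sqn (bigD1 i)//= [in RHS](bigD1 i)//= !mxE eqxx.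
rewrite (eq_bigr (fun k => (x - y) ord0 k ^+ 2)); first by ring.
by move=> k /negPf ki; rewrite !mxE ki.
Qed.

(** The logarithmic derivative at t = 0 of the distance between two points moved by the flow. *)
Definition stretch (z : rV * rV) : R :=
  (z.1 ord0 i - z.2 ord0 i) * (phi z.1 - phi z.2) / sqn (z.1 - z.2).

Lemma stretch_bound z : `|stretch z| <= K.
Proof.
have K0 := field_bound_ge0 F.
rewrite /stretch; have [->|z0] := eqVneq (z.1 - z.2) 0.
  have -> : sqn (0 : rV) = 0.
    by rewrite /sqn big1// => k _; rewrite mxE expr0n.
  by rewrite invr0 mulr0 normr0.
have d0 := sqn_gt0 z0.
rewrite -ler_sqr ?nnegrE// real_normK ?num_real// expr_div_n exprMn.
rewrite ler_pdivrMr ?exprn_gt0//.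
have h1 := sqr_coord_le_sqn (z.1 - z.2) i.
have h2 := field_lipschitz F z.1 z.2.
have : (z.1 ord0 i - z.2 ord0 i) ^+ 2 * (phi z.1 - phi z.2) ^+ 2 <=
    sqn (z.1 - z.2) * (K ^+ 2 * sqn (z.1 - z.2)).
  by apply: ler_pM; rewrite ?sqr_ge0//; move: h1; rewrite !mxE.
by move=> h; apply: le_trans h _; rewrite [X in _ <= _ * X]expr2; lra.
Qed.

Lemma measurable_stretch : measurable_fun setT phi -> measurable_fun setT stretch.
Proof.
move=> mphi.
apply: measurable_funM.
  apply: measurable_funM; apply: measurable_funB.
  - exact: (measurable_comp1 (measurable_coord i)).
  - exact: (measurable_comp2 (measurable_coord i)).
  - exact: measurable_comp1.
  - exact: measurable_comp2.
under eq_fun do rewrite -powR_inv1 ?sqn_ge0//.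
apply: measurableT_comp (measurable_powR _) _.
apply: measurableT_comp (@measurable_sqn R m) _; apply: measurable_rV_sub.
  exact: measurable_fst.
exact: measurable_snd.
Qed.

Variable s : R.
Hypotheses (s_gt0 : 0 < s) (n_gt2s : 2 * s < m.+1%:R).
Let a := m.+1%:R + 2 * s.

Let a_gt0 : 0 < a.
Proof. by rewrite addr_gt0// mulr_gt0. Qed.

(* The logarithmic derivative at t = 0 of the kernel transported by the flow, with
   its two Jacobian factors. *)
Definition energy_density (z : rV * rV) : R := J z.1 + J z.2 - a * stretch z.

Lemma energy_density_bound z : `|energy_density z| <= (2 + a) * K.
Proof.
have h1 := field_deriv_bound F z.1; have h2 := field_deriv_bound F z.2.
have h3 : `|a * stretch z| <= a * K.
  by rewrite normrM gtr0_norm// ler_wpM2l ?(ltW a_gt0)// stretch_bound.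
by apply: le_trans (ler_normB _ _) _; have := ler_normD (J z.1) (J z.2); lra.
Qed.

Lemma measurable_energy_density : measurable_fun setT energy_density.
Proof.
have mJ := field_deriv_measurable F.
apply: measurable_funB.
  by apply: measurable_funD; [exact: measurable_comp1|exact: measurable_comp2].
apply: measurable_funM; [exact: measurable_cst|exact: measurable_stretch (field_measurable F)].
Qed.

Definition energy_variation (u : rV -> R) : R :=
  \int[L2]_(z in TT) (gagliardo_integrand s u u z * energy_density z).

Lemma integrable_energy_density u : Hs_upper s u ->
  L2.-integrable TT (EFin \o (fun z => gagliardo_integrand s u u z * energy_density z)).
Proof.
move=> hu; apply: (integrable_mul_bounded (B := (2 + a) * K)).
- exact: measurable_T_upper.
- exact: integrable_gagliardo_sqr.
- by apply: measurable_funTS; exact: measurable_energy_density.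
- by move=> z _; exact: energy_density_bound.
Qed.

(** After the change of variables both energies integrate the same squares (u(x) - u(y))^2, so
    [kernel_ratio] compares them pointwise off the diagonal, where alone the integrands can be
    nonzero. *)
Lemma flow_energy : exists C t1 : R, [/\ 0 <= C, 0 < t1 & forall t Psi u,
  0 < t <= t1 -> half_space_diffeo (flow t) Psi (fun x => 1 + t * J x) ->
  Hs_upper s u -> Hs_upper s (u \o Psi) /\
  energy s (u \o Psi) (u \o Psi) <=
  energy s u u + t * energy_variation u + C * t ^+ 2 * energy s u u].
Proof.
have K0 := field_bound_ge0 F.
have r0 : 0 <= a / 2 by have := a_gt0; lra.
have [C C0 hC] := kernel_ratio r0 K0.
pose t1 := (1 + C + 4 * K)^-1.
have d0 : 0 < 1 + C + 4 * K by lra.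
have t10 : 0 < t1 by rewrite invr_gt0.
exists C, t1; split => // t Psi u /andP[t0 tt1] D hu.
have tC : t * (1 + C + 4 * K) <= 1 by rewrite -ler_pdivlMr// mul1r.
have t01 : t * C <= 1 /\ 0 <= t * C /\ 0 <= t * K /\ t <= 1 /\ t * (4 * K) <= 1.
  have h1 : 0 <= t * C by rewrite mulr_ge0// ltW.
  have h2 : 0 <= t * K by rewrite mulr_ge0// ltW.
  by split; [|split; [|split; [|split]]]; lra.
have [tC1 [tC0 [tK0 [t1' tK]]]] := t01.
have key z : z.1 != z.2 ->
    [/\ 0 <= 1 + t * J z.1, 0 <= 1 + t * J z.2 &
    riesz_kernel s (flow t z.1 - flow t z.2) * ((1 + t * J z.1) * (1 + t * J z.2)) <=
    (1 + t * energy_density z + C * t ^+ 2) * riesz_kernel s (z.1 - z.2)].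
  move=> z12; have z120 : z.1 - z.2 != 0 by rewrite subr_eq0.
  have d_gt0 := sqn_gt0 z120.
  have h1 := sqr_coord_le_sqn (z.1 - z.2) i.
  have h2 := field_lipschitz F z.1 z.2.
  have [|k1 k2 k3] := hC t _ (z.1 ord0 i - z.2 ord0 i) (phi z.1 - phi z.2)
    (J z.1) (J z.2) t0 tC1 d_gt0 _ h2 (field_deriv_bound F _) (field_deriv_bound F _).
    by move: h1; rewrite !mxE.
  split => //; rewrite /riesz_kernel sqn_flow; apply: le_trans k3 _.
  by rewrite /energy_density /stretch (_ : 2 * (a / 2) = a); [|field].
(* The 4 undoes the two Jacobians, each at least 1/2; the rest is the bound of
   [density_factor_bound]. *)
have hK x y : x != y ->
    riesz_kernel s (flow t x - flow t y) <= (4 * (2 + (2 + a) * K)) * riesz_kernel s (x - y).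
  move=> xy; have [k1 k2 k3] := key (x, y) xy.
  have /andP[j1 _] := diffeo_jac_bounds D x.
  have /andP[j2 _] := diffeo_jac_bounds D y.
  apply: (kernel_bound_of_ratio (riesz_kernel_ge0 _ _) (riesz_kernel_ge0 _ _) j1 j2 k3).
  exact: density_factor_bound t0 t1' C0 tC1 (energy_density_bound (x, y)).
have B0 : 0 <= 4 * (2 + (2 + a) * K).
  by rewrite mulr_ge0// addr_ge0// mulr_ge0//; have := a_gt0; lra.
have hPsi := diffeo_Hs_upper D n_gt2s B0 hK hu.
split => //.
have mT := @measurable_T_upper R m.
have [mu_ _ _] := hu.
rewrite -lee_fin -(gagliardo_formE hPsi hPsi) (diffeo_gagliardo D s mu_).
have ig := integrable_gagliardo_sqr hu.
have id := integrable_energy_density hu.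
have i1 := integrableZl mT t id.
have i2 := integrableZl mT (C * t ^+ 2) ig.
have i3 := integrableD mT ig i1.
have i4 := integrableD mT i3 i2.
have -> : energy s u u + t * energy_variation u + C * t ^+ 2 * energy s u u =
  \int[L2]_(z in TT) (gagliardo_integrand s u u z +
    t * (gagliardo_integrand s u u z * energy_density z) +
    C * t ^+ 2 * gagliardo_integrand s u u z).
  rewrite (RintegralD mT i3 i2) (RintegralD mT ig i1).
  by rewrite (RintegralZl _ mT id) (RintegralZl _ mT ig).
rewrite /Rintegral fineK; last exact: (integrable_fin_num mT i4).
have pt z : (u z.1 - u z.2) ^+ 2 *
      (riesz_kernel s (flow t z.1 - flow t z.2) * ((1 + t * J z.1) * (1 + t * J z.2))) <=
    gagliardo_integrand s u u z +
    t * (gagliardo_integrand s u u z * energy_density z) +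
    C * t ^+ 2 * gagliardo_integrand s u u z.
  have -> : gagliardo_integrand s u u z +
      t * (gagliardo_integrand s u u z * energy_density z) +
      C * t ^+ 2 * gagliardo_integrand s u u z =
      (u z.1 - u z.2) ^+ 2 * ((1 + t * energy_density z + C * t ^+ 2) *
        riesz_kernel s (z.1 - z.2)).
    by rewrite gagliardo_integrandE; ring.
  have [->|z12] := eqVneq z.1 z.2; first by rewrite subrr expr0n !mul0r.
  by rewrite ler_wpM2l ?sqr_ge0//; have [] := key z z12.
apply: ge0_le_integral => //.
- move=> z _; rewrite lee_fin.
  have /andP[j1 _] := diffeo_jac_bounds D z.1.
  have /andP[j2 _] := diffeo_jac_bounds D z.2.
  apply: mulr_ge0; first exact: sqr_ge0.
  apply: mulr_ge0; first exact: riesz_kernel_ge0.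
  by apply: mulr_ge0; apply: le_trans (_ : 0 <= 2^-1) _; rewrite ?invr_ge0.
- apply/measurable_EFinP; apply: measurable_funTS; apply: measurable_funM.
    apply: measurable_funX; apply: measurable_funB.
      exact: measurable_comp1.
    exact: measurable_comp2.
  apply: measurable_funM.
    apply: measurableT_comp (measurable_riesz_kernel s) _.
    have mPhi := diffeo_measurable D.
    apply: measurable_rV_sub.
      by apply: measurableT_comp mPhi _; exact: measurable_fst.
    by apply: measurableT_comp mPhi _; exact: measurable_snd.
  have mj := diffeo_jac_measurable D.
  apply: measurable_funM; first exact: (measurable_comp1 mj).
  exact: (measurable_comp2 mj).
- exact: (measurable_int _ i4).
- by move=> z _; rewrite lee_fin; exact: pt.
Qed.

End field.

(** The arithmetic of [field_inequality]: E and E' are the energies of u and u o Psi, V and I the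
    variations of energy and potential, g = 2/(p+1), Q = p M^(p-1), and 2 e t bounds the L^2
    remainder. Dividing by t and using t <= e leaves g I - c V <= (c C E + 4 Q) e, which is less
    than half of g I - c V if that is positive. *)
Lemma variation_contradiction (R : realType) (t e c E E' V I g C Q P : R) :
  0 <= c -> 0 < t -> t <= e -> 0 <= Q -> 0 <= c * (C * E) ->
  E' <= E + t * V + C * t ^+ 2 * E ->
  0 <= c * (E' - E) - g * (P + t * I - P) + 2 * Q * (2 * (e * t)) ->
  (c * (C * E) + 4 * Q + 1) * e = (g * I - c * V) / 2 -> g * I <= c * V.
Proof.
move=> c0 t0 te Q0 cCE EE h eB; rewrite leNgt; apply/negP => hlt.
have h1 : c * (E' - E) <= c * (t * V + C * t ^+ 2 * E) by rewrite ler_wpM2l//; lra.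
have : 0 <= t * (c * V - g * I + c * (C * E) * t + 4 * Q * e) by lra.
rewrite pmulr_rge0// => h2.
have h3 : c * (C * E) * t <= c * (C * E) * e by rewrite ler_wpM2l.
by lra.
Qed.

(** * The variational inequality for one admissible field *)

Section field_inequality.
Variables (R : realType) (m : nat) (s p M : R) (u : 'rV[R]_m.+1 -> R).
Local Notation L := (lebesgue_rV R m.+1).
Local Notation rV := 'rV[R]_m.+1.
Local Notation upper := (@upper_half R m).
Local Notation c := (frac_laplacian_const m s / 2).

Hypotheses (s_gt0 : 0 < s) (n_gt2s : 2 * s < m.+1%:R) (p_gt1 : 1 < p).
Hypothesis weak_u : weak_solution s p u.
Hypothesis u_bounds : forall x, upper x -> 0 <= u x <= M.

Variables (i : 'I_m.+1) (phi J : rV -> R) (K : R).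
Hypothesis F : admissible_field i phi J K.

Let hu : Hs_upper s u. Proof. by have [] := weak_u. Qed.

Let mup : measurable upper. Proof. exact: measurable_upper. Qed.

Definition potential_variation : R :=
  \int[L]_(x in upper) (u x `^ (p + 1) * J x).

Lemma integrable_potential_mul (g : rV -> R) B : measurable_fun setT g ->
  (forall x, `|g x| <= B) ->
  L.-integrable upper (EFin \o (fun x => u x `^ (p + 1) * g x)).
Proof.
move=> mg gB; apply: integrable_mul_bounded; [exact: mup| | |].
- exact: (integrable_potential p_gt1 weak_u u_bounds).
- exact: measurable_funTS mg.
- by move=> x _; exact: gB.
Qed.

(** The change of variables puts all dependence on t into the Jacobian 1 + t J, so the potential is
    exactly affine in t. *)
Lemma flow_potential t Psi : half_space_diffeo (flow i phi t) Psi (fun x => 1 + t * J x) ->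
  L.-integrable upper (fun x => (u (Psi x) `^ (p + 1))%:E) /\
  potential p (u \o Psi) = potential p u + t * potential_variation.
Proof.
move=> D; have [mu _ _] := hu.
have mpow : measurable_fun setT (fun x => (u x `^ (p + 1))%:E).
  by apply/measurable_EFinP; exact: measurableT_comp (measurable_powR _) mu.
have cov := diffeo_integral_upper D mpow (fun x _ => powR_ge0 _ _).
have i1 := integrable_potential p_gt1 weak_u u_bounds.
have i2 := integrable_potential_mul (field_deriv_measurable F) (field_deriv_bound F).
have i3 := integrableD mup i1 (integrableZl mup t i2).
have covE : (\int[L]_(x in upper) (u (Psi x) `^ (p + 1))%:E =
    \int[L]_(x in upper) (u x `^ (p + 1) + t * (u x `^ (p + 1) * J x))%:E)%E.
  rewrite cov; apply: eq_integral => x _; rewrite -EFinM; congr EFin; ring.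
split.
  apply/integrableP; split.
    by apply: measurable_funTS; exact: measurableT_comp mpow (diffeo_inv_measurable D).
  rewrite (eq_integral (fun x => (u (Psi x) `^ (p + 1))%:E)); last first.
    by move=> x _; rewrite /= ger0_norm ?powR_ge0.
  by rewrite covE; have := integrable_fin_num mup i3; rewrite fin_numElt => /andP[].
have := RintegralD mup i1 (integrableZl mup t i2).
by rewrite (RintegralZl t mup i2) => <-; rewrite /potential /Rintegral covE.
Qed.

(** The competitor is u o Psi, but only the flow has an explicit formula. Substitution exchanges the
    two, at the cost of a Jacobian at most 2. *)
Lemma flow_remainder t Psi N : 0 <= N ->
  half_space_diffeo (flow i phi t) Psi (fun x => 1 + t * J x) ->
  (\int[L]_(x in upper) ((u (flow i phi t x) - u x) ^+ 2)%:E <= N%:E)%E ->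
  (\int[L]_(x in upper) ((u (Psi x) - u x) ^+ 2)%:E <= (2 * N)%:E)%E.
Proof.
move=> N0 D hN; have [mu _ _] := hu.
have mPhi := diffeo_measurable D.
have mf : measurable_fun setT (fun x => ((u (flow i phi t x) - u x) ^+ 2)%:E).
  apply/measurable_EFinP; apply: measurable_funX; apply: measurable_funB => //.
  exact: measurableT_comp mu mPhi.
have -> : (\int[L]_(x in upper) ((u (Psi x) - u x) ^+ 2)%:E =
   \int[L]_(x in upper) (((u (flow i phi t x) - u x) ^+ 2)%:E * (1 + t * J x)%:E))%E.
  rewrite -(diffeo_integral_upper D mf (fun x _ => sqr_ge0 _)).
  by apply: eq_integral => x _; rewrite (diffeo_invK D) -sqrrN opprB.
apply: (@le_trans _ _ (\int[L]_(x in upper)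
    (2%:E * ((u (flow i phi t x) - u x) ^+ 2)%:E))%E).
  apply: ge0_le_integral => //.
  - by move=> x _; rewrite mule_ge0// lee_fin ?sqr_ge0 ?(diffeo_jac_ge0 D).
  - apply: measurable_funTS; apply: emeasurable_funM => //.
    by apply/measurable_EFinP; exact: diffeo_jac_measurable D.
  - by apply: measurable_funTS; apply: emeasurable_funM.
  move=> x _; rewrite muleC lee_wpmul2r ?lee_fin ?sqr_ge0//.
  by have /andP[] := diffeo_jac_bounds D x.
rewrite ge0_integralZl//; last 2 first.
- exact: measurable_funTS.
- by move=> x _; rewrite lee_fin sqr_ge0.
by rewrite EFinM lee_wpmul2l.
Qed.

(** Dividing by t and passing to the limit takes only a remainder that is o(t) along some times
    tending to 0, which is what the hypothesis asks for. *)
Lemma field_inequality :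
  (forall e t1 : R, 0 < e -> 0 < t1 -> exists t, 0 < t <= t1 /\
    (\int[L]_(x in upper) ((u (flow i phi t x) - u x) ^+ 2)%:E <= (e * t)%:E)%E) ->
  2 / (p + 1) * potential_variation <= c * energy_variation i phi J s u.
Proof.
move=> hrem.
have K0 := field_bound_ge0 F.
have [C [t1 [C0 t10 hflow]]] := flow_energy F s_gt0 n_gt2s.
pose Q := p * M `^ (p - 1).
have Q0 : 0 <= Q by rewrite mulr_ge0 ?powR_ge0//; have := p_gt1; lra.
have c0 : 0 <= c by exact: frac_laplacian_const_ge0.
have cCE : 0 <= c * (C * energy s u u) by rewrite mulr_ge0// mulr_ge0// energy_ge0.
rewrite leNgt; apply/negP => hlt.
set X := c * energy_variation i phi J s u in hlt.
set Y := 2 / (p + 1) * potential_variation in hlt.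
pose B := c * (C * energy s u u) + 4 * Q + 1.
have B0 : 0 < B by rewrite /B; lra.
pose e := (Y - X) / (2 * B).
have e0 : 0 < e by rewrite divr_gt0 ?mulr_gt0//; lra.
have eB : e * B = (Y - X) / 2 by rewrite /e; field; lra.
have K1 : 0 < 2 * K + 1 by lra.
(* The three bounds on t come from [flow_energy], from the error term t^2 in
   [variation_contradiction], and from [flow_diffeo]. *)
have [|t [/andP[t0 tt] ht]] := hrem e (Num.min (Num.min t1 e) (2 * K + 1)^-1) e0.
  by rewrite !lt_min t10 e0 invr_gt0.
move: tt; rewrite !le_min => /andP[/andP[tt1 te] tK].
have t2K : t * (2 * K) <= 1.
  have : t * (2 * K + 1) <= 1 by rewrite -ler_pdivlMr// mul1r.
  by lra.
have [Psi D] := flow_diffeo F t0 t2K.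
have [hPsi EPsi] := hflow t Psi u (introT andP (conj t0 tt1)) D hu.
have [iPsi PPsi] := flow_potential D.
have et0 : 0 <= e * t by rewrite mulr_ge0 ?ltW.
have hN := flow_remainder et0 D ht.
have := energy_comparison p_gt1 weak_u u_bounds hPsi _ iPsi hN.
have Psi_up x : upper x -> upper (Psi x).
  by move=> xu; apply/(diffeo_upper D); rewrite (diffeo_invK D).
move=> /(_ (fun x xu => u_bounds (Psi_up x xu))).
rewrite PPsi -/Q.
have : 0 <= c * energy s (fun x => (u \o Psi) x - u x) (fun x => (u \o Psi) x - u x).
  by rewrite mulr_ge0 ?energy_ge0.
move=> h1 h2; have {h1 h2} h := le_trans h1 h2.
have := variation_contradiction c0 t0 te Q0 cCE EPsi h.
rewrite -/B -/X -/Y mulrC => /(_ eB).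
by rewrite leNgt hlt.
Qed.

End field_inequality.

(** * From translations to shears *)

Lemma measurable_indic_comp d d' (T : measurableType d) (T' : measurableType d')
    (R : realType) (A : set T') (f : T -> T') :
  measurable A -> measurable_fun setT f ->
  measurable_fun setT (fun x => (\1_A (f x) : R)%:E).
Proof.
move=> mA mf; apply/measurable_EFinP.
have h : measurable_fun setT (\1_A : T' -> R) by exact: measurable_indic.
exact: measurableT_comp h mf.
Qed.

Section averaging.
Variables (R : realType) (m : nat) (i : 'I_m.+1) (u : 'rV[R]_m.+1 -> R).
Local Notation L := (lebesgue_rV R m.+1).
Local Notation mu := (@lebesgue_measure R).
Local Notation rV := 'rV[R]_m.+1.
Local Notation upper := (@upper_half R m).
Hypothesis mu_ : measurable_fun setT u.

Let D (x : rV) (z : R) : \bar R := ((shift_diff i z u x) ^+ 2)%:E.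

Let D0 x z : (0 <= D x z)%E. Proof. by rewrite lee_fin sqr_ge0. Qed.

Let mD : measurable_fun [set: rV * measurableTypeR R] (fun w => D w.1 w.2).
Proof.
apply/measurable_EFinP; apply: measurable_funX; apply: measurable_funB.
  apply: measurableT_comp mu_ _; apply: measurable_upd; first exact: measurable_fst.
  apply: measurable_funD; last exact: measurable_snd.
  by apply: measurableT_comp (measurable_coord i) _; exact: measurable_fst.
by apply: measurableT_comp mu_ _; exact: measurable_fst.
Qed.

Let mDx x : measurable_fun [set: measurableTypeR R] (D x).
Proof. exact: (measurableT_comp mD (measurable_pair1 x)). Qed.

(** The average is not normalized by the length b - a. *)
Definition avg_diff (a b : R) (x : rV) : \bar R := (\int[mu]_(z in `]a, b]) D x z)%E.

Lemma avg_diff_ge0 a b x : (0 <= avg_diff a b x)%E.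
Proof. by apply: integral_ge0 => z _; exact: D0. Qed.

Let measurable_oc a b : measurable (`]a, b]%classic : set (measurableTypeR R)).
Proof. exact: measurable_itv. Qed.

Let DI a b := fun w : rV * measurableTypeR R => (D w.1 w.2 * (\1_(`]a, b]%classic) w.2)%:E)%E.

Let mDI a b : measurable_fun setT (DI a b).
Proof.
apply: emeasurable_funM => //.
exact: (measurable_indic_comp (measurable_oc a b) measurable_snd).
Qed.

Let DI0 a b w : (0 <= DI a b w)%E.
Proof. by rewrite mule_ge0 ?D0// lee_fin. Qed.

Let avg_diffE a b x : avg_diff a b x = (\int[mu]_z DI a b (x, z))%E.
Proof.
rewrite /avg_diff integral_mkcond; apply: eq_integral => z _.
by rewrite patchE /DI /= indicE; case: ifP; rewrite ?mule1 ?mule0.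
Qed.

Lemma measurable_avg_diff a b : measurable_fun setT (avg_diff a b).
Proof.
rewrite (funext (avg_diffE a b)).
rewrite -[X in measurable_fun _ X]/(fubini_F mu (DI a b)).
have := @measurable_fun_fubini_tonelli_F _ _ _ _ R mu (DI a b) (mDI a b) (DI0 a b).
exact.
Qed.

Lemma integral_avg_diff a b B : a <= b ->
  (forall z, a < z <= b -> (shift_norm2 i z u <= B%:E)%E) ->
  (\int[L]_(x in upper) avg_diff a b x <= ((b - a) * B)%:E)%E.
Proof.
move=> ab hB.
pose f := fun w : rV * measurableTypeR R => (DI a b w * (\1_upper w.1)%:E)%E.
have mf : measurable_fun setT f.
  apply: emeasurable_funM; first exact: mDI.
  have := @measurable_indic_comp _ _ (rV * measurableTypeR R)%type rV R upper fst
    (@measurable_upper R m) measurable_fst.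
  exact.
have f0 w : (0 <= f w)%E by rewrite mule_ge0 ?DI0// lee_fin.
have -> : (\int[L]_(x in upper) avg_diff a b x = \int[L]_x \int[mu]_z f (x, z))%E.
  rewrite integral_mkcond; apply: eq_integral => x _; rewrite patchE /f /= indicE.
  case: ifP => _ /=; first by rewrite avg_diffE; apply: eq_integral => z _; rewrite mule1.
  by rewrite integral0_eq// => z _; rewrite mule0.
rewrite (@fubini_tonelli _ _ _ _ R L mu f mf f0).
have -> : (\int[mu]_z \int[L]_x f (x, z) = \int[mu]_(z in `]a, b]) shift_norm2 i z u)%E.
  rewrite [RHS]integral_mkcond; apply: eq_integral => z _; rewrite patchE /f /DI /= indicE.
  case: ifP => _ /=; last by rewrite integral0_eq// => x _; rewrite mule0 mul0e.
  rewrite /shift_norm2 [RHS]integral_mkcond; apply: eq_integral => x _.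
  by rewrite patchE indicE mule1 /D; case: ifP => _; rewrite ?mule1 ?mule0.
have lab : mu `]a, b]%classic = (b - a)%:E.
  rewrite lebesgue_measure_itv/= lte_fin; case: ltgtP ab => // -> _.
  by rewrite subrr.
apply: (@le_trans _ _ (\int[mu]_(z in `]a, b]) (cst B%:E) z)%E); last first.
  by rewrite integral_cst//= lab -EFinM mulrC.
apply: ge0_le_integral => //.
- by move=> z _; exact: shift_norm2_ge0.
- apply: measurable_funTS.
  have mg : measurable_fun [set: rV * measurableTypeR R]
      (fun w => D w.1 w.2 * (\1_upper w.1)%:E)%E.
    apply: emeasurable_funM => //.
    have := @measurable_indic_comp _ _ (rV * measurableTypeR R)%type rV R upper fst
    (@measurable_upper R m) measurable_fst.
    exact.
  have g0 (w : rV * measurableTypeR R) : (0 <= D w.1 w.2 * (\1_upper w.1)%:E)%E.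
    by rewrite mule_ge0 ?D0// lee_fin.
  have := @measurable_fun_fubini_tonelli_G _ _ _ _ R L _ mg g0.
  apply: eq_measurable_fun => z _; rewrite /fubini_G /shift_norm2 [RHS]integral_mkcond.
  apply: eq_integral => x _.
  by rewrite patchE indicE /D /=; case: ifP => _; rewrite ?mule1 ?mule0.
Qed.

Lemma integral_translation (f : R -> \bar R) (h : R) : measurable_fun setT f ->
  (forall z, 0 <= f z)%E -> (\int[mu]_z f (z - h)%R = \int[mu]_z f z)%E.
Proof.
move=> mf f0.
rewrite -[RHS](@ge0_integral_substitution R (fun z => z - h) (fun z => z + h) (cst 1))//.
- by apply: eq_integral => z _; rewrite mule1.
- by move=> z; rewrite subrK.
- by move=> z; rewrite addrK.
- by move=> a b ab; rewrite lerD2r.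
- move=> a b ab; have lab : mu `]a, b]%classic = (b - a)%:E.
    rewrite lebesgue_measure_itv/= lte_fin; case: ltgtP ab => // -> _.
    by rewrite subrr.
  by rewrite /= integral_cst//= lab mul1e; congr EFin; ring.
Qed.

Variables (h j : rV -> R) (Psi : rV -> rV) (r B : R).
Hypotheses (diff : half_space_diffeo (shear i h) Psi j).
Hypotheses (r_gt0 : 0 < r) (h_bound : forall x, `|h x| <= r).
Hypothesis shift_bound : forall z, 0 < z <= 3 * r -> (shift_norm2 i z u <= B%:E)%E.

(* u(x + h(x) e_i) and u(x) are compared through u(x + z e_i), averaged over z in
   ]r, 2r]: both differences are then translation increments with positive step. *)
Let pointwise x :
  (r%:E * ((u (shear i h x) - u x) ^+ 2)%:E <=
   2%:E * avg_diff r (2 * r) x + 2%:E * avg_diff 0 (3 * r) (shear i h x))%E.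
Proof.
have r0 := r_gt0.
have lab : mu `]r, 2 * r]%classic = r%:E.
  rewrite lebesgue_measure_itv/= lte_fin ifT; last lra.
  by rewrite -EFinD; congr EFin; ring.
have -> : (r%:E * ((u (shear i h x) - u x) ^+ 2)%:E =
    \int[mu]_(z in `]r, (2 * r)%R]) (cst ((u (shear i h x) - u x) ^+ 2)%:E) z)%E.
  by rewrite integral_cst//= lab muleC.
have mDh : measurable_fun [set: measurableTypeR R] (fun z => D (shear i h x) (z - h x)).
  apply: (measurableT_comp (mDx (shear i h x))).
  by apply: measurable_funB => //; exact: measurable_cst.
apply: (@le_trans _ _ (\int[mu]_(z in `]r, (2 * r)%R])
   (2%:E * D x z + 2%:E * D (shear i h x) (z - h x)))%E).
  apply: ge0_le_integral => //.
  - by move=> z _; rewrite lee_fin sqr_ge0.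
  - apply: measurable_funTS; apply: emeasurable_funD; apply: emeasurable_funM => //.
  move=> z _; rewrite /D -!EFinM -EFinD lee_fin /shift_diff.
  have -> : shift i (z - h x) (shear i h x) = shift i z x.
    by rewrite -[shear i h x]/(shift i (h x) x) shiftD addrC subrK.
  have := sqr_ge0 ((u (shift i z x) - u x) + (u (shift i z x) - u (shear i h x))).
  by lra.
have ge0D y z : (0 <= 2%:E * D y z)%E by rewrite mule_ge0.
rewrite ge0_integralD//; last 2 first.
- by apply: measurable_funTS; apply: emeasurable_funM => //; exact: mDx.
- by apply: measurable_funTS; apply: emeasurable_funM.
rewrite ge0_integralZl//; last by apply: measurable_funTS; exact: mDx.
rewrite ge0_integralZl//; last exact: measurable_funTS.
apply: leeD2l; rewrite lee_wpmul2l//.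
have mfI : measurable_fun [set: measurableTypeR R] (fun z => DI 0 (3 * r) (shear i h x, z)).
  exact: (measurableT_comp (mDI 0 (3 * r)) (measurable_pair1 _)).
(* Since z is in ]r, 2r] and |h(x)| <= r, the step z - h(x) lies in ]0, 3r]; after translating the
   variable, the integral is enlarged to that interval. *)
rewrite avg_diffE -(integral_translation (h x) mfI); last by move=> z; exact: DI0.
rewrite integral_mkcond; apply: ge0_le_integral => //.
- by move=> z _; rewrite patchE; case: ifP.
- exact: measurable_erestrict.
- apply: (measurableT_comp mfI).
  by apply: measurable_funB => //; exact: measurable_cst.
move=> z _; rewrite patchE; case: ifPn => [|_]; last exact: DI0.
rewrite inE /= in_itv/= => /andP[z1 z2]; rewrite /DI /= indicE mem_set ?mule1//.
have := h_bound x; rewrite ler_norml => /andP[h1 h2].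
by rewrite /= in_itv/=; apply/andP; split; lra.
Qed.

(** Integrate [pointwise]. The first average contributes r B; the second contributes 3 r B, doubled
    because the Jacobian is at least 1/2. With the two factors 2 the total is 14 r B, to be divided
    by r. *)
Lemma shear_norm2_le :
  (\int[L]_(x in upper) ((u (shear i h x) - u x) ^+ 2)%:E <= (14 * B)%:E)%E.
Proof.
have r0 := r_gt0.
have mup := @measurable_upper R m.
have mPhi := diffeo_measurable diff.
have mA a b := measurable_avg_diff a b.
have mG : measurable_fun setT (fun x => ((u (shear i h x) - u x) ^+ 2)%:E).
  apply/measurable_EFinP; apply: measurable_funX; apply: measurable_funB => //.
  exact: measurableT_comp mu_ mPhi.
have mAP a b : measurable_fun setT (fun x => avg_diff a b (shear i h x)).
  exact: measurableT_comp (mA a b) mPhi.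
have e1 : (\int[L]_(x in upper) avg_diff r (2 * r) x <= (r * B)%:E)%E.
  have := @integral_avg_diff r (2 * r) B.
  rewrite (_ : 2 * r - r = r); last by ring.
  apply; first lra.
  by move=> z /andP[z1 z2]; apply: shift_bound; apply/andP; split; lra.
have e2 : (\int[L]_(x in upper) avg_diff 0 (3 * r) (shear i h x) <= (6 * r * B)%:E)%E.
  apply: (@le_trans _ _ (\int[L]_(x in upper)
      (2%:E * (avg_diff 0 (3 * r) (shear i h x) * (j x)%:E)))%E).
    apply: ge0_le_integral => //.
    - by move=> x _; exact: avg_diff_ge0.
    - exact: measurable_funTS.
    - apply: measurable_funTS; apply: emeasurable_funM => //.
      apply: emeasurable_funM => //.
      by apply/measurable_EFinP; exact: diffeo_jac_measurable diff.
    move=> x _; rewrite muleCA -[leLHS]mule1 lee_wpmul2l ?avg_diff_ge0//.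
    have /andP[j1 _] := diffeo_jac_bounds diff x.
    by rewrite -EFinM lee_fin; lra.
  rewrite ge0_integralZl//; last 2 first.
  - apply: measurable_funTS; apply: emeasurable_funM => //.
    by apply/measurable_EFinP; exact: diffeo_jac_measurable diff.
  - by move=> x _; rewrite mule_ge0 ?avg_diff_ge0// lee_fin (diffeo_jac_ge0 diff).
  rewrite -(diffeo_integral_upper diff (f := fun x => avg_diff 0 (3 * r) (shear i h x)))//;
    last by move=> x _; exact: avg_diff_ge0.
  under eq_integral do rewrite (diffeo_invK diff).
  have := @integral_avg_diff 0 (3 * r) B; rewrite subr0 => h0.
  rewrite (_ : 6 * r * B = 2 * (3 * r * B)); last by ring.
  by rewrite EFinM lee_wpmul2l// h0//; lra.
have : (r%:E * \int[L]_(x in upper) ((u (shear i h x) - u x) ^+ 2)%:E <=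
    (r * (14 * B))%:E)%E.
  rewrite -ge0_integralZl//; last 3 first.
  - exact: measurable_funTS.
  - by move=> x _; rewrite lee_fin sqr_ge0.
  - by rewrite lee_fin ltW.
  apply: (@le_trans _ _ (\int[L]_(x in upper)
     (2%:E * avg_diff r (2 * r) x + 2%:E * avg_diff 0 (3 * r) (shear i h x)))%E).
    apply: ge0_le_integral => //.
    - by move=> x _; rewrite mule_ge0// lee_fin ?sqr_ge0// ltW.
    - by apply: measurable_funTS; apply: emeasurable_funM.
    - by apply: measurable_funTS; apply: emeasurable_funD; apply: emeasurable_funM.
  rewrite ge0_integralD//; last 4 first.
  - by move=> x _; rewrite mule_ge0// avg_diff_ge0.
  - by apply: measurable_funTS; apply: emeasurable_funM.
  - by move=> x _; rewrite mule_ge0// avg_diff_ge0.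
  - by apply: measurable_funTS; apply: emeasurable_funM.
  rewrite ge0_integralZl//; [|exact: measurable_funTS|by move=> x _; exact: avg_diff_ge0].
  rewrite ge0_integralZl//; [|exact: measurable_funTS|by move=> x _; exact: avg_diff_ge0].
  rewrite (_ : r * (14 * B) = 2 * (r * B) + 2 * (6 * r * B)); last by ring.
  by rewrite [leRHS]EFinD leeD// EFinM lee_wpmul2l.
by rewrite EFinM lee_pmul2l// lte_fin.
Qed.

End averaging.

(** * Profiles with kinks and product fields *)

Section primitive.
Variable R : realType.
Local Notation mu := (@lebesgue_measure R).

(** f is a Lipschitz function with weak derivative j. The integrated form tolerates kinks and is
    stable under linear combinations. *)
Record primitive (f j : R -> R) : Prop := Primitive {
  primitive_measurable : measurable_fun [set: measurableTypeR R] (j : measurableTypeR R -> R);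
  primitive_bounded : exists B, forall x, `|j x| <= B;
  primitiveE : forall a b, a <= b ->
    (\int[mu]_(x in `]a, b]) (j x)%:E = (f b - f a)%:E)%E }.

Let measurable_oc a b : measurable (`]a, b]%classic : set (measurableTypeR R)).
Proof. exact: measurable_itv. Qed.

Lemma lebesgue_measure_oc (a b : R) : a <= b -> mu `]a, b]%classic = (b - a)%:E.
Proof.
move=> ab; rewrite lebesgue_measure_itv/= lte_fin; case: ltgtP ab => // -> _.
by rewrite subrr.
Qed.

Lemma integrable_bounded_oc (j : R -> R) a b :
  measurable_fun [set: measurableTypeR R] (j : measurableTypeR R -> R) ->
  (exists B, forall x, `|j x| <= B) -> a <= b ->
  mu.-integrable `]a, b] (EFin \o j).
Proof.
move=> mj [B jB] ab.
have i1 : mu.-integrable `]a, b] (EFin \o cst (1%R : R)).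
  apply/integrableP; split; first exact/measurable_EFinP/measurable_cst.
  rewrite (eq_integral (cst 1%:E)); last by move=> r _; rewrite /= normr1.
  by rewrite integral_cst//= lebesgue_measure_oc// mul1e ltry.
have := @integrable_mul_bounded _ _ _ mu _ (cst 1) j B (measurable_oc a b) i1
  (measurable_funTS mj) (fun x _ => jB x).
by apply: eq_integrable => // x _; rewrite /= mul1r.
Qed.

Lemma primitiveD f1 j1 f2 j2 : primitive f1 j1 -> primitive f2 j2 ->
  primitive (fun x => f1 x + f2 x) (fun x => j1 x + j2 x).
Proof.
move=> [m1 b1 e1] [m2 b2 e2]; split.
- exact: measurable_funD.
- have [B1 h1] := b1; have [B2 h2] := b2; exists (B1 + B2) => x.
  by apply: le_trans (ler_normD _ _) _; exact: lerD.
- move=> a b ab.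
  have i1 := integrable_bounded_oc m1 b1 ab; have i2 := integrable_bounded_oc m2 b2 ab.
  apply: (etrans (integralD (measurable_oc a b) i1 i2)).
  have -> : (\int[mu]_(x in `]a, b]) (EFin \o j1) x = (f1 b - f1 a)%:E)%E by exact: e1.
  have -> : (\int[mu]_(x in `]a, b]) (EFin \o j2) x = (f2 b - f2 a)%:E)%E by exact: e2.
  by rewrite -EFinD; congr EFin; ring.
Qed.

Lemma primitiveZ k f j : primitive f j ->
  primitive (fun x => k * f x) (fun x => k * j x).
Proof.
move=> [mj b e]; split.
- by apply: measurable_funM => //; exact: measurable_cst.
- have [B h] := b; exists (`|k| * B) => x; by rewrite normrM ler_wpM2l.
- move=> a c ac.
  have ij := integrable_bounded_oc mj b ac.
  apply: (etrans (integralZl (measurable_oc a c) ij k)).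
  have -> : (\int[mu]_(x in `]a, c]) (EFin \o j) x = (f c - f a)%:E)%E by exact: e.
  by rewrite -EFinM; congr EFin; ring.
Qed.

Lemma primitive_cst k : primitive (cst k) (cst 0).
Proof.
split.
- exact: measurable_cst.
- by exists 0 => x; rewrite normr0.
- by move=> a b ab; rewrite subrr integral0.
Qed.

Definition ramp (c x : R) : R := Num.max 0 (x - c).
Definition step (c x : R) : R := ((c < x)%R : nat)%:R.

Lemma primitive_ramp c : primitive (ramp c) (step c).
Proof.
have stepE x : step c x = \1_(`]c, +oo[%classic : set (measurableTypeR R)) x.
  rewrite indicE /step; congr (_%:R).
  by case: (ltP c x) => cx; [rewrite mem_set//|rewrite memNset//];
    rewrite /= in_itv/= andbT ?cx//; apply/negP; rewrite -leNgt.
split.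
- by rewrite (funext stepE); apply: measurable_indic; exact: measurable_itv.
- by exists 1 => x; rewrite /step; case: ltP => _; rewrite ?normr0 ?normr1.
- move=> a b ab.
  under eq_integral do rewrite stepE.
  rewrite integral_indic; [|exact: measurable_oc|exact: measurable_itv].
  rewrite (_ : _ `&` _ = `](Num.max a c), b]%classic); last first.
    apply/seteqP; split => x /=; rewrite !in_itv/= andbT gt_max.
      by move=> [-> /andP[-> ->]].
    by move=> /andP[/andP[-> ->] ->].
  have -> : (ramp c b - ramp c a)%:E =
      if Num.max a c < b then (b - Num.max a c)%:E else 0%E.
    rewrite /ramp; case: (leP a c) => ac; rewrite ?(max_idPr (ltW ac))//;
      rewrite /Num.max; case: ltP => h1; case: ltP => h2; case: ltP => h3;
      congr EFin; lra.
  exact: (lebesgue_measure_itv `](Num.max a c), b]).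
Qed.

Lemma primitive_lipschitz f j K : primitive f j -> (forall x, `|j x| <= K) ->
  forall a b, `|f a - f b| <= K * `|a - b|.
Proof.
move=> [mj _ e] jK.
suff h a b : a <= b -> `|f b - f a| <= K * (b - a).
  move=> a b; have [ab|/ltW ba] := leP a b.
    by rewrite distrC [`|a - b|]distrC (ger0_norm (_ : 0 <= b - a)) ?subr_ge0// h.
  by rewrite (ger0_norm (_ : 0 <= a - b)) ?subr_ge0// h.
move=> ab; rewrite -lee_fin -abse_EFin -e//.
apply: le_trans (le_abse_integral mu (measurable_oc a b) _) _.
  by apply/measurable_EFinP; exact: measurable_funTS.
apply: (@le_trans _ _ (\int[mu]_(x in `]a, b]) (cst K%:E) x)%E); last first.
  by rewrite integral_cst//= lebesgue_measure_oc// -EFinM.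
apply: ge0_le_integral => //.
- apply: measurableT_comp => //; apply/measurable_EFinP; exact: measurable_funTS.
- by move=> x _; rewrite /= lee_fin.
Qed.

End primitive.

Section product_field.
Variables (R : realType) (m : nat) (i : 'I_m.+1).
Variables (beta beta' : R -> R) (b : 'rV[R]_m.+1 -> R) (A : R).
Local Notation L := (lebesgue_rV R m.+1).
Local Notation mu := (@lebesgue_measure R).
Local Notation rV := 'rV[R]_m.+1.
Local Notation upper := (@upper_half R m).

Hypotheses (beta_primitive : primitive beta beta')
  (beta_bound : forall x, `|beta x| <= A) (beta'_bound : forall x, `|beta' x| <= 1)
  (b_measurable : measurable_fun setT b) (b_bounds : forall x, 0 <= b x <= 1)
  (b_upd : forall x r, b (upd i x r) = b x)
  (b_lipschitz : forall x y, A * `|b x - b y| <= m.+1%:R * Num.sqrt (sqn (x - y))).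

Definition product_field (x : rV) : R := beta (x ord0 i) * b x.
Definition product_field' (x : rV) : R := beta' (x ord0 i) * b x.

Lemma coord_le_sqrt_sqn (x : rV) k : `|x ord0 k| <= Num.sqrt (sqn x).
Proof. by rewrite -sqrtr_sqr ler_wsqrtr// sqr_coord_le_sqn. Qed.

Lemma measurable_primitive : measurable_fun [set: R] beta.
Proof.
suff : continuous beta by move=> /continuous_measurable_fun.
move=> x; apply/cvgrPdist_le => e e0; exists e => //= y /ltW xy.
by have := primitive_lipschitz beta_primitive beta'_bound x y; lra.
Qed.

(** As [b] is constant along e_i, only [beta] is differentiated. The hypothesis [b_lipschitz] lets
    the slope of [b], of order 1/A, compensate |beta| <= A; so the constant n + 1 is independent of
    A, as dominated convergence will require when A grows. *)
Lemma product_field_admissible :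
  (forall t x, 0 < t -> upper (flow i product_field t x) <-> upper x) ->
  (forall t x, 0 < t -> lower_half (flow i product_field t x) <-> lower_half x) ->
  admissible_field i product_field product_field' m.+2%:R.
Proof.
move=> hup hlow; split => //.
- apply: measurable_funM => //.
  exact: measurableT_comp measurable_primitive (measurable_coord i).
- apply: measurable_funM => //.
  exact: measurableT_comp (primitive_measurable beta_primitive) (measurable_coord i).
- move=> x; have /andP[b0 b1] := b_bounds x.
  rewrite normrM (ger0_norm b0); apply: (@le_trans _ _ (1 * 1)); first exact: ler_pM.
  by rewrite mulr1 ler1n.
- move=> x y; have q0 := sqn_ge0 (x - y).
  rewrite -[in leRHS](sqr_sqrtr q0) -exprMn -[leLHS]real_normK ?num_real//.
  rewrite ler_sqr ?nnegrE ?mulr_ge0 ?sqrtr_ge0//.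
  have -> : product_field x - product_field y =
      (beta (x ord0 i) - beta (y ord0 i)) * b x + beta (y ord0 i) * (b x - b y).
    by rewrite /product_field; ring.
  apply: le_trans (ler_normD _ _) _; rewrite !normrM.
  have /andP[b0 b1] := b_bounds x.
  have h1 : `|beta (x ord0 i) - beta (y ord0 i)| * `|b x| <= Num.sqrt (sqn (x - y)).
    apply: (@le_trans _ _ (`|x ord0 i - y ord0 i| * 1)).
      apply: ler_pM => //; last by rewrite ger0_norm.
      by have := primitive_lipschitz beta_primitive beta'_bound (x ord0 i) (y ord0 i); lra.
    by rewrite mulr1; have := coord_le_sqrt_sqn (x - y) i; rewrite !mxE.
  have h2 : `|beta (y ord0 i)| * `|b x - b y| <= m.+1%:R * Num.sqrt (sqn (x - y)).
    by apply: le_trans (b_lipschitz x y); rewrite ler_wpM2r.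
  rewrite -[m.+2]addn1 natrD mulrDl mul1r; lra.
- move=> x r r' rr; rewrite /product_field /product_field'.
  under eq_integral do rewrite upd_same b_upd mulrC.
  rewrite !upd_same !b_upd.
  have := primitiveE (primitiveZ (b x) beta_primitive) rr => ->.
  by congr EFin; ring.
Qed.

End product_field.

(** * Continuously differentiable functions on the half-space *)

Lemma mean_value_le (R : realType) (f df : R -> R) (a b B : R) : a <= b ->
  (forall r, a <= r <= b -> is_derive r 1 f (df r) /\ `|df r| <= B) ->
  `|f b - f a| <= B * (b - a).
Proof.
move=> ab h.
have d r : r \in `[a, b]%R -> is_derive r 1 f (df r) by rewrite in_itv/= => /h[].
have mvt := @MVT_segment R f df a b ab.
have c : {within `[a, b], continuous f}.
  by apply: derivable_within_continuous => r /d [].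
have [z zab e] := mvt (fun r rab => d r (subset_itv_oo_cc rab)) c.
rewrite e normrM (ger0_norm (_ : 0 <= b - a)) ?subr_ge0//.
rewrite ler_wpM2r ?subr_ge0//.
by move: zab; rewrite in_itv/= => /h[].
Qed.

Section continuously_differentiable.
Variables (R : realType) (m : nat) (u : 'rV[R]_m.+1 -> R).
Local Notation L := (lebesgue_rV R m.+1).
Local Notation rV := 'rV[R]_m.+1.
Local Notation upper := (@upper_half R m).
Hypothesis u_C1 : continuously_differentiable_on upper u.

Lemma is_derive_upd i x r : derivable u (upd i x r) (delta_mx ord0 i) ->
  is_derive r 1 (fun t => u (upd i x t)) (grad u (upd i x r) ord0 i).
Proof.
have E : (fun h : R => h^-1 *: (u (upd i x (h *: 1 + r)) - u (upd i x r))) =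
         (fun h : R => h^-1 *: (u (h *: delta_mx ord0 i + upd i x r) - u (upd i x r))).
  apply/funext => h; congr (_ *: (u _ - _)); apply/rowP => k.
  have dk : (delta_mx ord0 i : 'rV[R]_m.+1) 0 k = (k == i)%:R by rewrite mxE eqxx.
  rewrite 2![in RHS]mxE dk; have [->|ki] := eqVneq k i.
    by rewrite !upd_same [h%:A]mulr1 mulr1.
  by rewrite mulr0 add0r !upd_neq.
move=> dr; split; first by rewrite /derivable /= E.
by rewrite mxE /derive /= E.
Qed.

Lemma partial_lipschitz i x a b B : a <= b ->
  (forall r, a <= r <= b ->
    upper (upd i x r) /\ `|grad u (upd i x r) ord0 i| <= B) ->
  `|u (upd i x b) - u (upd i x a)| <= B * (b - a).
Proof.
move=> ab h; apply: (@mean_value_le R (fun t => u (upd i x t))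
  (fun r => grad u (upd i x r) ord0 i) a b B ab) => r /h[xu hB]; split => //.
by apply: is_derive_upd; have [] := u_C1 xu i.
Qed.

Lemma grad_bounded_on_compact (K : set rV) : compact K -> K `<=` upper ->
  exists2 B : R, 0 <= B & forall x i, K x -> `|grad u x ord0 i| <= B.
Proof.
move=> cK Ku.
have bi i : exists B, 0 <= B /\ forall x, K x -> `|grad u x ord0 i| <= B.
  have : compact ((fun x => grad u x ord0 i) @` K).
    apply: continuous_compact => //; apply: continuous_in_subspaceT => x.
    by rewrite inE => /Ku xu; have [] := u_C1 xu i.
  move=> /compact_bounded[B0 [_ hB]].
  exists (`|B0| + 1); split; first by rewrite addr_ge0.
  move=> x Kx; apply: (hB (`|B0| + 1)); last by exists x.
  by have := ler_norm B0; lra.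
have [B hB] := choice bi; exists (\sum_i B i).
  by apply: sumr_ge0 => i _; have [] := hB i.
move=> x i Kx; have [_ /(_ x Kx) h] := hB i; apply: le_trans h _.
rewrite (bigD1 i)//= lerDl; apply: sumr_ge0 => k _; by have [] := hB k.
Qed.

(** Go from x to y one coordinate at a time, inside a compact box on which all partial derivatives
    are bounded; each move is controlled by the mean value theorem. *)
Lemma continuous_upper x : upper x -> {for x, continuous u}.
Proof.
move=> xu.
have xn0 : 0 < x ord0 ord_max by exact: xu.
pose d := x ord0 ord_max / 2.
have d0 : 0 < d by rewrite /d; lra.
pose K : set rV := [set v | forall i, `[x ord0 i - d, x ord0 i + d]%classic (v ord0 i)].
have cK : compact K.
  by apply: (rV_compact (A := fun i => `[x ord0 i - d, x ord0 i + d]%classic)) => i;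
    exact: segment_compact.
have KP (v : rV) : (forall i, `|v ord0 i - x ord0 i| <= d) -> K v.
  by move=> h i; have := h i; rewrite ler_distl /= in_itv/=.
have Ku : K `<=` upper.
  move=> v /(_ ord_max); rewrite /= in_itv/= /upper_half /= /d => /andP[h _]; lra.
have [B B0 hB] := grad_bounded_on_compact cK Ku.
(* The interpolating points: the first k coordinates come from y, the others from x. *)
pose z (y : rV) k : rV := \row_(i < m.+1) if (i < k)%N then y ord0 i else x ord0 i.
have step (y : rV) (k : 'I_m.+1) : (forall i, `|y ord0 i - x ord0 i| <= d) ->
    `|u (z y k.+1) - u (z y k)| <= B * `|y ord0 k - x ord0 k|.
  move=> hy.
  have -> : z y k.+1 = upd k (z y k) (y ord0 k).
    apply/rowP => i; rewrite !mxE; case: eqP => [->|/eqP ik]; first by rewrite ltnSn.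
    by rewrite ltnS leq_eqVlt (negPf (ik : (i != k :> nat))).
  have -> : z y k = upd k (z y k) (x ord0 k).
    by apply/rowP => i; rewrite !mxE; case: eqP => [->|//]; rewrite ltnn.
  rewrite updK.
  have inK r : `|r - x ord0 k| <= d -> K (upd k (z y k) r).
    move=> hr; apply: KP => i; rewrite !mxE; case: eqP => [->//|_].
    by case: ifP => _; rewrite ?subrr ?normr0 ?(ltW d0).
  have hk := hy k.
  have [xy|/ltW yx] := leP (x ord0 k) (y ord0 k).
    rewrite (ger0_norm (_ : 0 <= y ord0 k - x ord0 k)) ?subr_ge0//.
    apply: partial_lipschitz => // r /andP[r1 r2].
    have Kr : K (upd k (z y k) r).
      by apply: inK; move: hk; rewrite !ger0_norm; lra.
    by split; [exact: Ku|exact: hB].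
  rewrite distrC [X in B * X]distrC.
  rewrite (ger0_norm (_ : 0 <= x ord0 k - y ord0 k)) ?subr_ge0//.
  apply: partial_lipschitz => // r /andP[r1 r2].
  have Kr : K (upd k (z y k) r).
    by apply: inK; move: hk; rewrite !ler0_norm; lra.
  by split; [exact: Ku|exact: hB].
have lip (y : rV) : (forall i, `|y ord0 i - x ord0 i| <= d) ->
    `|u y - u x| <= \sum_(k < m.+1) B * `|y ord0 k - x ord0 k|.
  move=> hy.
  have -> : u y - u x = \sum_(k < m.+1) (u (z y k.+1) - u (z y k)).
    rewrite -(big_mkord xpredT (fun k => u (z y k.+1) - u (z y k))) telescope_sumr//.
    by congr (u _ - u _); apply/rowP => i; rewrite !mxE ?ltn_ord.
  by apply: le_trans (ler_norm_sum _ _ _) _; apply: ler_sum => k _; exact: step.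
move=> W /nbhs_ballP[e /= e0 We].
have B1 : 0 < m.+1%:R * B + 1 by have := mulr_ge0 (ler0n R m.+1) B0; lra.
pose e' := Num.min d (e / (m.+1%:R * B + 1)).
have e'0 : 0 < e' by rewrite lt_min d0 divr_gt0.
apply/nbhs_ballP; exists e' => //= y [_ xy]; apply: We.
have hy i : `|y ord0 i - x ord0 i| <= e'.
  by have := xy ord0 i; rewrite /ball /= distrC => /ltW.
rewrite /ball /= distrC; apply: le_lt_trans (lip y _) _.
  by move=> i; apply: le_trans (hy i) _; rewrite /e' ge_min lexx.
apply: (@le_lt_trans _ _ (\sum_(k < m.+1) B * (e / (m.+1%:R * B + 1)))).
  apply: ler_sum => k _; rewrite ler_wpM2l//; apply: le_trans (hy k) _.
  by rewrite /e' ge_min lexx orbT.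
rewrite sumr_const card_ord -[ltLHS]mulr_natl !mulrA ltr_pdivrMr// mulrC ltr_pM2l//.
lra.
Qed.

(** If u(x) were outside [D], continuity would keep u outside [D] on a whole box around x, and a box
    has positive measure. *)
Lemma ae_upper_closed (D : set R) : closed D ->
  {ae L, forall x, upper x -> D (u x)} -> forall x, upper x -> D (u x).
Proof.
move=> cD [N [mN N0 hN]] x xu; apply: contrapT => nD.
have : nbhs x (upper `&` (u @^-1` (~` D))).
  apply: filterI; last first.
    by apply: (continuous_upper xu); apply: open_nbhs_nbhs; split => //; exact: closed_openC.
  have xn0 : 0 < x ord0 ord_max by exact: xu.
  apply/nbhs_ballP; exists (x ord0 ord_max) => //= y [_ /(_ ord0 ord_max)].
  by rewrite /ball /= ltr_distlC => /andP[h _]; rewrite /upper_half /=; lra.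
move=> /nbhs_ballP[e /= e0 he].
have mB i : measurable (`]x ord0 i - e, x ord0 i + e[%classic : set (measurableTypeR R)).
  exact: measurable_itv.
have := lebesgue_rV_box mB.
set X := [set y : rV | _] => LX.
have XN : X `<=` N.
  move=> y hy; apply: hN => /=.
  have [] : (upper `&` (u @^-1` (~` D))) y.
    apply: he; split => // i j; have := hy j; rewrite (ord1 i) /= in_itv/= => /andP[h1 h2].
    by rewrite /ball /= ltr_distlC; apply/andP; split; lra.
  by move=> yu nDy /(_ yu).
have : (L X <= L N)%E by apply: le_measure; rewrite ?inE//; exact: (measurable_rV_box mB).
rewrite N0 LX (eq_bigr (fun=> (2 * e)%:E)); last first.
  move=> i _; rewrite lebesgue_measure_itv/= lte_fin ifT; last lra.
  by rewrite -EFinD; congr EFin; ring.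
rewrite leNgt => /negP; apply.
have -> : (\prod_(i < m.+1) (2 * e)%:E)%E = (\prod_(i < m.+1) (2 * e))%:E by rewrite -prodEFin.
by rewrite lte_fin; apply: prodr_gt0 => i _; lra.
Qed.

End continuously_differentiable.

(** * Truncated dilation fields *)

Section profiles.
Variable R : realType.
Implicit Types A x c : R.

Lemma ramp_stepP c x : c < x /\ (ramp c x, step c x) = (x - c, 1) \/
  x <= c /\ (ramp c x, step c x) = (0, 0).
Proof.
rewrite /ramp /step; case: (ltP c x) => cx; [left|right]; split => //.
  by rewrite (max_idPr _)// subr_ge0 ltW.
by rewrite (max_idPl _)// subr_le0.
Qed.

Lemma ramp_step_gt c x : c < x -> ramp c x = x - c /\ step c x = 1.
Proof. by case: (ramp_stepP c x) => -[h [-> ->]]//; rewrite ltNge h. Qed.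

Lemma ramp_step_le c x : x <= c -> ramp c x = 0 /\ step c x = 0.
Proof. by case: (ramp_stepP c x) => -[h [-> ->]]//; rewrite leNgt h. Qed.

(** The truncation of x to [-A, A], as a combination of ramps so that its derivative follows by
    linearity. *)
Definition clamp A x : R := - A + ramp (- A) x + (-1) * ramp A x.
Definition clamp' A x : R := 0 + step (- A) x + (-1) * step A x.

Lemma primitive_clamp A : primitive (clamp A) (clamp' A).
Proof.
exact: primitiveD (primitiveD (primitive_cst (- A)) (primitive_ramp (- A)))
  (primitiveZ (-1) (primitive_ramp A)).
Qed.

Ltac ramps := repeat match goal with |- context [ramp ?c ?x] =>
  let h := fresh in let e := fresh in
  case: (ramp_stepP c x) => -[h [-> e]]; rewrite ?e {e} end.

Lemma clamp_bound A x : 0 <= A -> `|clamp A x| <= A.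
Proof. by move=> A0; rewrite ler_norml /clamp; ramps; apply/andP; split; lra. Qed.

Lemma clamp'_bound A x : 0 <= A -> `|clamp' A x| <= 1.
Proof.
move=> A0; rewrite ler_norml /clamp'.
case: (ramp_stepP (- A) x) => -[h [_ ->]]; case: (ramp_stepP A x) => -[h' [_ ->]];
  apply/andP; split; lra.
Qed.

Lemma clampE A x : `|x| < A -> clamp A x = x /\ clamp' A x = 1.
Proof.
rewrite ltr_norml /clamp /clamp' => /andP[h1 h2].
case: (ramp_stepP (- A) x) => -[h [-> ->]]; case: (ramp_stepP A x) => -[h' [-> ->]];
  split; lra.
Qed.

(* The piecewise linear function with nodes at -A, 0, 1/A, A and 2A - 1/A where
   it takes the values -A, 0, 0, A - 1/A and 0.  It vanishes just above 0 because
   u is not known to be regular up to the boundary. *)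
Definition tent A x : R := - A + ramp (- A) x + (-1) * ramp 0 x + ramp A^-1 x +
  (-2) * ramp A x + ramp (2 * A - A^-1) x.
Definition tent' A x : R := 0 + step (- A) x + (-1) * step 0 x + step A^-1 x +
  (-2) * step A x + step (2 * A - A^-1) x.

Lemma primitive_tent A : primitive (tent A) (tent' A).
Proof.
do 4?[apply: primitiveD; last by [exact: primitiveZ (primitive_ramp _)|exact: primitive_ramp]].
exact: primitiveD (primitive_cst _) (primitive_ramp _).
Qed.

Section tent.
Variable A : R.
Hypothesis A_ge1 : 1 <= A.

Let invA : 0 < A^-1 <= 1.
Proof. by have h := A_ge1; have h0 := lt_le_trans ltr01 h; rewrite invr_gt0 invf_le1 ?h0. Qed.

Lemma tent_bound x : `|tent A x| <= A.
Proof.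
have := invA; have h := A_ge1; rewrite /tent; move: (A^-1) => a /andP[a0 a1].
by rewrite ler_norml; ramps; apply/andP; split; lra.
Qed.

Lemma tent'_bound x : `|tent' A x| <= 1.
Proof.
have := invA; have h := A_ge1; rewrite /tent'; move: (A^-1) => a /andP[a0 a1].
rewrite ler_norml.
case: (ramp_stepP (- A) x) => -[h1 [_ ->]]; case: (ramp_stepP 0 x) => -[h2 [_ ->]];
case: (ramp_stepP a x) => -[h3 [_ ->]]; case: (ramp_stepP A x) => -[h4 [_ ->]];
case: (ramp_stepP (2 * A - a) x) => -[h5 [_ ->]]; apply/andP; split; lra.
Qed.

Lemma tent_ge0 x : 0 <= x -> 0 <= tent A x.
Proof.
have := invA; have h := A_ge1; rewrite /tent; move: (A^-1) => a /andP[a0 a1] x0.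
by ramps; lra.
Qed.

Lemma tent_le0 x : x <= 0 -> tent A x <= 0.
Proof.
have := invA; have h := A_ge1; rewrite /tent; move: (A^-1) => a /andP[a0 a1] x0.
by ramps; lra.
Qed.

(** Compactness is sought on the positive side only, since the remainder is integrated over the
    upper half-space alone; below -A the tent keeps the value -A. *)
Lemma tent_supp x : 0 < x -> tent A x != 0 -> A^-1 <= x <= 2 * A.
Proof.
have := invA; have h := A_ge1; rewrite /tent; move: (A^-1) => a /andP[a0 a1] x0.
move=> /eqP t0; rewrite -[_ && _]negbK; apply/negP => /nandP hn; apply: t0.
by move: hn; rewrite -!ltNge; ramps; case=> ?; lra.
Qed.

Lemma tentE x : - A < x < A -> x <= 0 \/ A^-1 < x ->
  `|tent A x - x| <= A^-1 /\ tent' A x = 1.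
Proof.
have := invA; have h := A_ge1; rewrite /tent /tent'; move: (A^-1) => a /andP[a0 a1].
move=> /andP[h1 h2] hx; rewrite ler_norml.
have [-> ->] := ramp_step_gt h1; have [|-> ->] := @ramp_step_le A x; first lra.
have [|-> ->] := @ramp_step_le (2 * A - a) x; first lra.
case: hx => hx.
  have [-> ->] := ramp_step_le hx; have [|-> ->] := @ramp_step_le a x; first lra.
  by split; [apply/andP; split|]; lra.
have [-> ->] := ramp_step_gt hx; have [|-> ->] := @ramp_step_gt 0 x; first lra.
by split; [apply/andP; split|]; lra.
Qed.

End tent.
End profiles.

Section cutoff.
Variables (R : realType) (m : nat) (i : 'I_m.+1) (A : R).
Local Notation rV := 'rV[R]_m.+1.
Hypothesis A_gt0 : 0 < A.

(** It makes the normal field compactly supported in the tangential directions. Its slope 1/A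
    matches the height of the tent, as [product_field_admissible] demands. *)
Definition cutoff (x : rV) : R :=
  Num.max 0 (1 - (\sum_(j | j != i) `|x ord0 j|) / A).

Let l1_ge0 (x : rV) : 0 <= \sum_(j | j != i) `|x ord0 j|.
Proof. exact: sumr_ge0. Qed.

Lemma measurable_cutoff : measurable_fun setT cutoff.
Proof.
apply: measurable_maxr; first exact: measurable_cst.
apply: measurable_funB; first exact: measurable_cst.
apply: measurable_funM; last exact: measurable_cst.
under eq_fun do rewrite big_mkcond.
apply: measurable_sum => j; case: (j != i); last exact: measurable_cst.
by apply: measurableT_comp (measurable_coord j).
Qed.

Lemma cutoff_bounds x : 0 <= cutoff x <= 1.
Proof.
by rewrite /cutoff le_max lexx ge_max ler01 gerBl divr_ge0// ltW.
Qed.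

Lemma cutoff_upd x r : cutoff (upd i x r) = cutoff x.
Proof.
congr (Num.max _ (_ - _ / _)); apply: eq_bigr => j ji.
by rewrite upd_neq.
Qed.

Lemma cutoff_supp x j : j != i -> cutoff x != 0 -> `|x ord0 j| <= A.
Proof.
move=> ji; rewrite leNgt; apply: contra => h.
apply/eqP/max_idPl; rewrite subr_le0 ler_pdivlMr// mul1r.
apply: le_trans (ltW h) _; rewrite (bigD1 j)//= lerDl; exact: sumr_ge0.
Qed.

Lemma cutoff_lipschitz x y :
  A * `|cutoff x - cutoff y| <= m.+1%:R * Num.sqrt (sqn (x - y)).
Proof.
have maxL (a b : R) : `|Num.max 0 a - Num.max 0 b| <= `|a - b|.
  by rewrite /Num.max; case: (ltP 0 a) => ?; case: (ltP 0 b) => ?;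
    rewrite ler_norml; case: (ler0P (a - b)) => ?; apply/andP; split; lra.
apply: (@le_trans _ _ (\sum_(j | j != i) `|x ord0 j - y ord0 j|)).
  apply: (@le_trans _ _ (A * (`|\sum_(j | j != i) `|x ord0 j| - \sum_(j | j != i) `|y ord0 j| | / A))).
    rewrite ler_wpM2l ?(ltW A_gt0)//; apply: le_trans (maxL _ _) _.
    have -> (a b : R) : 1 - a / A - (1 - b / A) = (b - a) / A by ring.
    by rewrite normrM (gtr0_norm (x := A^-1)) ?invr_gt0// distrC.
  rewrite mulrCA divff ?gt_eqF// mulr1 -sumrB.
  apply: le_trans (ler_norm_sum _ _ _) _; apply: ler_sum => j _.
  exact: ler_dist_dist.
apply: (@le_trans _ _ (\sum_(j < m.+1) Num.sqrt (sqn (x - y)))).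
  rewrite big_mkcond; apply: ler_sum => j _; case: ifP => _; last exact: sqrtr_ge0.
  by have := coord_le_sqrt_sqn (x - y) j; rewrite !mxE.
by rewrite sumr_const card_ord -[leLHS]mulr_natl.
Qed.

Lemma cutoff_near1 x : `|cutoff x - 1| <= (\sum_(j | j != i) `|x ord0 j|) / A.
Proof.
have := cutoff_bounds x; rewrite /cutoff => /andP[h0 h1].
rewrite distrC ger0_norm ?subr_ge0//.
have : 1 - (\sum_(j | j != i) `|x ord0 j|) / A <= cutoff x by rewrite /cutoff le_max lexx orbT.
by rewrite /cutoff; lra.
Qed.

End cutoff.

Section fields.
Variables (R : realType) (m : nat).
Local Notation L := (lebesgue_rV R m.+1).
Local Notation rV := 'rV[R]_m.+1.
Local Notation upper := (@upper_half R m).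

(** Only x_i is truncated: the remainder is controlled by translation increments over the whole
    half-space, for which a bounded displacement suffices. *)
Definition tangential_field i A : rV -> R := product_field i (clamp A) (cst 1).
Definition tangential_field' i A : rV -> R := product_field' i (clamp' A) (cst 1).
Definition normal_field A : rV -> R :=
  product_field ord_max (tent A) (cutoff ord_max A).
Definition normal_field' A : rV -> R :=
  product_field' ord_max (tent' A) (cutoff ord_max A).

Lemma tangential_field_admissible i A : i != ord_max -> 0 <= A ->
  admissible_field i (tangential_field i A) (tangential_field' i A) m.+2%:R.
Proof.
move=> im A0.
have ft t x : flow i (tangential_field i A) t x ord0 ord_max = x ord0 ord_max.
  by rewrite /flow /shear upd_neq// eq_sym.
apply: (product_field_admissible (A := A)) => //.
- exact: primitive_clamp.
- by move=> x; exact: clamp_bound.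
- by move=> x; exact: clamp'_bound.
- by move=> x; rewrite ler01 lexx.
- by move=> x y; rewrite subrr normr0 mulr0 mulr_ge0// sqrtr_ge0.
- by move=> t x _; rewrite /upper_half /= ft.
- by move=> t x _; rewrite /lower_half /= ft.
Qed.

(** The tent has the sign of x_n and vanishes at 0, so the flow pushes points away from the boundary
    and none crosses it. *)
Lemma normal_field_admissible A : 1 <= A ->
  admissible_field ord_max (normal_field A) (normal_field' A) m.+2%:R.
Proof.
move=> A1; have A0 : 0 < A by apply: lt_le_trans A1.
have ft t x : flow ord_max (normal_field A) t x ord0 ord_max =
    x ord0 ord_max + t * normal_field A x.
  by rewrite /flow /shear upd_same.
have ge0 t (x : rV) : 0 < t -> 0 <= x ord0 ord_max -> 0 <= t * normal_field A x.
  move=> t0 x0; apply: mulr_ge0; first exact: ltW.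
  apply: mulr_ge0; first exact: tent_ge0.
  by have /andP[] := cutoff_bounds ord_max A0 x.
have le0 t (x : rV) : 0 < t -> x ord0 ord_max <= 0 -> t * normal_field A x <= 0.
  move=> t0 x0; apply: mulr_ge0_le0; first exact: ltW.
  apply: mulr_le0_ge0; first exact: tent_le0.
  by have /andP[] := cutoff_bounds ord_max A0 x.
apply: (product_field_admissible (A := A)) => //.
- exact: primitive_tent.
- exact: tent_bound.
- exact: tent'_bound.
- exact: measurable_cutoff.
- exact: cutoff_bounds.
- exact: cutoff_upd.
- exact: cutoff_lipschitz.
- move=> t x t0; rewrite /upper_half /= ft; have := ge0 t x t0; have := le0 t x t0.
  by case: (ltrP 0 (x ord0 ord_max)) => x0 h1 h2; split => // h3;
    [have := h2 (ltW x0); lra|have := h1 isT; lra].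
- move=> t x t0; rewrite /lower_half /= ft; have := ge0 t x t0; have := le0 t x t0.
  by case: (ltrP (x ord0 ord_max) 0) => x0 h1 h2; split => // h3;
    [have := h1 (ltW x0); lra|have := h2 isT; lra].
Qed.

End fields.

(** The base 3/2 is the ratio between the decay 3^-k of squared increments and the time scale
    2^-k. *)
Lemma exists_expr_ge (R : realType) (X : R) : exists k : nat, X <= (3 / 2) ^+ k.
Proof.
have bern k : 1 + k%:R / 2 <= (3 / 2 : R) ^+ k.
  elim: k => [|k ih]; first by rewrite mul0r addr0 expr0.
  have k0 : 0 <= k%:R :> R by [].
  rewrite exprS -natr1; lra.
exists (Num.truncn (2 * `|X|)).+1; apply: le_trans (bern _).
have := truncnS_gt (2 * `|X|); have := ler_norm X; lra.
Qed.

(** * Remainder estimates for the truncated fields *)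

Section remainders.
Variables (R : realType) (m : nat) (s p M : R) (u : 'rV[R]_m.+1 -> R).
Local Notation L := (lebesgue_rV R m.+1).
Local Notation rV := 'rV[R]_m.+1.
Local Notation upper := (@upper_half R m).
Local Notation c := (frac_laplacian_const m s / 2).

Hypotheses (s_gt0 : 0 < s) (n_gt2s : 2 * s < m.+1%:R) (p_gt1 : 1 < p).
Hypothesis weak_u : weak_solution s p u.
Hypothesis u_bounds : forall x, upper x -> 0 <= u x <= M.
Hypothesis u_C1 : continuously_differentiable_on upper u.

Lemma tangential_remainder i A : i != ord_max -> 1 <= A -> 0 < c ->
  forall e t1 : R, 0 < e -> 0 < t1 -> exists t, 0 < t <= t1 /\
    (\int[L]_(x in upper)
       ((u (flow i (tangential_field i A) t x) - u x) ^+ 2)%:E <= (e * t)%:E)%E.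
Proof.
move=> im A1 c0 e t1 e0 t10.
have A0 : 0 < A by apply: lt_le_trans A1.
have [B [t0 [B0 t00 dec]]] :=
  shift_norm2_decay s_gt0 n_gt2s p_gt1 weak_u u_bounds im c0.
have F := tangential_field_admissible im (ltW A0).
have [mu _ _] : Hs_upper s u by have [] := weak_u.
(* The times are t = d / 2^k, with displacement at most t A. [shear_norm2_le] asks for increments
   with step up to 3 t A, which is exactly t0 / 2^k. *)
pose d := t0 / (3 * A).
have d0 : 0 < d by rewrite divr_gt0// mulr_gt0.
have ed0 : 0 < e * d by rewrite mulr_gt0.
(* The three summands provide in turn t <= t1, the smallness required by [flow_diffeo], and 14 B /
   3^k <= e d / 2^k. *)
have [k hk] := exists_expr_ge (d / t1 + d * (2 * m.+2%:R) + 14 * B / (e * d)).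
have h1 : 0 <= d / t1 by rewrite divr_ge0// ltW.
have h2 : 0 <= d * (2 * m.+2%:R) by rewrite mulr_ge0// ltW.
have h3 : 0 <= 14 * B / (e * d) by rewrite divr_ge0 ?(ltW ed0)// mulr_ge0.
have p2 : 0 < (2 : R) ^+ k by exact: exprn_gt0.
have p3 : 0 < (3 : R) ^+ k by exact: exprn_gt0.
have p32 : (3 / 2 : R) ^+ k <= 2 ^+ k by rewrite lerXn2r ?nnegrE//; lra.
have t_gt0 : 0 < d / 2 ^+ k by rewrite divr_gt0.
exists (d / 2 ^+ k); split.
  rewrite t_gt0 /= ler_pdivrMr//.
  have : d / t1 <= 2 ^+ k by lra.
  by rewrite ler_pdivrMr// mulrC.
have tK : d / 2 ^+ k * (2 * m.+2%:R) <= 1.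
  by rewrite mulrAC ler_pdivrMr// mul1r; lra.
have [Psi D] := flow_diffeo F t_gt0 tK.
have r0 : 0 < d / 2 ^+ k * A by rewrite mulr_gt0.
apply: (@le_trans _ _ (14 * (B / 3 ^+ k))%:E).
  apply: (shear_norm2_le mu D r0).
    move=> x; rewrite normrM gtr0_norm// ler_wpM2l ?(ltW t_gt0)//.
    by rewrite /tangential_field /product_field mulr1 clamp_bound// ltW.
  move=> z /andP[z0 z1]; apply: dec; rewrite z0 /=.
  apply: le_trans z1 _; rewrite /d le_eqVlt; apply/orP; left; apply/eqP.
  by field; rewrite !gt_eqF.
rewrite lee_fin !mulrA ler_pdivrMr//.
have : 14 * B / (e * d) <= (3 / 2) ^+ k by lra.
rewrite ler_pdivrMr// expr_div_n => h; apply: le_trans h _.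
rewrite le_eqVlt; apply/orP; left; apply/eqP.
by rewrite /d; move: (_ ^+ k) (_ ^+ k) => a b; ring.
Qed.

(** Here the remainder is O(t^2): the field moves only points of a compact set [K] on which the
    gradient of u is bounded, so the mean value theorem along e_n applies. *)
Lemma normal_remainder A : 1 <= A ->
  forall e t1 : R, 0 < e -> 0 < t1 -> exists t, 0 < t <= t1 /\
    (\int[L]_(x in upper)
       ((u (flow ord_max (normal_field A) t x) - u x) ^+ 2)%:E <= (e * t)%:E)%E.
Proof.
move=> A1 e t1 e0 t10.
have A0 : 0 < A by apply: lt_le_trans A1.
have F := normal_field_admissible m A1.
have [mu _ _] : Hs_upper s u by have [] := weak_u.
have mup := @measurable_upper R m.
(* The support of the tent reaches at most 2A, and a displacement of at most A, for t <= 1, explains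
   the endpoint 3A. *)
pose I (i : 'I_m.+1) : set R :=
  if i == ord_max then `[A^-1, 3 * A]%classic else `[- A, A]%classic.
pose K : set rV := [set v | forall i, I i (v ord0 i)].
have cK : compact K.
  by apply: (rV_compact (A := I)) => i; rewrite /I; case: ifP => _; exact: segment_compact.
have Ku : K `<=` upper.
  move=> v /(_ ord_max); rewrite /I eqxx /= in_itv/= /upper_half /= => /andP[h _].
  by apply: lt_le_trans h; rewrite invr_gt0.
have [B B0 hB] := grad_bounded_on_compact u_C1 cK Ku.
have mI i : measurable (I i : set (measurableTypeR R)).
  by rewrite /I; case: ifP => _; exact: measurable_itv.
have mK : measurable K by exact: measurable_rV_box mI.
have [V V0 LK] : exists2 V : R, 0 <= V & L K = V%:E.
  have : L K \is a fin_num.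
    rewrite (lebesgue_rV_box mI); apply: prode_fin_num => i _.
    by rewrite /I; case: ifP => _; rewrite lebesgue_measure_itv/=; case: ifP.
  move=> /fineK e1; exists (fine (L K)) => //; exact: fine_ge0.
(* The remainder will be at most Q t^2, hence at most e t once t <= e / (Q + 1). *)
pose Q := (B * A) ^+ 2 * V.
have Q0 : 0 <= Q by rewrite mulr_ge0 ?sqr_ge0.
pose t := Num.min (Num.min 1 t1) (e / (Q + 1)).
have t0 : 0 < t by rewrite !lt_min ltr01 t10 divr_gt0//; lra.
have [t_le1 t_let1 t_le] : [/\ t <= 1, t <= t1 & t <= e / (Q + 1)].
  by split; rewrite /t !ge_min lexx ?orbT.
exists t; split; first by rewrite t0.
have pt x : upper x ->
    (u (flow ord_max (normal_field A) t x) - u x) ^+ 2 <=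
    (B * (t * A)) ^+ 2 * \1_K x.
  move=> xu; have xn0 : 0 < x ord0 ord_max by exact: xu.
  have [z0|nz] := eqVneq (normal_field A x) 0.
    rewrite /flow /shear z0 mulr0 addr0 upd_id subrr expr0n /=.
    by rewrite mulr_ge0 ?sqr_ge0.
  have /andP[b0 b1] := cutoff_bounds ord_max A0 x.
  have [tz cz] : tent A (x ord0 ord_max) != 0 /\ cutoff ord_max A x != 0.
    by move: nz; rewrite /normal_field /product_field mulf_eq0 negb_or => /andP.
  have /andP[xA1 xA2] := tent_supp A1 xn0 tz.
  have inK r : x ord0 ord_max <= r <= x ord0 ord_max + A -> K (upd ord_max x r).
    move=> /andP[r1 r2] i; rewrite /I; case: ifPn => [/eqP ->|im].
      by rewrite upd_same /= in_itv/=; apply/andP; split; lra.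
    by rewrite upd_neq// /= in_itv/= -ler_norml; exact: cutoff_supp cz.
  have Kx : K x.
    by rewrite -(upd_id ord_max x); apply: inK; rewrite lexx lerDl ltW.
  rewrite indicE mem_set// mulr1 -[leLHS]real_normK ?num_real//.
  have nA : 0 <= normal_field A x <= A.
    have h1 := tent_ge0 A1 (ltW xn0); have := tent_bound A1 (x ord0 ord_max).
    rewrite ger0_norm// => h2; rewrite /normal_field /product_field mulr_ge0//=.
    by apply: le_trans h2; rewrite ler_piMr.
  have /andP[n0 n1] := nA.
  have tn0 : 0 <= t * normal_field A x by rewrite mulr_ge0// ltW.
  have tn1 : t * normal_field A x <= t * A by rewrite ler_wpM2l// ltW.
  have tA : t * A <= A by rewrite ler_piMl// ltW.
  rewrite ler_sqr ?nnegrE//; last by rewrite !mulr_ge0// ltW.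
  rewrite /flow /shear -[X in _ - u X](upd_id ord_max x).
  apply: (@le_trans _ _ (B * (x ord0 ord_max + t * normal_field A x - x ord0 ord_max))).
    apply: (partial_lipschitz u_C1); first by rewrite lerDl.
    move=> r /andP[r1 r2].
    have Kr : K (upd ord_max x r) by apply: inK; apply/andP; split; lra.
    by split; [exact: Ku|exact: hB].
  by rewrite addrAC subrr add0r ler_wpM2l.
apply: (@le_trans _ _ (\int[L]_(x in upper) (((B * (t * A)) ^+ 2)%:E * (\1_K x)%:E))%E).
  apply: ge0_le_integral => //.
  - by move=> x _; rewrite lee_fin sqr_ge0.
  - apply: measurable_funTS; apply/measurable_EFinP; apply: measurable_funX.
    apply: measurable_funB => //.
    apply: measurableT_comp mu _; apply: measurable_shear.
    by apply: measurable_funM => //; exact: field_measurable F.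
  - apply: measurable_funTS; apply: emeasurable_funM => //.
    by apply/measurable_EFinP; exact: measurable_indic.
rewrite ge0_integralZl//; last 2 first.
- by apply/measurable_EFinP; apply: measurable_funTS; exact: measurable_indic.
- by rewrite lee_fin sqr_ge0.
rewrite integral_indic//.
apply: (@le_trans _ _ (((B * (t * A)) ^+ 2)%:E * V%:E)%E).
  apply: lee_wpmul2l; first by rewrite lee_fin sqr_ge0.
  by rewrite -LK le_measure ?inE//; exact: measurableI.
rewrite -EFinM lee_fin.
have -> : (B * (t * A)) ^+ 2 * V = t * Q * t by rewrite /Q; ring.
rewrite ler_wpM2r ?(ltW t0)//.
have : t * (Q + 1) <= e by rewrite -ler_pdivlMr//; lra.
lra.
Qed.

End remainders.

(** * Removal of the truncation *)

Section limits.
Variable R : realType.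

Lemma cvg_harmonic_bound (v : R^nat) l S N :
  (forall k, (N <= k)%N -> `|v k - l| <= S / k.+1%:R) -> v @ \oo --> l.
Proof.
move=> h; apply/cvgrPdist_le => e e0.
exists (maxn N (Num.truncn (`|S| / e)).+1) => // k /=; rewrite geq_max => /andP[Nk Sk].
rewrite distrC; apply: le_trans (h _ Nk) _; rewrite ler_pdivrMr//.
apply: le_trans (ler_norm S) _; rewrite -ler_pdivrMl// mulrC.
apply: le_trans (ltW (truncnS_gt _)) _.
by rewrite ler_nat; apply: leq_trans Sk _.
Qed.

Lemma cvg_Rintegral_mul d (T : measurableType d) (mu : {measure set T -> \bar R})
    (D : set T) (f : T -> R) (g : (T -> R)^nat) (l : T -> R) B :
  measurable D -> mu.-integrable D (EFin \o f) ->
  (forall k, measurable_fun D (g k)) -> measurable_fun D l ->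
  (forall k x, D x -> `|g k x| <= B) -> (forall x, D x -> `|l x| <= B) ->
  (forall x, D x -> g ^~ x @ \oo --> l x) ->
  \int[mu]_(x in D) (f x * g k x) @[k --> \oo] --> \int[mu]_(x in D) (f x * l x).
Proof.
move=> mD fi mg ml gB lB gl.
have mf : measurable_fun D f by apply/measurable_EFinP; exact: measurable_int fi.
have il := integrable_mul_bounded mD fi ml lB.
apply: fine_cvg; rewrite fineK; last exact: integrable_fin_num il.
apply: (@dominated_cvg _ _ _ mu D mD (fun k x => (f x * g k x)%:E)
  (fun x => (f x * l x)%:E) (fun x => (B * `|f x|)%:E)) => //.
- by move=> k; apply/measurable_EFinP; exact: measurable_funM.
- move=> x Dx; apply: cvg_EFin; first exact: nearW.
  by apply: cvgMr; exact: gl.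
- have := integrableZl mD B (integrable_abse fi).
  by apply: eq_integrable => // x _; rewrite /= EFinM.
- move=> k x Dx; rewrite /= lee_fin normrM mulrC ler_wpM2r//; exact: gB.
Qed.

End limits.

Section field_limits.
Variables (R : realType) (m : nat).
Local Notation rV := 'rV[R]_m.+1.

Lemma tangential_field_cvg i (x : rV) :
  (fun k => tangential_field i k.+1%:R x) @ \oo --> x ord0 i /\
  (fun k => tangential_field' i k.+1%:R x) @ \oo --> (1 : R).
Proof.
have h k : ((Num.truncn `|x ord0 i|).+1 <= k)%N -> `|x ord0 i| < k.+1%:R.
  move=> hk; apply: lt_le_trans (truncnS_gt _) _.
  by rewrite ler_nat ltnS; exact: ltnW.
split; apply: (@cvg_harmonic_bound _ _ _ 0) => k /h /clampE[e1 e2].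
  by rewrite /tangential_field /product_field e1 mulr1 subrr normr0 mul0r.
by rewrite /tangential_field' /product_field' e2 mulr1 subrr normr0 mul0r.
Qed.

(** Convergence holds at every point: a positive x_n eventually exceeds 1/(k+1), and for x_n <= 0
    the tent is exact as soon as k + 1 > -x_n. *)
Lemma normal_field_cvg (x : rV) :
  (fun k => normal_field k.+1%:R x) @ \oo --> x ord0 ord_max /\
  (fun k => normal_field' k.+1%:R x) @ \oo --> (1 : R).
Proof.
pose r := x ord0 ord_max.
have h k : ((Num.truncn (`|r| + `|r^-1|)).+1 <= k)%N ->
    - k.+1%:R < r < k.+1%:R /\ (r <= 0 \/ k.+1%:R^-1 < r).
  move=> hk; have : `|r| + `|r^-1| < k.+1%:R.
    apply: lt_le_trans (truncnS_gt _) _.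
    by rewrite ler_nat ltnS; exact: ltnW.
  move=> hr; split.
    rewrite -ltr_norml; apply: le_lt_trans hr; by rewrite lerDl.
  have [r0|r0] := lerP r 0; [by left|right].
  rewrite -[ltRHS]invrK ltf_pV2 ?posrE ?invr_gt0//.
  apply: le_lt_trans hr; apply: le_trans (ler_norm _) _; by rewrite lerDr.
have c1 : (fun k => cutoff ord_max k.+1%:R x) @ \oo --> (1 : R).
  by apply: (@cvg_harmonic_bound _ _ _ _ 0) => k _; exact: cutoff_near1.
have A1 k : 1 <= k.+1%:R :> R by rewrite ler1n.
split.
  rewrite -[X in _ --> X]mulr1; apply: cvgM c1.
  apply: (@cvg_harmonic_bound _ _ _ 1) => k /h[h1 h2]; rewrite div1r.
  by have [] := tentE (A1 k) h1 h2.
rewrite -[X in _ --> X]mulr1; apply: cvgM c1.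
apply: (@cvg_harmonic_bound _ _ _ 0) => k /h[h1 h2]; rewrite mul0r.
by have [_ ->] := tentE (A1 k) h1 h2; rewrite subrr normr0.
Qed.

End field_limits.

(** * The Pohozaev inequality *)

Section pohozaev.
Variables (R : realType) (m : nat) (s p M : R) (u : 'rV[R]_m.+1 -> R).
Local Notation L := (lebesgue_rV R m.+1).
Local Notation L2 := (L \x L)%E.
Local Notation rV := 'rV[R]_m.+1.
Local Notation upper := (@upper_half R m).
Local Notation TT := (@T_upper R m).
Local Notation c := (frac_laplacian_const m s / 2).
Local Notation coordinate i := (fun x : rV => x ord0 i).

Hypotheses (s_gt0 : 0 < s) (n_gt2s : 2 * s < m.+1%:R) (p_gt1 : 1 < p).
Hypothesis weak_u : weak_solution s p u.
Hypothesis u_bounds : forall x, upper x -> 0 <= u x <= M.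
Hypothesis u_C1 : continuously_differentiable_on upper u.

Let hu : Hs_upper s u. Proof. by have [] := weak_u. Qed.

Let a := m.+1%:R + 2 * s.

Let a_gt0 : 0 < a. Proof. by rewrite addr_gt0// mulr_gt0. Qed.

Let density i (z : rV * rV) : R := energy_density i (coordinate i) (cst 1) s z.

Let densityE i z : density i z = 2 - a * ((z.1 - z.2) ord0 i ^+ 2 / sqn (z.1 - z.2)).
Proof. by rewrite /density /energy_density /stretch /= !mxE expr2. Qed.

Let density_bound i z : `|density i z| <= 2 + a.
Proof.
have : 0 <= (z.1 - z.2) ord0 i ^+ 2 / sqn (z.1 - z.2) <= 1.
  rewrite divr_ge0 ?sqr_ge0 ?sqn_ge0//=.
  have [->|z0] := eqVneq (z.1 - z.2) 0; first by rewrite mxE expr0n mul0r.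
  by rewrite ler_pdivrMr ?sqn_gt0// mul1r sqr_coord_le_sqn.
move=> /andP[h1 h2]; rewrite densityE; apply: le_trans (ler_normB _ _) _.
rewrite normr_nat lerD2l normrM (gtr0_norm a_gt0) ger0_norm//.
by rewrite ler_piMr// ltW.
Qed.

Let measurable_density i : measurable_fun setT (density i).
Proof.
have mc : measurable_fun setT (coordinate i) by exact: measurable_coord.
rewrite /density /energy_density; apply: measurable_funB.
  by apply: measurable_funD; exact: measurable_cst.
apply: measurable_funM; [exact: measurable_cst|exact: measurable_stretch mc].
Qed.

(** Since [K] is common to all k, both variations are dominated by multiples of the fixed integrands
    u^(p+1) and [gagliardo_integrand s u u]. *)
Lemma coordinate_inequality i (phi J : nat -> rV -> R) K :
  (forall k, admissible_field i (phi k) (J k) K) ->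
  (forall x, phi ^~ x @ \oo --> x ord0 i) -> (forall x, J ^~ x @ \oo --> (1 : R)) ->
  (forall k (e t1 : R), 0 < e -> 0 < t1 -> exists t, 0 < t <= t1 /\
    (\int[L]_(x in upper) ((u (flow i (phi k) t x) - u x) ^+ 2)%:E <= (e * t)%:E)%E) ->
  2 / (p + 1) * potential p u <=
    c * \int[L2]_(z in TT) (gagliardo_integrand s u u z * density i z).
Proof.
move=> F phi_cvg J_cvg rem.
have K0 := field_bound_ge0 (F 0).
have potential_cvg : potential_variation p u (J k) @[k --> \oo] --> potential p u.
  have -> : potential p u = \int[L]_(x in upper) (u x `^ (p + 1) * cst 1 x).
    by apply: eq_Rintegral => x _; rewrite mulr1.
  (* The bound is enlarged to 1 + K because it must also cover the limit, the constant 1. *)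
  apply: (@cvg_Rintegral_mul _ _ _ _ _ _ _ _ (1 + K)).
  - exact: measurable_upper.
  - exact: integrable_potential weak_u u_bounds.
  - by move=> k; apply: measurable_funTS; exact: field_deriv_measurable (F k).
  - exact: measurable_cst.
  - by move=> k x _; apply: le_trans (field_deriv_bound (F k) x) _; rewrite lerDr.
  - by move=> x _; rewrite normr1 lerDl.
  - by move=> x _; exact: J_cvg.
have energy_cvg : energy_variation i (phi k) (J k) s u @[k --> \oo] -->
    \int[L2]_(z in TT) (gagliardo_integrand s u u z * density i z).
  apply: (@cvg_Rintegral_mul _ _ _ _ _ _ _ _ ((2 + a) * (1 + K))).
  - exact: measurable_T_upper.
  - exact: integrable_gagliardo_sqr.
  - by move=> k; apply: measurable_funTS; exact: measurable_energy_density (F k) _.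
  - exact: measurable_funTS (measurable_density i).
  - move=> k x _; apply: le_trans (energy_density_bound (F k) s_gt0 x) _.
    by rewrite -/a ler_pM2l ?lerDr//; have := a_gt0; lra.
  - move=> x _; apply: le_trans (density_bound i x) _.
    have a0 := a_gt0; have : 0 <= (2 + a) * K by rewrite mulr_ge0//; lra.
    lra.
  - move=> z _; apply: cvgB; first by apply: cvgD; exact: J_cvg.
    apply: cvgMr; apply: cvgMl; apply: cvgMr; apply: cvgB; exact: phi_cvg.
have h1 : 2 / (p + 1) * potential_variation p u (J k) @[k --> \oo] -->
    2 / (p + 1) * potential p u by exact: cvgMr.
have h2 : c * energy_variation i (phi k) (J k) s u @[k --> \oo] -->
    c * \int[L2]_(z in TT) (gagliardo_integrand s u u z * density i z) by exact: cvgMr.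
apply: (ler_cvg_to h1 h2).
apply: nearW => k.
exact: (field_inequality s_gt0 n_gt2s p_gt1 weak_u u_bounds (F k) (rem k)).
Qed.

Lemma coordinate_inequalities i : 0 < c ->
  2 / (p + 1) * potential p u <=
    c * \int[L2]_(z in TT) (gagliardo_integrand s u u z * density i z).
Proof.
move=> c0; have A1 k : 1 <= k.+1%:R :> R by rewrite ler1n.
have [->|im] := eqVneq i ord_max.
  apply: (@coordinate_inequality _ (fun k => normal_field k.+1%:R)
    (fun k => normal_field' k.+1%:R) m.+2%:R).
  - by move=> k; exact: normal_field_admissible.
  - by move=> x; have [] := normal_field_cvg x.
  - by move=> x; have [] := normal_field_cvg x.
  - by move=> k; exact: (normal_remainder weak_u u_C1).
apply: (@coordinate_inequality _ (fun k => tangential_field i k.+1%:R)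
  (fun k => tangential_field' i k.+1%:R) m.+2%:R).
- by move=> k; exact: tangential_field_admissible.
- by move=> x; have [] := tangential_field_cvg i x.
- by move=> x; have [] := tangential_field_cvg i x.
- by move=> k; exact: (tangential_remainder s_gt0 n_gt2s p_gt1 weak_u u_bounds).
Qed.

(** The quotients z_i^2 / |z|^2 sum to 1, so the densities sum to 2n - (n + 2s), the scaling
    exponent of the energy under dilations. *)
Lemma sum_density :
  \sum_i \int[L2]_(z in TT) (gagliardo_integrand s u u z * density i z) =
  (m.+1%:R - 2 * s) * energy s u u.
Proof.
have mT := @measurable_T_upper R m.
have ig := integrable_gagliardo_sqr hu.
have ii i := integrable_mul_bounded mT ig (measurable_funTS (measurable_density i))
  (fun z _ => density_bound i z).
transitivity (fine (\sum_i \int[L2]_(z in TT)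
    (gagliardo_integrand s u u z * density i z)%:E)%E).
  apply: sum_fine => i _; exact: integrable_fin_num (ii i).
rewrite -(integral_sum mT ii).
transitivity (fine (\int[L2]_(z in TT) ((m.+1%:R - 2 * s)%:E * (gagliardo_integrand s u u z)%:E))%E).
  congr fine; apply: eq_integral => z _.
  rewrite sumEFin -EFinM; congr EFin; rewrite -mulr_sumr mulrC.
  (* On the diagonal the quotients are 0 by the convention on inverses and the sum is different, but
     there the energy integrand vanishes. *)
  have [z0|z0] := eqVneq z.1 z.2.
    by rewrite /gagliardo_integrand z0 subrr !mul0r !mulr0.
  congr (_ * _); under eq_bigr do rewrite densityE.
  rewrite sumrB sumr_const card_ord -mulr_sumr -mulr_suml -/(sqn _).
  rewrite divff ?mulr1 ?gt_eqF ?sqn_gt0 ?subr_eq0// /a -[2 *+ _]mulr_natl; ring.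
rewrite (integralZl mT ig) fineM//; first exact: integrable_fin_num ig.
Qed.

Lemma potential_eq0 : p < (m.+1%:R + 2 * s) / (m.+1%:R - 2 * s) ->
  potential p u = 0.
Proof.
move=> p_sub.
have EP := energy_potential p_gt1 weak_u u_bounds.
have P0 : 0 <= potential p u by apply: Rintegral_ge0 => x _; exact: powR_ge0.
have : 0 <= c by exact: frac_laplacian_const_ge0.
(* If c = 0, testing the equation with u already gives Q = c E = 0. *)
rewrite le_eqVlt => /orP[/eqP c0|c0]; first by rewrite -EP -c0 mul0r.
have : \sum_(i < m.+1) (2 / (p + 1) * potential p u) <=
    \sum_i c * \int[L2]_(z in TT) (gagliardo_integrand s u u z * density i z).
  by apply: ler_sum => i _; exact: coordinate_inequalities.
rewrite sumr_const card_ord -[leLHS]mulr_natl -mulr_sumr sum_density [leRHS]mulrCA EP.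
have p1 : 0 < p + 1 by have := p_gt1; lra.
have ns : 0 < m.+1%:R - 2 * s by have := n_gt2s; lra.
move: p_sub; rewrite ltr_pdivlMr// => p_sub.
rewrite !mulrA -subr_le0 -mulrBl => h.
(* Subcriticality p (n - 2s) < n + 2s is the same as (p + 1)(n - 2s) < 2n. *)
have : 0 < m.+1%:R * 2 / (p + 1) - (m.+1%:R - 2 * s).
  by rewrite subr_gt0 ltr_pdivlMr//; lra.
move=> q0; apply/eqP; rewrite eq_le P0 andbT.
by move: h; rewrite pmulr_rle0.
Qed.

Lemma weak_solution_eq0 : p < (m.+1%:R + 2 * s) / (m.+1%:R - 2 * s) ->
  forall x, upper x -> u x = 0.
Proof.
move=> p_sub; have [mu _ _] := hu.
apply: (ae_upper_closed (D := [set 0]) u_C1).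
  rewrite (_ : [set 0] = [set x : R | x <= 0] `&` [set x | 0 <= x]).
    by apply: closedI; [exact: closed_le|exact: closed_ge].
  by apply/seteqP; split => [x -> /=|x [h1 h2]]; [split|apply/eqP; rewrite eq_le h1].
have mup := @measurable_upper R m.
have iP := integrable_potential p_gt1 weak_u u_bounds.
have := potential_eq0 p_sub; rewrite /potential /Rintegral => h.
have : (\int[L]_(x in upper) `|(u x `^ (p + 1))%:E| = 0)%E.
  rewrite -[RHS](_ : (0%R)%:E = _)// -h fineK; last exact: integrable_fin_num iP.
  by apply: eq_integral => x _; rewrite gee0_abs// lee_fin powR_ge0.
move/(ae_eq_integral_abs L mup (measurable_int _ iP)).
apply: filterS => x /= hx xu; have [] := hx xu.
move=> /eqP; rewrite powR_eq0 => /andP[/eqP //].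
Qed.

End pohozaev.

Lemma grad_eq0 (R : realType) m (u : 'rV[R]_m.+1 -> R) x :
  (forall y, upper_half y -> u y = 0) -> upper_half x -> grad u x = 0.
Proof.
move=> u0 xu; apply/rowP => i; rewrite !mxE.
rewrite (@near_eq_derive _ _ _ u (cst 0)) ?derive_cst//.
have xn0 : 0 < x ord0 ord_max by exact: xu.
apply/nbhs_ballP; exists (x ord0 ord_max) => //= y [_ /(_ ord0 ord_max)].
rewrite /ball /= ltr_distlC => /andP[h _]; apply: u0.
by rewrite /upper_half /=; lra.
Qed.

Theorem lemma1p6 (R : realType) (m : nat) (s p : R)
  (s_gt0 : 0 < s) (s_lt1 : s < 1)
  (n_gt2s : 2 * s < m.+1%:R)
  (p_gt1 : 1 < p) (p_subcritical : p < (m.+1%:R + 2 * s) / (m.+1%:R - 2 * s)) :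
  exists C : R, forall u : 'rV[R]_m.+1 -> R,
    weak_solution s p u ->
    bounded_ae_upper u ->
    continuously_differentiable_on (@upper_half R m) u ->
    forall x : 'rV[R]_m.+1, upper_half x ->
      u x + enorm (grad u x) `^ (2 * s / (2 * s + p - 1))
        <= C * (x ord0 ord_max) `^ (- (2 * s / (p - 1))).
Proof.
exists 0 => u weak_u [M u_le] u_C1 x xu; have [_ u_ge0 _] := weak_u.
have u_bounds y : upper_half y -> 0 <= u y <= M.
  move=> yu; apply/andP; split.
    exact: (ae_upper_closed (D := [set r | 0 <= r]) u_C1 (@closed_ge R 0) u_ge0 yu).
  apply: (ae_upper_closed (D := [set r | r <= M]) u_C1 (@closed_le R M) _ yu).
  by apply: filterS u_le => z h /h; exact: le_trans (ler_norm _).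
have u0 := weak_solution_eq0 s_gt0 n_gt2s p_gt1 weak_u u_bounds u_C1 p_subcritical.
rewrite u0// (grad_eq0 u0 xu) mul0r add0r.
have -> : enorm (0 : 'rV[R]_m.+1) = 0.
  by rewrite /enorm big1 ?sqrtr0// => i _; rewrite mxE expr0n.
(* The power of 0 is 0 because the exponent 2s/(2s + p - 1) is positive; with exponent 0 it would be
   1. *)
by rewrite powR0// gt_eqF// divr_gt0//; lra.
Qed.
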